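(* Let $Q$ be a tame quiver without oriented cycles and $\mathbf{k}$ a finite field. Let $P,P'$ be indecomposable preprojective $\mathbf{k}Q$-modules of defect $-1$, let $R$ be an indecomposable regular $\mathbf{k}Q$-module and let $R'$ be a regular $\mathbf{k}Q$-module (possibly zero). Then there exists a short exact sequence $$0\longrightarrow P\longrightarrow P'\oplus R'\longrightarrow R\longrightarrow 0$$ if and only if $R'$ is (isomorphic to) a submodule of $R$ such that there is a short exact sequence $$0\longrightarrow P\longrightarrow P'\longrightarrow R/R'\longrightarrow 0.$$ In this case, we have $$F_{RP}^{P'\oplus R'}=\begin{cases}|\mathrm{Hom}(P,R)|,&\text{if }R\cong R';\\ a_{R'},&\text{if }R\not\cong R'.\end{cases}$$
   Context: A tame quiver is a (connected) quiver whose underlying graph is an extended Dynkin diagram of type $\widetilde{\mathbb{A}},\widetilde{\mathbb{D}},\widetilde{\mathbb{E}}_6,\widetilde{\mathbb{E}}_7$ or $\widetilde{\mathbb{E}}_8$. $\mathbf{k}Q$-modules are finite dimensional left modules over the path algebra; each indecomposable one is preprojective, regular or preinjective, and a regular module is a direct sum of indecomposable regular ones. The defect of $M$ is $\langle\delta,[M]\rangle$, where $\langle-,-\rangle$ is the Euler form and $\delta$ is the minimal positive imaginary root (so indecomposable preprojectives have negative defect). Hall number: $F_{MN}^{L}=|\{X\subseteq L\mid X\cong N,\ L/X\cong M\}|$. For a module $M$, $a_M=|\mathrm{Aut}(M)|$ (so $a_0=1$). *)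

(* Defs.v *)
From HB Require Import structures.
From mathcomp Require Import all_boot all_order all_algebra.
From mathcomp Require Import finmap.
From mathcomp Require Import boolp classical_sets cardinality.
Set Implicit Arguments.
Unset Strict Implicit.
Unset Printing Implicit Defensive.
Import GRing.Theory Num.Theory.
Local Open Scope ring_scope.

Record quiver := Quiver {
  vtx : finType;
  arr : finType;
  src : arr -> vtx;
  tgt : arr -> vtx }.

Definition op_quiver (Q : quiver) := Quiver (@tgt Q) (@src Q).

Section Paths.
Variable Q : quiver.
Implicit Types (i : vtx Q) (s : seq (arr Q)).

(* A path is a starting vertex together with the sequence of its arrows, the  *)
(* first arrow traversed being the head of the sequence.                      *)
Fixpoint is_qpath i s : bool :=
  if s is a :: s' then (src a == i) && is_qpath (tgt a) s' else true.

Definition qend i s : vtx Q := last i (map (@tgt Q) s).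

Definition acyclic := forall i s, is_qpath i s -> qend i s = i -> s = [::].

(* The basis of the path algebra of an acyclic quiver: a path visits no vertex *)
(* twice, so that the bound on the length excludes nothing in that case.      *)
Definition qpath := {x : vtx Q * (#|vtx Q|).-bseq (arr Q) | is_qpath x.1 x.2}.

Definition pstart (p : qpath) : vtx Q := (val p).1.
Definition parrows (p : qpath) : seq (arr Q) := (val p).2.
Definition pend (p : qpath) : vtx Q := qend (pstart p) (parrows p).

End Paths.

Arguments acyclic : clear implicits.
Arguments qpath : clear implicits.

(* A multigraph with vertices 0, ..., n-1 is given by the list of its edges;  *)
(* an edge occurs in one of its two orientations, once per multiplicity.      *)
Definition edge_mult (e : seq (nat * nat)) (i j : nat) : nat :=
  count [pred x | (x == (i, j)) || (x == (j, i))] e.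

Definition arrow_mult (Q : quiver) (i j : vtx Q) : nat :=
  #|[set a : arr Q | ((src a, tgt a) == (i, j)) || ((src a, tgt a) == (j, i))]|.

Definition underlying_graph_is (Q : quiver) (n : nat) (e : seq (nat * nat)) :=
  exists f : vtx Q -> 'I_n,
    bijective f /\ forall i j, arrow_mult i j = edge_mult e (f i) (f j).

Definition edges_affA (n : nat) : seq (nat * nat) :=
  (n, 0)%N :: [seq (i, i.+1) | i <- iota 0 n].
Definition edges_affD (n : nat) : seq (nat * nat) :=
  [:: (0, 2); (1, 2); (n - 2, n - 1); (n - 2, n)]%N
    ++ [seq (i, i.+1) | i <- iota 2 (n - 4)].
Definition edges_affE6 : seq (nat * nat) :=
  [:: (0, 1); (1, 2); (0, 3); (3, 4); (0, 5); (5, 6)]%N.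
Definition edges_affE7 : seq (nat * nat) :=
  [:: (0, 1); (1, 2); (2, 3); (0, 4); (4, 5); (5, 6); (0, 7)]%N.
Definition edges_affE8 : seq (nat * nat) :=
  [:: (0, 1); (1, 2); (2, 3); (3, 4); (4, 5); (0, 6); (6, 7); (0, 8)]%N.

Definition tame (Q : quiver) : Prop :=
  [\/ exists n : nat, underlying_graph_is Q n.+1 (edges_affA n),
      exists2 n : nat, (4 <= n)%N & underlying_graph_is Q n.+1 (edges_affD n) |
      [\/ underlying_graph_is Q 7 edges_affE6,
          underlying_graph_is Q 8 edges_affE7 |
          underlying_graph_is Q 9 edges_affE8]].

Section Roots.
Variable Q : quiver.
Implicit Types x y : {ffun vtx Q -> int}.

Definition euler x y : int :=
  \sum_(i : vtx Q) x i * y i - \sum_(a : arr Q) x (src a) * y (tgt a).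

(* For an extended Dynkin graph, the imaginary roots are the nonzero vectors  *)
(* on which the Tits form x |-> <x, x> vanishes.                              *)
Definition pos_imag_root x : Prop :=
  [/\ x != 0, forall i, 0 <= x i & euler x x = 0].

Definition min_pos_imag_root x : Prop :=
  pos_imag_root x /\
  forall y, pos_imag_root y -> (forall i, y i <= x i) -> y = x.

End Roots.

(* A finite dimensional left module over the path algebra kQ, which is        *)
(* generated by the e_i and the arrows subject to e_i e_j = [i = j] e_i,      *)
(* sum_i e_i = 1 and a = e_(tgt a) a e_(src a).                               *)
Record kQmodule (k : fieldType) (Q : quiver) := KQModule {
  kQsort :> vectType k;
  idem : vtx Q -> 'End(kQsort);
  arrow : arr Q -> 'End(kQsort);
  idemM : forall i j, (idem i \o idem j)%VF = if i == j then idem i else 0;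
  idem_sum : \sum_i idem i = \1%VF;
  arrowE : forall a, arrow a = (idem (tgt a) \o arrow a \o idem (src a))%VF }.

Arguments idem {k Q} _ _.
Arguments arrow {k Q} _ _.

Section Modules.
Variables (k : fieldType) (Q : quiver).
Implicit Types L M N : kQmodule k Q.

Definition is_hom M N (f : 'Hom(M, N)) : bool :=
  [forall i, (f \o idem M i)%VF == (idem N i \o f)%VF] &&
  [forall a, (f \o arrow M a)%VF == (arrow N a \o f)%VF].

Definition is_iso M N (f : 'Hom(M, N)) : bool :=
  [&& is_hom f, lker f == 0%VS & limg f == fullv].

Definition isom M N : Prop := exists f : 'Hom(M, N), is_iso f.

Definition short_exact L M N : Prop :=
  exists (f : 'Hom(L, M)) (g : 'Hom(M, N)),
    [/\ is_hom f, is_hom g, lker f = 0%VS, limg f = lker g & limg g = fullv].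

Definition is_zero M : Prop := \dim {:M} = 0%N.

Definition dimvec M : {ffun vtx Q -> int} :=
  [ffun i => Posz (\dim (limg (idem M i)))].

Definition defect (delta : {ffun vtx Q -> int}) M : int :=
  euler delta (dimvec M).

Definition is_submod M (X : {vspace M}) : bool :=
  [forall i, (idem M i @: X <= X)%VS] && [forall a, (arrow M a @: X <= X)%VS].

Lemma submod_idem M (X : {vspace M}) i u :
  is_submod X -> u \in X -> idem M i u \in X.
Proof.
by case/andP=> /forallP/(_ i) h _ uX; apply: (subvP h); apply: memv_img.
Qed.

Lemma submod_arrow M (X : {vspace M}) a u :
  is_submod X -> u \in X -> arrow M a u \in X.
Proof.
by case/andP=> _ /forallP/(_ a) h uX; apply: (subvP h); apply: memv_img.
Qed.

Lemma idem_app M i j (u : M) :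
  idem M i (idem M j u) = if i == j then idem M i u else 0.
Proof.
by rewrite -comp_lfunE idemM; case: eqP => // _; rewrite zero_lfunE.
Qed.

Lemma idem_sum_app M (u : M) : \sum_i idem M i u = u.
Proof. by rewrite -sum_lfunE idem_sum id_lfunE. Qed.

Lemma arrow_app M a (u : M) :
  idem M (tgt a) (arrow M a (idem M (src a) u)) = arrow M a u.
Proof. by rewrite [in RHS]arrowE !comp_lfunE. Qed.

Section ZeroModule.

Let z : 'End('rV[k]_0) := 0.

Fact zero_lfun_eq (f g : 'End('rV[k]_0)) : f = g.
Proof. by apply/lfunP=> u; rewrite [LHS]thinmx0 [RHS]thinmx0. Qed.

Definition zero_mod : kQmodule k Q :=
  @KQModule k Q 'rV[k]_0 (fun=> z) (fun=> z)
    (fun _ _ => zero_lfun_eq _ _) (zero_lfun_eq _ _)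
    (fun _ => zero_lfun_eq _ _).

End ZeroModule.

Section DirectSum.
Variables M N : kQmodule k Q.

Definition pair_fun (f : 'End(M)) (g : 'End(N)) (u : (M * N)%type) :
  (M * N)%type := (f u.1, g u.2).

Fact pair_fun_linear f g : linear (pair_fun f g).
Proof. by move=> c [u1 u2] [v1 v2]; rewrite /pair_fun /= !linearP. Qed.
HB.instance Definition _ f g :=
  GRing.isLinear.Build k (M * N)%type (M * N)%type _ (pair_fun f g)
    (pair_fun_linear f g).

Definition pair_lfun f g : 'End((M * N)%type) := linfun (pair_fun f g).

Fact dsum_idemM i j :
  (pair_lfun (idem M i) (idem N i) \o pair_lfun (idem M j) (idem N j))%VF =
  if i == j then pair_lfun (idem M i) (idem N i) else 0.
Proof.
apply/lfunP=> u; rewrite comp_lfunE !lfunE /= /pair_fun /= !idem_app.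
by case: eqP => _; rewrite ?lfunE //= zero_lfunE.
Qed.

Fact dsum_idem_sum : \sum_i pair_lfun (idem M i) (idem N i) = \1%VF.
Proof.
apply/lfunP=> u; rewrite sum_lfunE id_lfunE.
rewrite (eq_bigr (fun i => (idem M i u.1, idem N i u.2))); last first.
  by move=> i _; rewrite lfunE.
rewrite [LHS]surjective_pairing !raddf_sum /= !idem_sum_app.
by rewrite -surjective_pairing.
Qed.

Fact dsum_arrowE a : pair_lfun (arrow M a) (arrow N a) =
  (pair_lfun (idem M (tgt a)) (idem N (tgt a)) \o
   pair_lfun (arrow M a) (arrow N a) \o
   pair_lfun (idem M (src a)) (idem N (src a)))%VF.
Proof.
by apply/lfunP=> u; rewrite !comp_lfunE !lfunE /= /pair_fun /= !arrow_app.
Qed.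

Definition dsum : kQmodule k Q :=
  KQModule dsum_idemM dsum_idem_sum dsum_arrowE.

End DirectSum.

Section Submodule.
Variables (M : kQmodule k Q) (X : {vspace M}) (sX : is_submod X).

Definition res_lfun (f : 'End(M)) : 'End(subvs_of X) :=
  (linfun (vsproj X) \o f \o linfun vsval)%VF.

Fact res_lfunE f u : res_lfun f u = vsproj X (f (vsval u)).
Proof. by rewrite !comp_lfunE !lfunE. Qed.

Fact sub_idemM i j :
  (res_lfun (idem M i) \o res_lfun (idem M j))%VF =
  if i == j then res_lfun (idem M i) else 0.
Proof.
apply/lfunP=> u; rewrite comp_lfunE !res_lfunE vsprojK; last first.
  exact: submod_idem sX (subvsP u).
rewrite idem_app; case: eqP => _; first by rewrite res_lfunE.
by rewrite zero_lfunE linear0.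
Qed.

Fact sub_idem_sum : \sum_i res_lfun (idem M i) = \1%VF.
Proof.
apply/lfunP=> u; rewrite sum_lfunE id_lfunE.
under eq_bigr do rewrite res_lfunE.
by rewrite -linear_sum /= idem_sum_app vsvalK.
Qed.

Fact sub_arrowE a : res_lfun (arrow M a) =
  (res_lfun (idem M (tgt a)) \o res_lfun (arrow M a) \o
   res_lfun (idem M (src a)))%VF.
Proof.
apply/lfunP=> u; rewrite 2!comp_lfunE !res_lfunE.
rewrite [vsval (vsproj X (idem _ _ _))]vsprojK; last first.
  exact: submod_idem sX (subvsP u).
rewrite vsprojK ?arrow_app //.
by apply: submod_arrow => //; apply: submod_idem sX (subvsP u).
Qed.

Definition submod : kQmodule k Q := KQModule sub_idemM sub_idem_sum sub_arrowE.

End Submodule.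

(* The quotient M / X is carried by a complement of X in M, on which M is     *)
(* projected along X; see quo_proj_hom, lker_quo_proj and limg_quo_proj.      *)
Section Quotient.
Variables (M : kQmodule k Q) (X : {vspace M}) (sX : is_submod X).

Definition quo_proj : 'Hom(M, subvs_of X^C) :=
  linfun (vsproj X^C \o daddv_pi X^C X).

Definition quo_incl : 'Hom(subvs_of X^C, M) := linfun vsval.

Definition quo_lfun (f : 'End(M)) : 'End(subvs_of X^C) :=
  (quo_proj \o f \o quo_incl)%VF.

Fact quo_cap : (X^C :&: X = 0)%VS.
Proof. by rewrite capvC capv_compl. Qed.

Fact quo_projK (u : M) : u - quo_incl (quo_proj u) \in X.
Proof.
rewrite !lfunE /= vsprojK ?memv_pi //.
have uE : daddv_pi X^C X u + daddv_pi X X^C u = u.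
  by apply: daddv_pi_add; rewrite ?quo_cap // addvC addv_complf memvf.
by rewrite -{1}uE addrC addKr memv_pi.
Qed.

Fact quo_inclK u : quo_proj (quo_incl u) = u.
Proof.
rewrite !lfunE /= daddv_pi_id ?vsvalK //; [exact: quo_cap | exact: subvsP].
Qed.

Fact quo_proj0 u : (quo_proj u == 0) = (u \in X).
Proof.
apply/eqP/idP => [u0|uX]; first by have := quo_projK u; rewrite u0 linear0 subr0.
have := daddv_pi_add quo_cap (w := u); rewrite addvC addv_complf memvf.
rewrite [daddv_pi X X^C u]daddv_pi_id ?capv_compl // => /(_ isT).
by move/(canRL (addrK _)); rewrite subrr lfunE /= => ->; rewrite linear0.
Qed.

Fact quo_projE u v : u - v \in X -> quo_proj u = quo_proj v.
Proof. by rewrite -quo_proj0 linearB subr_eq0 => /eqP. Qed.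

Fact quo_lfunE (f : 'End(M)) : (forall u, u \in X -> f u \in X) ->
  forall u, quo_lfun f (quo_proj u) = quo_proj (f u).
Proof.
move=> fX u; rewrite !comp_lfunE; apply: quo_projE.
by rewrite -linearB -opprB linearN memvN; apply/fX/quo_projK.
Qed.

Let idX i u (uX : u \in X) := submod_idem i sX uX.
Let arX a u (uX : u \in X) := submod_arrow a sX uX.

Fact quo_idemM i j :
  (quo_lfun (idem M i) \o quo_lfun (idem M j))%VF =
  if i == j then quo_lfun (idem M i) else 0.
Proof.
apply/lfunP=> u; rewrite -(quo_inclK u) comp_lfunE.
rewrite !(quo_lfunE (idX _)) idem_app; case: eqP => _.
  by rewrite (quo_lfunE (idX _)).
by rewrite zero_lfunE linear0.
Qed.

Fact quo_idem_sum : \sum_i quo_lfun (idem M i) = \1%VF.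
Proof.
apply/lfunP=> u; rewrite -(quo_inclK u) sum_lfunE id_lfunE.
under eq_bigr do rewrite (quo_lfunE (idX _)).
by rewrite -linear_sum idem_sum_app.
Qed.

Fact quo_arrowE a : quo_lfun (arrow M a) =
  (quo_lfun (idem M (tgt a)) \o quo_lfun (arrow M a) \o
   quo_lfun (idem M (src a)))%VF.
Proof.
apply/lfunP=> u; rewrite -(quo_inclK u) 2!comp_lfunE.
by rewrite !(quo_lfunE (idX _), quo_lfunE (arX _)) arrow_app.
Qed.

Definition quomod : kQmodule k Q := KQModule quo_idemM quo_idem_sum quo_arrowE.

Lemma quo_proj_hom : is_hom (quo_proj : 'Hom(M, quomod)).
Proof.
apply/andP; split; apply/forallP=> x; apply/eqP/lfunP=> u.
  rewrite comp_lfunE [RHS]comp_lfunE; exact/esym/(quo_lfunE (idX x)).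
rewrite comp_lfunE [RHS]comp_lfunE; exact/esym/(quo_lfunE (arX x)).
Qed.

Lemma lker_quo_proj : lker quo_proj = X.
Proof. by apply/vspaceP=> u; rewrite memv_ker quo_proj0. Qed.

Lemma limg_quo_proj : limg quo_proj = fullv.
Proof.
by apply/vspaceP=> u; rewrite memvf -(quo_inclK u) memv_img ?memvf.
Qed.

End Quotient.

Definition indecomposable M : Prop :=
  ~ is_zero M /\ forall X Y, isom M (dsum X Y) -> is_zero X \/ is_zero Y.

Definition hom_set M N : set 'Hom(M, N) := [set f | is_hom f]%classic.

Definition aut_set M : set 'End(M) := [set f | is_iso f]%classic.

(* The number of elements of a finite set; hom_set, aut_set and the set of    *)
(* submodules counted by hall are finite over a finite field, see             *)
(* finite_lfun_set and finite_vspace_set.                                     *)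
Definition ncard (T : choiceType) (A : set T) : nat := #|` fset_set A|.

Definition hall M N L : nat :=
  ncard [set X : {vspace L} |
    exists sX : is_submod X,
      isom (submod sX) N /\ isom (quomod sX) M]%classic.

End Modules.

Arguments zero_mod {k Q}.
Arguments hom_set {k Q} M N _.
Arguments aut_set {k Q} M _.

Lemma finite_inj_set (T : Type) (F : finType) (f : T -> F) (A : set T) :
  injective f -> finite_set A.
Proof.
move=> fI; apply: (sub_finite_set (B := (f @^-1` setT)%classic)) => //.
by apply: finite_preimage => [? ? _ _ /fI //|]; exact: finite_finset.
Qed.

Lemma finite_lfun_set (k : finFieldType) (U V : vectType k) (A : set 'Hom(U, V)) :
  finite_set A.
Proof.
pose f (g : 'Hom(U, V)) : 'M[k]_(dim U, dim V) := VectorInternalTheory.f2mx g.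
apply: (@finite_inj_set _ 'M[k]_(dim U, dim V) f) => [[g] [h]].
by rewrite /f /= => ->.
Qed.

Lemma finite_vspace_set (k : finFieldType) (U : vectType k) (A : set {vspace U}) :
  finite_set A.
Proof.
pose f (X : {vspace U}) : 'M[k]_(dim U) := VectorInternalTheory.vs2mx X.
apply: (@finite_inj_set _ 'M[k]_(dim U) f) => X Y; rewrite /f => XY.
by rewrite -[X]VectorInternalTheory.vs2mxK XY VectorInternalTheory.vs2mxK.
Qed.

Section Dual.
Variables (k : fieldType) (Q : quiver) (M : kQmodule k Q).

Definition dual_fun (f : 'End(M)) (h : 'Hom(M, k^o)) : 'Hom(M, k^o) :=
  (h \o f)%VF.

Fact dual_fun_linear f : linear (dual_fun f).
Proof. by move=> c g h; rewrite /dual_fun comp_lfunDl comp_lfunZl. Qed.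
HB.instance Definition _ f :=
  GRing.isLinear.Build k 'Hom(M, k^o) 'Hom(M, k^o) _ (dual_fun f)
    (dual_fun_linear f).

Definition dual_lfun f : 'End('Hom(M, k^o)) := linfun (dual_fun f).

Fact dual_idemM (i j : vtx (op_quiver Q)) :
  (dual_lfun (idem M i) \o dual_lfun (idem M j))%VF =
  if i == j then dual_lfun (idem M i) else 0.
Proof.
apply/lfunP=> h; rewrite comp_lfunE !lfunE /= /dual_fun -comp_lfunA idemM.
rewrite eq_sym; case: eqP => [->|_]; first by rewrite lfunE.
by rewrite zero_lfunE comp_lfun0r.
Qed.

Fact dual_idem_sum : \sum_(i : vtx (op_quiver Q)) dual_lfun (idem M i) = \1%VF.
Proof.
apply/lfunP=> h; rewrite sum_lfunE id_lfunE.
rewrite (eq_bigr (fun i => h \o idem M i)%VF); last by move=> i _; rewrite lfunE.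
apply/lfunP=> u; rewrite sum_lfunE.
under eq_bigr do rewrite comp_lfunE.
by rewrite -linear_sum idem_sum_app.
Qed.

Fact dual_arrowE (a : arr (op_quiver Q)) : dual_lfun (arrow M a) =
  (dual_lfun (idem M (tgt a)) \o dual_lfun (arrow M a) \o
   dual_lfun (idem M (src a)))%VF.
Proof.
apply/lfunP=> h; rewrite 2!comp_lfunE !lfunE /= /dual_fun.
by rewrite -!comp_lfunA [in LHS]arrowE -comp_lfunA.
Qed.

Definition dual : kQmodule k (op_quiver Q) :=
  KQModule dual_idemM dual_idem_sum dual_arrowE.

End Dual.

(* The left module Hom_k(kQ, U), with (x f)(y) = f (y x), a function being    *)
(* given by its values on the paths.                                          *)
Section Coinduced.
Variables (k : fieldType) (Q : quiver) (U : vectType k).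
Local Notation W := {ffun qpath Q -> U}.

(* f (i, s) if the path (i, s) exists, 0 otherwise; the sum has at most one   *)
(* term.                                                                      *)
Definition pval (f : W) (i : vtx Q) (s : seq (arr Q)) : U :=
  \sum_(p : qpath Q | (pstart p == i) && (parrows p == s)) f p.

Fact pval_linear i s : linear (fun f => pval f i s).
Proof.
move=> c f g; rewrite /pval scaler_sumr -big_split.
by apply: eq_bigr => p _; rewrite !ffunE.
Qed.

Fact pvalE f (p : qpath Q) : pval f (pstart p) (parrows p) = f p.
Proof. by rewrite /pval (big_pred1 p). Qed.

Definition coind_idem_fun i (f : W) : W :=
  [ffun p => if pstart p == i then f p else 0].
Definition coind_arrow_fun a (f : W) : W :=
  [ffun p => if pstart p == tgt a then pval f (src a) (a :: parrows p) else 0].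

Fact coind_idem_linear i : linear (coind_idem_fun i).
Proof.
move=> c f g; apply/ffunP=> p; rewrite !ffunE; case: eqP => _ //.
by rewrite scaler0 addr0.
Qed.
HB.instance Definition _ i :=
  GRing.isLinear.Build k W W _ (coind_idem_fun i) (coind_idem_linear i).

Fact coind_arrow_linear a : linear (coind_arrow_fun a).
Proof.
move=> c f g; apply/ffunP=> p; rewrite !ffunE; case: eqP => _.
  exact: pval_linear.
by rewrite scaler0 addr0.
Qed.
HB.instance Definition _ a :=
  GRing.isLinear.Build k W W _ (coind_arrow_fun a) (coind_arrow_linear a).

Definition coind_idem i : 'End(W) := linfun (coind_idem_fun i).
Definition coind_arrow a : 'End(W) := linfun (coind_arrow_fun a).

Fact coind_idemM i j : (coind_idem i \o coind_idem j)%VF =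
  if i == j then coind_idem i else 0.
Proof.
apply/lfunP=> f; rewrite comp_lfunE !lfunE /=; apply/ffunP=> p.
rewrite !ffunE; case: (eqVneq i j) => [<-|ij].
  by rewrite lfunE /= ffunE; case: eqP.
rewrite zero_lfunE ffunE; case: (eqVneq (pstart p) i) => // ->.
by rewrite (negPf ij).
Qed.

Fact coind_idem_sum : \sum_i coind_idem i = \1%VF.
Proof.
apply/lfunP=> f; rewrite sum_lfunE id_lfunE; apply/ffunP=> p.
rewrite sum_ffunE (bigD1 (pstart p)) //= big1 => [|i ip].
  by rewrite addr0 lfunE /= ffunE eqxx.
by rewrite lfunE /= ffunE eq_sym (negPf ip).
Qed.

Fact coind_arrowE a :
  coind_arrow a = (coind_idem (tgt a) \o coind_arrow a \o coind_idem (src a))%VF.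
Proof.
apply/lfunP=> f; rewrite !comp_lfunE !lfunE /=; apply/ffunP=> p; rewrite !ffunE.
case: eqP => // _; apply: eq_bigr => q /andP[/eqP qs _].
by rewrite ffunE qs eqxx.
Qed.

Definition coind : kQmodule k Q :=
  KQModule coind_idemM coind_idem_sum coind_arrowE.

End Coinduced.

(* The Auslander-Reiten translate tau M = D Ext^1(M, kQ), computed from the   *)
(* standard projective resolution                                             *)
(*   0 -> \oplus_a kQ e_(tgt a) (x) e_(src a) M -> \oplus_i kQ e_i (x) e_i M  *)
(*     -> M -> 0,     p (x) m |-> p a (x) m - p (x) a m,                      *)
(* to which D Hom(-, kQ) is applied. As D Hom(kQ e_i, kQ) = D (e_i kQ), the   *)
(* module D (e_(tgt a) kQ) (x) e_(src a) M consists of the functions from the *)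
(* paths ending at tgt a to e_(src a) M. So tau M is the set of the families  *)
(* (f_a) of such functions (extended by 0 to the other paths) which satisfy   *)
(*   \sum_a f_a (a q) = \sum_a a f_a (q)     for each path q.                 *)
Section Translate.
Variables (k : fieldType) (Q : quiver) (M : kQmodule k Q).
Local Notation B := {ffun arr Q -> M}.
Local Notation W := {ffun qpath Q -> B}.

Definition tau_supp_fun (f : W) : W :=
  [ffun p => [ffun a =>
    f p a - (if pend p == tgt a then idem M (src a) (f p a) else 0)]].

Definition tau_rel_fun (f : W) : {ffun qpath Q -> M} :=
  [ffun q => \sum_a pval f (pstart q) (rcons (parrows q) a) a
           - \sum_a arrow M a (f q a)].

Fact tau_supp_linear : linear tau_supp_fun.
Proof.
move=> c f g; apply/ffunP=> p; apply/ffunP=> a; rewrite !ffunE.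
case: eqP => _; first by rewrite linearP scalerBr opprD addrACA.
by rewrite !subr0.
Qed.
HB.instance Definition _ :=
  GRing.isLinear.Build k W W _ tau_supp_fun tau_supp_linear.

Fact tau_rel_linear : linear tau_rel_fun.
Proof.
move=> c f g; apply/ffunP=> q; rewrite !ffunE scalerBr addrACA -opprD.
rewrite !scaler_sumr -!big_split; congr (_ - _); apply: eq_bigr => a _.
  by rewrite (pval_linear _ _ c f g) !ffunE.
by rewrite !ffunE linearP.
Qed.
HB.instance Definition _ :=
  GRing.isLinear.Build k W {ffun qpath Q -> M} _ tau_rel_fun tau_rel_linear.

Definition tau_space : {vspace W} :=
  (lker (linfun tau_supp_fun) :&: lker (linfun tau_rel_fun))%VS.

Lemma tau_spaceP (f : W) :
  f \in tau_space <->
  (forall p a, f p a = if pend p == tgt a then idem M (src a) (f p a) else 0) /\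
  (forall q, \sum_a pval f (pstart q) (rcons (parrows q) a) a =
             \sum_a arrow M a (f q a)).
Proof.
rewrite memv_cap !memv_ker !lfunE /=; split.
  case/andP=> /eqP/ffunP h1 /eqP/ffunP h2; split=> [p a|q].
    by move/ffunP/(_ a): (h1 p); rewrite !ffunE => /eqP; rewrite subr_eq0 => /eqP.
  by move: (h2 q); rewrite !ffunE => /eqP; rewrite subr_eq0 => /eqP.
case=> h1 h2; apply/andP; split; apply/eqP/ffunP=> p.
  by apply/ffunP=> a; rewrite !ffunE -h1 subrr.
by rewrite !ffunE h2 subrr.
Qed.

Fact pval_coord (f : W) i s a :
  pval f i s a = \sum_(p : qpath Q | (pstart p == i) && (parrows p == s)) f p a.
Proof. by rewrite /pval sum_ffunE. Qed.

Fact pval0 (f : W) i s :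
  ~~ (is_qpath i s && (size s <= #|vtx Q|)%N) -> pval f i s = 0.
Proof.
move=> h; rewrite /pval big_pred0 // => p; apply/negP=> /andP[/eqP pi /eqP ps].
case/negP: h; rewrite -pi -ps /pstart /parrows (valP p) /=; exact: size_bseq.
Qed.

Fact qpath_ex i s : is_qpath i s -> (size s <= #|vtx Q|)%N ->
  exists p : qpath Q, pstart p = i /\ parrows p = s.
Proof.
move=> h1 h2; pose x := (i, Bseq h2 : (#|vtx Q|).-bseq (arr Q)).
by exists (exist (fun y : vtx Q * (#|vtx Q|).-bseq (arr Q) => is_qpath y.1 y.2) x h1).
Qed.

Fact tau_submod : is_submod (M := coind Q B) tau_space.
Proof.
apply/andP; split; apply/forallP=> x; apply/subvP=> _ /memv_imgP[f + ->].
- case/tau_spaceP=> h1 h2; apply/tau_spaceP; rewrite lfunE /=; split=> [p a|q].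
    rewrite !ffunE; case: eqP => _; first exact: h1.
    by rewrite ffunE linear0 if_same.
  case: (eqVneq (pstart q) x) => [qx|qx].
    transitivity (\sum_a arrow M a (f q a)); last first.
      by apply: eq_bigr => a _; rewrite ffunE qx eqxx.
    rewrite -h2; apply: eq_bigr => a _; rewrite !pval_coord.
    by apply: eq_bigr => p /andP[/eqP pq _]; rewrite ffunE pq qx eqxx.
  transitivity (0 : M); [|apply: esym]; apply: big1 => a _; last first.
    by rewrite ffunE (negPf qx) ffunE linear0.
  rewrite pval_coord big1 // => p /andP[/eqP pq _].
  by rewrite ffunE pq (negPf qx) ffunE.
case/tau_spaceP=> h1 h2; apply/tau_spaceP; rewrite lfunE /=.
have h1' p a i s : pstart p = tgt x -> parrows p = s -> i = src x ->
    pval f i (x :: s) a =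
    if pend p == tgt a then idem M (src a) (pval f i (x :: s) a) else 0.
  move=> px ps ->; case: (boolP (is_qpath (src x) (x :: s) &&
    (size (x :: s) <= #|vtx Q|)%N)) => [/andP[u1 u2]|u]; last first.
    by rewrite pval0 // ffunE linear0 if_same.
  have [r [r1 r2]] := qpath_ex u1 u2.
  rewrite -r1 -r2 pvalE [LHS]h1; congr (if _ == _ then _ else _).
  by rewrite /pend /qend r1 r2 px ps /=.
split=> [p a|q].
  rewrite !ffunE; case: eqP => [px|_]; last by rewrite ffunE linear0 if_same.
  exact: h1'.
case: (eqVneq (pstart q) (tgt x)) => [qx|qx]; last first.
  transitivity (0 : M); [|apply: esym]; apply: big1 => a _; last first.
    by rewrite ffunE (negPf qx) ffunE linear0.
  rewrite pval_coord big1 // => p /andP[/eqP pq _].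
  by rewrite ffunE pq (negPf qx) ffunE.
transitivity (\sum_a pval f (src x) (x :: rcons (parrows q) a) a).
  apply: eq_bigr => a _; case: (boolP (is_qpath (tgt x) (rcons (parrows q) a) &&
    (size (rcons (parrows q) a) <= #|vtx Q|)%N)) => [/andP[u1 u2]|u].
    have [r [r1 r2]] := qpath_ex u1 u2.
    by rewrite qx -r1 -r2 pvalE ffunE r1 eqxx.
  rewrite qx !pval0 //; apply: contra u => /andP[/= /andP[_ ->] u2] /=.
  exact: ltnW.
transitivity (\sum_a arrow M a (pval f (src x) (x :: parrows q) a)); last first.
  by apply: eq_bigr => a _; rewrite ffunE qx eqxx.
case: (boolP (is_qpath (src x) (x :: parrows q) &&
    (size (x :: parrows q) <= #|vtx Q|)%N)) => [/andP[u1 u2]|u].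
  have [r [r1 r2]] := qpath_ex u1 u2.
  by rewrite -r1 -r2 pvalE -h2 r1 r2.
rewrite !big1 // => a _; rewrite pval0 ?ffunE ?linear0 //.
apply: contra u; rewrite /= eqxx size_rcons /=.
have -> : is_qpath (tgt x) (parrows q) by rewrite -qx /parrows; exact: (valP q).
by case/andP=> _ /ltnW.
Qed.

Definition tau : kQmodule k Q := submod tau_submod.

End Translate.

Section Regular.
Variables (k : fieldType) (Q : quiver).
Implicit Type M : kQmodule k Q.

Definition preprojective M : Prop :=
  indecomposable M /\ exists n : nat, is_zero (iter n (@tau k Q) M).

(* The inverse translate is D tau D, D being the duality between kQ-modules   *)
(* and kQ^op-modules; so the condition says that tau^-n M = 0.                *)
Definition preinjective M : Prop :=
  indecomposable M /\
  exists n : nat, is_zero (iter n (@tau k (op_quiver Q)) (dual M)).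

Definition indec_regular M : Prop :=
  [/\ indecomposable M, ~ preprojective M & ~ preinjective M].

Definition regular M : Prop :=
  exists Rs : seq (kQmodule k Q),
    (forall n, (n < size Rs)%N -> indec_regular (nth zero_mod Rs n)) /\
    isom M (foldr (@dsum k Q) zero_mod Rs).

End Regular.

(* Main.v *)
From HB Require Import structures.
From mathcomp Require Import finmap boolp classical_sets cardinality.
From mathcomp Require Import all_boot all_order all_algebra.
From mathcomp Require Import zify ring.
Require Import Defs.
Set Implicit Arguments.
Unset Strict Implicit.
Unset Printing Implicit Defensive.
Import Order.TTheory GRing.Theory Num.Theory.
Import passmx.
Local Open Scope ring_scope.

(* Write ext(M, N) for dim Hom(N, tau M); the Euler form computes             *)
(* hom(M, N) - ext(M, N), and ext(M, N) = 0 allows lifting. The modules       *)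
(* killed by a power of tau are the torsion-free part of a torsion pair, on   *)
(* which the defect is negative, while it is nonnegative on the torsion part; *)
(* hence regular modules form an abelian category, closed under extensions.   *)
(* As tau preserves regular simples and dim Hom(T, R / soc R) is at most      *)
(* ext(T, soc R), a regular module with a simple socle, or dually a simple    *)
(* top, is uniserial, and so is every indecomposable regular module R.        *)
(*   A preprojective P of defect -1 has End P = k, and its nonzero maps to    *)
(* preprojectives are injective. There is a preprojective L of dimension      *)
(* dim P + delta, so dim Hom(P, L) >= 2; from the pencil of maps P -> L one   *)
(* builds, for each regular simple T with Hom(P, T) <> 0, a local regular     *)
(* module C with top T and dimension a multiple of delta such that            *)
(* Hom(P, rad C) = 0 and dim Hom(P, T) <= dim End T. Consequently, if R is    *)
(* uniserial with top T, then T is the only regular composition factor of R   *)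
(* which receives a nonzero map from P, and End R acts transitively on        *)
(* Hom(P, R) from any map with image outside rad R.                           *)
(*   In a sequence 0 -> P -> P' (+) R' -> R -> 0 the components P -> P' and   *)
(* R' -> R are injective. If R' is isomorphic to R, the submodules to count   *)
(* are the graphs of the maps P -> R'. Otherwise the component P' -> R is not *)
(* contained in rad R, so up to a unique automorphism of R it is fixed, and   *)
(* R' -> R, whose image is determined by its dimension, varies by Aut R'.     *)

(** * Linear algebra *)

Lemma exists_minimizer (T : Type) (f : T -> nat) (P : T -> Prop) :
  (exists x, P x) -> exists2 x, P x & forall y, P y -> (f x <= f y)%N.
Proof.
case=> x0 Px0; pose value n := `[< exists2 x, P x & f x = n >].
have value_ex : exists n, value n by exists (f x0); apply/asboolP; exists x0.
case: (ex_minnP value_ex) => m /asboolP[x Px <-] min; exists x => // y Py.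
by apply: min; apply/asboolP; exists y.
Qed.

Lemma exists_maximizer (T : Type) (f : T -> nat) (P : T -> Prop) (m : nat) :
  (exists x, P x) -> (forall x, P x -> (f x <= m)%N) ->
  exists2 x, P x & forall y, P y -> (f y <= f x)%N.
Proof.
move=> exP fm; have [x Px min] := exists_minimizer (fun x => m - f x)%N exP.
by exists x => // y Py; have := min _ Py; have := fm _ Px; have := fm _ Py; lia.
Qed.

Section LinearAlgebra.
Variable k : fieldType.
Implicit Types U V W : vectType k.

Lemma linfunE U V (f : U -> V) : linear f -> linfun f =1 f.
Proof.
move=> lin_f; pose F : {linear U -> V} := HB.pack f (GRing.isLinear.Build k U V _ f lin_f).
exact: (lfunE F).
Qed.

Definition subspace_pred U (P : U -> Prop) :=
  P 0 /\ forall c u v, P u -> P v -> P (c *: u + v).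

Definition vspace_of U (P : U -> Prop) : {vspace U} :=
  xget 0%VS [set S : {vspace U} | forall u, u \in S <-> P u]%classic.

Lemma vspace_ofP U (P : U -> Prop) u : subspace_pred P -> reflect (P u) (u \in vspace_of P).
Proof.
move=> [P0 Plin]; suff /(xgetPex 0%VS) E :
    exists S : {vspace U}, forall v, v \in S <-> P v by apply: (iffP idP) => /(E u).
have [||S SP maxS] := @exists_maximizer _ (fun S : {vspace U} => \dim S)
    (fun S => forall v, v \in S -> P v) (\dim {:U}).
- by exists 0%VS => v; rewrite memv0 => /eqP->.
- by move=> S _; apply/dimvS/subvf.
exists S => v; split=> [|Pv]; first exact: SP.
suff Sv_S : (S + <[v]> <= S)%VS.
  by apply: (subvP Sv_S); apply: (subvP (addvSr _ _) _ (memv_line v)).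
rewrite -(geq_leqif (dimv_leqif_sup (addvSl S <[v]>))); apply: maxS.
by move=> _ /memv_addP[s sS [w /vlineP[c ->] ->]]; rewrite addrC; apply: Plin => //; apply: SP.
Qed.

Lemma lker_eq0P U V (f : 'Hom(U, V)) : reflect (forall u, f u = 0 -> u = 0) (lker f == 0%VS).
Proof.
rewrite -subv0; apply: (iffP subvP) => h u => [fu0|].
  by apply/eqP; rewrite -memv0; apply: h; rewrite memv_ker fu0.
by rewrite memv_ker memv0 => /eqP/h->.
Qed.

Lemma limg_fullP U V (f : 'Hom(U, V)) : reflect (forall v, exists u, f u = v) (limg f == fullv).
Proof.
apply: (iffP eqP) => [full v|h].
  by have := memvf v; rewrite -full => /memv_imgP[u _ ->]; exists u.
by apply/vspaceP=> v; have [u <-] := h v; rewrite memv_img ?memvf.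
Qed.

Lemma lker_full U V (f : 'Hom(U, V)) : (lker f == fullv) = (f == 0).
Proof.
apply/eqP/eqP => [full|->]; last by apply/vspaceP=> u; rewrite memv_ker zero_lfunE eqxx memvf.
by apply/lfunP=> u; rewrite zero_lfunE; apply/eqP; rewrite -memv_ker full memvf.
Qed.

Lemma limg_eq0 U V (f : 'Hom(U, V)) : (limg f == 0%VS) = (f == 0).
Proof. by rewrite -lker_full [RHS]eqEsubv subvf lkerE. Qed.

Lemma limg_dim_in U V (f : 'Hom(U, V)) (S : {vspace U}) :
  {in S, forall u, f u = 0 -> u = 0} -> \dim (f @: S) = \dim S.
Proof.
move=> inj; apply: limg_dim_eq; apply/eqP; rewrite -subv0; apply/subvP=> u.
by rewrite memv_cap memv_ker memv0 => /andP[uS /eqP/(inj _ uS)->].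
Qed.

Lemma limg_dim_lker0 U V (f : 'Hom(U, V)) (S : {vspace U}) :
  lker f == 0%VS -> \dim (f @: S) = \dim S.
Proof. by move/lker_eq0P=> inj; apply: limg_dim_in => u _; apply: inj. Qed.

Lemma dimv_linear_bij U V (f : U -> V) (S : {vspace U}) (I : {vspace V}) :
  linear f -> (forall u, u \in S -> f u = 0 -> u = 0) ->
  (forall w, w \in I <-> exists2 u, u \in S & f u = w) -> \dim S = \dim I.
Proof.
move=> lin_f inj IP; rewrite -(@limg_dim_in _ _ (linfun f)) => [|u uS]; last first.
  by rewrite linfunE //; apply: inj.
congr (\dim _); apply/vspaceP=> w; apply/memv_imgP/idP => [[u uS ->]|/IP[u uS <-]].
  by apply/IP; exists u; rewrite ?linfunE.
by exists u; rewrite ?linfunE.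
Qed.

Lemma dimv_linear_inj U V (f : U -> V) (S : {vspace U}) (I : {vspace V}) :
  linear f -> (forall u, u \in S -> f u = 0 -> u = 0) ->
  (forall u, u \in S -> f u \in I) -> (\dim S <= \dim I)%N.
Proof.
move=> lin_f inj SI; rewrite -(@limg_dim_in _ _ (linfun f)) => [|u uS]; last first.
  by rewrite linfunE //; apply: inj.
by apply/dimvS/subvP=> _ /memv_imgP[u uS ->]; rewrite linfunE // SI.
Qed.

Definition postcomp W U V (f : 'Hom(U, V)) : 'Hom('Hom(W, U), 'Hom(W, V)) :=
  linfun (fun h : 'Hom(W, U) => (f \o h)%VF).
Definition precomp W U V (f : 'Hom(U, V)) : 'Hom('Hom(V, W), 'Hom(U, W)) :=
  linfun (fun h : 'Hom(V, W) => (h \o f)%VF).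

Lemma postcompE W U V (f : 'Hom(U, V)) h : postcomp W f h = (f \o h)%VF.
Proof. by rewrite linfunE // => c g g'; rewrite comp_lfunDr comp_lfunZr. Qed.

Lemma precompE W U V (f : 'Hom(U, V)) h : precomp W f h = (h \o f)%VF.
Proof. by rewrite linfunE // => c g g'; rewrite comp_lfunDl comp_lfunZl. Qed.

Lemma postcomp_inj W U V (f : 'Hom(U, V)) : lker f == 0%VS -> lker (postcomp W f) == 0%VS.
Proof.
move/lker_eq0P=> inj; apply/lker_eq0P=> h; rewrite postcompE => fh0; apply/lfunP=> w.
by rewrite zero_lfunE; apply: inj; rewrite -comp_lfunE fh0 zero_lfunE.
Qed.

Lemma precomp_inj W U V (f : 'Hom(U, V)) : limg f == fullv -> lker (precomp W f) == 0%VS.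
Proof.
move/limg_fullP=> onto; apply/lker_eq0P=> h; rewrite precompE => hf0; apply/lfunP=> v.
by have [u <-] := onto v; rewrite -comp_lfunE hf0 !zero_lfunE.
Qed.

Lemma dim_hom U V : dim 'Hom(U, V) = (dim U * dim V)%N. Proof. by []. Qed.

Lemma dim_ffun_family (I : finType) U (B : I -> {vspace U}) (S : {vspace {ffun I -> U}}) :
  (forall x, x \in S <-> forall i, x i \in B i) -> \dim S = (\sum_i \dim (B i))%N.
Proof.
move=> SP; pose single i (u : U) : {ffun I -> U} := [ffun j => if j == i then u else 0].
have single_lin i : linear (single i).
  move=> c u v; apply/ffunP=> j; rewrite !ffunE; case: eqP => // _.
  by rewrite scaler0 addr0.
pose A i := (linfun (single i) @: B i)%VS.
have A_off i x j : x \in A i -> j != i -> x j = 0.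
  by case/memv_imgP=> u _ -> ji; rewrite linfunE // ffunE (negPf ji).
have sum_at (x : I -> {ffun I -> U}) j : (forall i, x i \in A i) -> (\sum_i x i) j = x j j.
  move=> xA; rewrite sum_ffunE (bigD1 j) //= big1 ?addr0 // => i ij.
  by apply: A_off (xA i) _; rewrite eq_sym.
have -> : S = (\sum_i A i)%VS.
  apply/vspaceP=> x; apply/idP/idP => [/SP xB|/memv_sumP[y yA ->]].
    have xA i : single i (x i) \in A i by rewrite -(linfunE (single_lin i)) memv_img.
    apply/memv_sumP; exists (fun i => single i (x i)) => //.
    by apply/ffunP=> j; rewrite sum_at // ffunE eqxx.
  apply/SP=> j; rewrite sum_at => [|i]; last exact: yA.
  by have /memv_imgP[u uB ->] := yA j isT; rewrite linfunE // ffunE eqxx.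
have /directvP -> /= : directv (\sum_i A i).
  apply/directv_sum_independent => y yA y0 i _; apply/ffunP=> j; rewrite [RHS]ffunE.
  case: (eqVneq j i) => [->|ji]; last exact: A_off (yA i isT) ji.
  by move/ffunP/(_ i): y0; rewrite sum_at ?ffunE // => l; apply: yA.
apply: eq_bigr => i _; apply: limg_dim_in => u _; rewrite linfunE // => /ffunP/(_ i).
by rewrite !ffunE eqxx.
Qed.

Lemma limg_idempotentP U (e : 'End(U)) u :
  (forall v, e (e v) = e v) -> reflect (e u = u) (u \in limg e).
Proof.
move=> eK; apply: (iffP memv_imgP) => [[v _ ->]|<-]; first exact: eK.
by exists u; rewrite ?memvf.
Qed.

Lemma dim_hom_idempotents U V (e : 'End(U)) (e' : 'End(V)) (S : {vspace 'Hom(U, V)}) :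
  (forall u, e (e u) = e u) -> (forall u, e' (e' u) = e' u) ->
  (forall f : 'Hom(U, V), f \in S <-> forall u, f u = e' (f (e u))) ->
  \dim S = (\dim (limg e) * \dim (limg e'))%N.
Proof.
move=> eK eK' SP.
pose extend (g : 'Hom(subvs_of (limg e), subvs_of (limg e'))) : 'Hom(U, V) :=
  (linfun vsval \o g \o linfun (vsproj (limg e)) \o e)%VF.
have extendE g u : extend g u = vsval (g (vsproj (limg e) (e u))).
  by rewrite !comp_lfunE !lfunE.
transitivity (\dim {:'Hom(subvs_of (limg e), subvs_of (limg e'))}); last by rewrite dimvf dim_hom.
apply/esym; apply: (dimv_linear_bij (f := extend)).
- move=> c g h; apply/lfunP=> u.
  by rewrite add_lfunE scale_lfunE !extendE add_lfunE scale_lfunE.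
- move=> g _ g0; apply/lfunP=> x; rewrite zero_lfunE; apply: subvs_inj.
  have := extendE g (vsval x); rewrite g0 zero_lfunE (limg_idempotentP _ eK (subvsP x)) vsvalK.
  by move <-; rewrite linear0.
move=> f; split=> [/SP fS|[g _ <-]]; last first.
  by apply/SP=> u; rewrite !extendE eK (limg_idempotentP _ eK' (subvsP _)).
exists (linfun (vsproj (limg e')) \o f \o linfun vsval)%VF; first exact: memvf.
apply/lfunP=> u; rewrite extendE !comp_lfunE !lfunE /=.
rewrite [vsval (vsproj _ (e u))]vsprojK ?memv_img ?memvf //.
by rewrite vsprojK; [rewrite [RHS]fS [LHS]fS eK | rewrite fS memv_img ?memvf].
Qed.

Section Functionals.
Variable U : vectType k.

Lemma exists_functional (w : U) : w != 0 -> exists l : 'Hom(U, k^o), l w != 0.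
Proof.
move=> w0; have free_w : free [tuple w] by rewrite /free /= span_seq1 dim_vline w0.
exists (linfun (coord [tuple w] ord0 : U -> k^o)); rewrite lfunE /=.
by have := coord_free ord0 ord0 free_w; rewrite /= => ->; rewrite oner_eq0.
Qed.

Lemma functional_sep (u v : U) : (forall h : 'Hom(U, k^o), h u = h v) -> u = v.
Proof.
move=> sep; apply/eqP; rewrite -subr_eq0; apply: contraT => /exists_functional[l].
by rewrite linearB /= sep subrr eqxx.
Qed.

End Functionals.

Section Orthogonal.
Variables (U V : vectType k) (b : U -> V -> k).
Hypothesis linl : forall v, linear (fun u => b u v : k^o).
Hypothesis linr : forall u, linear (b u : V -> k^o).

Lemma dim_orthogonal (A S : {vspace U}) (B T : {vspace V}) :
  (forall v, v \in B -> (forall u, u \in A -> b u v = 0) -> v = 0) ->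
  \dim A = \dim B -> (S <= A)%VS ->
  (forall v, v \in T <-> v \in B /\ forall u, u \in S -> b u v = 0) ->
  (\dim T + \dim S)%N = \dim A.
Proof.
move=> nondeg dimAB SA TP.
pose r (X : {vspace U}) : 'Hom(V, 'Hom(subvs_of X, k^o)) :=
  linfun (fun v => linfun (fun x : subvs_of X => b (vsval x) v : k^o)).
have inner_lin (X : {vspace U}) v : linear (fun x : subvs_of X => b (vsval x) v : k^o).
  by move=> c x y; rewrite linearP; apply: linl.
have rE X v x : r X v x = b (vsval x) v.
  rewrite [r X v]linfunE => [|c v1 v2]; first by rewrite (linfunE (inner_lin X v)).
  by apply/lfunP=> y; rewrite add_lfunE scale_lfunE !(linfunE (inner_lin X _)) linr.
have r0P (X : {vspace U}) v : r X v = 0 <-> forall u, u \in X -> b u v = 0.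
  split=> [r0 u uX|h]; first by rewrite -(vsprojK uX) -rE r0 zero_lfunE.
  by apply/lfunP=> x; rewrite rE zero_lfunE; apply/h/subvsP.
have dual_dim (X : {vspace U}) : \dim {:'Hom(subvs_of X, k^o)} = \dim X.
  by rewrite dimvf dim_hom muln1.
have onA : (r A @: B)%VS = fullv.
  apply/eqP; rewrite eqEdim subvf dual_dim dimAB limg_dim_in //= => v vB /r0P.
  exact: nondeg.
have onS : (r S @: B)%VS = fullv.
  apply/vspaceP=> w; rewrite memvf.
  have : (w \o linfun (vsproj S) \o linfun vsval)%VF \in (r A @: B)%VS by rewrite onA memvf.
  case/memv_imgP=> v vB rv; apply/memv_imgP; exists v => //; apply/lfunP=> x.
  have xA : vsval x \in A := subvP SA _ (subvsP x).
  have /lfunP/(_ (vsproj A (vsval x))) := rv.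
  by rewrite rE vsprojK // !comp_lfunE !lfunE /= vsprojK // vsvalK rE.
rewrite dimAB -(limg_ker_dim (r S) B) onS dual_dim; congr (\dim _ + _)%N.
apply/vspaceP=> v; rewrite memv_cap memv_ker; apply/idP/andP => [/TP[-> /r0P->]|[vB /eqP/r0P]].
  by rewrite eqxx.
by move=> h; apply/TP.
Qed.

End Orthogonal.

Section Annihilators.
Variable U : vectType k.
Implicit Types (X Y : {vspace U}) (Z : {vspace 'Hom(U, k^o)}).

Definition annihilator X : {vspace 'Hom(U, k^o)} :=
  vspace_of (fun h : 'Hom(U, k^o) => forall u, u \in X -> h u = 0).
Definition zero_locus Z : {vspace U} :=
  vspace_of (fun u => forall h, h \in Z -> h u = 0).

Lemma annihilatorP X (h : 'Hom(U, k^o)) :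
  reflect (forall u, u \in X -> h u = 0) (h \in annihilator X).
Proof.
apply: vspace_ofP; split=> [u _|c f g f0 g0 u uX]; first by rewrite zero_lfunE.
by rewrite add_lfunE scale_lfunE f0 // g0 // scaler0 addr0.
Qed.

Lemma zero_locusP Z u : reflect (forall h, h \in Z -> h u = 0) (u \in zero_locus Z).
Proof.
apply: vspace_ofP; split=> [h _|c v w v0 w0 h hZ]; first exact: linear0.
by rewrite linearP /= v0 // w0 // scaler0 addr0.
Qed.

Let evaluation_linl (h : 'Hom(U, k^o)) : linear (fun u : U => h u : k^o).
Proof. by move=> c u v; rewrite linearP. Qed.
Let evaluation_linr (u : U) : linear (fun h : 'Hom(U, k^o) => h u : k^o).
Proof. by move=> c f g; rewrite add_lfunE scale_lfunE. Qed.

Lemma dim_annihilator X : (\dim (annihilator X) + \dim X)%N = \dim {:U}.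
Proof.
apply: (dim_orthogonal (b := fun u (h : 'Hom(U, k^o)) => h u) evaluation_linl evaluation_linr
  (B := fullv)) => [h _ h0||| h]; rewrite ?subvf //.
- by apply/lfunP=> u; rewrite zero_lfunE h0 ?memvf.
- by rewrite !dimvf dim_hom muln1.
by rewrite memvf; split=> [/annihilatorP|[_] /annihilatorP].
Qed.

Lemma dim_zero_locus Z : (\dim (zero_locus Z) + \dim Z)%N = \dim {:U}.
Proof.
have dimU : \dim {:'Hom(U, k^o)} = \dim {:U} by rewrite !dimvf dim_hom muln1.
rewrite -dimU; apply: (dim_orthogonal (b := fun (h : 'Hom(U, k^o)) u => h u) evaluation_linr
  evaluation_linl (B := fullv)) => [u _ u0||| u]; rewrite ?subvf //.
- by apply: functional_sep => h; rewrite linear0 u0 ?memvf.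
by rewrite memvf; split=> [/zero_locusP|[_] /zero_locusP].
Qed.

Lemma zero_locusK Z : annihilator (zero_locus Z) = Z.
Proof.
apply/esym/eqP; rewrite eqEdim; apply/andP; split.
  by apply/subvP=> h hZ; apply/annihilatorP=> u /zero_locusP; apply.
by have := dim_annihilator (zero_locus Z); have := dim_zero_locus Z; lia.
Qed.

Lemma annihilatorK X : zero_locus (annihilator X) = X.
Proof.
apply/esym/eqP; rewrite eqEdim; apply/andP; split.
  by apply/subvP=> u uX; apply/zero_locusP=> h /annihilatorP; apply.
by have := dim_annihilator X; have := dim_zero_locus (annihilator X); lia.
Qed.

Lemma annihilatorS X Y : (annihilator Y <= annihilator X)%VS = (X <= Y)%VS.
Proof.
apply/idP/idP => [sub|XY]; last first.
  by apply/subvP=> h /annihilatorP hY; apply/annihilatorP=> u /(subvP XY); apply: hY.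
rewrite -(annihilatorK X) -(annihilatorK Y); apply/subvP=> u /zero_locusP uX.
by apply/zero_locusP=> h /(subvP sub); apply: uX.
Qed.

Lemma annihilator0 : annihilator 0%VS = fullv.
Proof.
apply/vspaceP=> h; rewrite memvf; apply/annihilatorP=> u.
by rewrite memv0 => /eqP->; rewrite linear0.
Qed.

Lemma annihilatorf : annihilator fullv = 0%VS.
Proof. by apply/eqP; rewrite -dimv_eq0; have := dim_annihilator fullv; lia. Qed.

End Annihilators.

Section TracePairing.
Variables U V : vectType k.

Definition lftrace (f : 'Hom(U, V)) (g : 'Hom(V, U)) : k^o :=
  \tr (mxof (vbasis fullv) (vbasis fullv) f *m mxof (vbasis fullv) (vbasis fullv) g).

Lemma lftrace_linearl g : linear (fun f => lftrace f g : k^o).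
Proof.
by move=> c f f'; rewrite /lftrace linearP mulmxDl -scalemxAl mxtraceD mxtraceZ.
Qed.

Lemma lftrace_linearr f : linear (lftrace f : 'Hom(V, U) -> k^o).
Proof.
by move=> c g g'; rewrite /lftrace linearP mulmxDr -scalemxAr mxtraceD mxtraceZ.
Qed.

HB.instance Definition _ f :=
  GRing.isLinear.Build k 'Hom(V, U) k^o _ (lftrace f) (lftrace_linearr f).

Lemma lftraceBl f f' g : lftrace (f - f') g = lftrace f g - lftrace f' g.
Proof. by rewrite -!(linfunE (lftrace_linearl g)) linearB. Qed.

Lemma lftrace0l g : lftrace 0 g = 0.
Proof. by have := lftraceBl 0 0 g; rewrite !subrr. Qed.

Lemma lftrace_suml (I : finType) (f : I -> 'Hom(U, V)) g :
  lftrace (\sum_i f i) g = \sum_i lftrace (f i) g.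
Proof.
rewrite -(linfunE (lftrace_linearl g)) linear_sum; apply: eq_bigr => i _.
exact: linfunE (lftrace_linearl g) (f i).
Qed.

Lemma lftrace_compl (p : 'End(V)) f g : lftrace (p \o f)%VF g = lftrace f (g \o p)%VF.
Proof. by rewrite /lftrace !(mxof_comp _ _ (vbasisP fullv)) mulmxA. Qed.

Lemma lftrace_nondeg g : (forall f, lftrace f g = 0) -> g = 0.
Proof.
move=> trace0; apply/eqP; rewrite -(mxof_eq0 (vbasisP _) (vbasisP _)).
apply/eqP/matrixP=> j i; set A := mxof _ _ _.
have := trace0 (hommx (vbasis fullv) (vbasis fullv) (delta_mx i j)).
rewrite /lftrace (hommxK (vbasisP _) (vbasisP _)) -/A /mxtrace (bigD1 i) //= big1 => [|l li].
  rewrite addr0 !mxE (bigD1 j) //= big1 => [|m mj]; rewrite !mxE ?eqxx ?mul1r ?addr0 //.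
  by rewrite (negPf mj) andbF mul0r.
by rewrite mxE big1 // => m _; rewrite !mxE (negPf li) mul0r.
Qed.

End TracePairing.

Lemma lftrace_compr U V (p : 'End(U)) (f : 'Hom(U, V)) g :
  lftrace (f \o p)%VF g = lftrace f (p \o g)%VF.
Proof. by rewrite /lftrace !(mxof_comp _ _ (vbasisP fullv)) -mulmxA mxtrace_mulC -mulmxA. Qed.

Lemma lftrace_nondeg_in U V (e : 'End(U)) (e' : 'End(V)) (g : 'Hom(V, U)) :
  (forall u, e (e u) = e u) -> (forall v, e' (e' v) = e' v) -> (forall v, g v = e (g (e' v))) ->
  (forall f : 'Hom(U, V), (forall u, f u = e' (f (e u))) -> lftrace f g = 0) -> g = 0.
Proof.
move=> eK eK' gE trace0; apply: lftrace_nondeg => f.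
have -> : g = (e \o (g \o e'))%VF by apply/lfunP=> v; rewrite !comp_lfunE -gE.
rewrite -lftrace_compr -lftrace_compl; apply: trace0 => u.
by rewrite !comp_lfunE eK eK'.
Qed.

End LinearAlgebra.

(** * Modules and their homomorphisms *)

Section Homomorphisms.
Variables (k : fieldType) (Q : quiver).
Implicit Types L M N X Y Z : kQmodule k Q.

Lemma is_homP M N (f : 'Hom(M, N)) :
  reflect ((forall i u, f (idem M i u) = idem N i (f u)) /\
           (forall a u, f (arrow M a u) = arrow N a (f u))) (is_hom f).
Proof.
apply: (iffP andP) => [[/forallP idemC /forallP arrowC]|[idemC arrowC]]; split.
- by move=> i u; move/eqP/lfunP: (idemC i) => /(_ u); rewrite !comp_lfunE.
- by move=> a u; move/eqP/lfunP: (arrowC a) => /(_ u); rewrite !comp_lfunE.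
- by apply/forallP=> i; apply/eqP/lfunP=> u; rewrite !comp_lfunE.
by apply/forallP=> a; apply/eqP/lfunP=> u; rewrite !comp_lfunE.
Qed.

Lemma hom_idemE M N (f : 'Hom(M, N)) (hf : is_hom f) i u : f (idem M i u) = idem N i (f u).
Proof. by case/is_homP: hf. Qed.

Lemma hom_arrowE M N (f : 'Hom(M, N)) (hf : is_hom f) a u : f (arrow M a u) = arrow N a (f u).
Proof. by case/is_homP: hf. Qed.

Lemma is_hom_linfun M N (f : M -> N) : linear f ->
  (forall i u, f (idem M i u) = idem N i (f u)) ->
  (forall a u, f (arrow M a u) = arrow N a (f u)) -> is_hom (linfun f).
Proof. by move=> lin_f idemC arrowC; apply/is_homP; split=> x u; rewrite !linfunE. Qed.

Lemma is_hom_id M : is_hom (\1%VF : 'Hom(M, M)).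
Proof. by apply/is_homP; split=> x u; rewrite !id_lfunE. Qed.

Lemma is_hom_comp L M N (f : 'Hom(L, M)) (g : 'Hom(M, N)) :
  is_hom f -> is_hom g -> is_hom (g \o f)%VF.
Proof.
move=> hf hg; apply/is_homP; split=> x u; rewrite !comp_lfunE.
  by rewrite (hom_idemE hf) (hom_idemE hg).
by rewrite (hom_arrowE hf) (hom_arrowE hg).
Qed.

Definition homs M N : {vspace 'Hom(M, N)} := vspace_of (fun f => is_hom f).

Lemma mem_homs M N f : (f \in homs M N) = is_hom f.
Proof.
apply/vspace_ofP/idP => //; split=> [|c g h hg hh].
  by apply/is_homP; split=> x u; rewrite !zero_lfunE linear0.
apply/is_homP; split=> x u; rewrite !(add_lfunE, scale_lfunE) linearP.
  by rewrite (hom_idemE hg) (hom_idemE hh).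
by rewrite (hom_arrowE hg) (hom_arrowE hh).
Qed.

Lemma is_hom0 M N : is_hom (0 : 'Hom(M, N)).
Proof. by rewrite -mem_homs mem0v. Qed.

Lemma is_homD M N (f g : 'Hom(M, N)) : is_hom f -> is_hom g -> is_hom (f + g).
Proof. by rewrite -!mem_homs; apply: memvD. Qed.

Lemma is_homN M N (f : 'Hom(M, N)) : is_hom f -> is_hom (- f).
Proof. by rewrite -!mem_homs memvN. Qed.

Lemma is_homB M N (f g : 'Hom(M, N)) : is_hom f -> is_hom g -> is_hom (f - g).
Proof. by rewrite -!mem_homs; apply: memvB. Qed.

Definition is_mono M N (f : 'Hom(M, N)) : bool := is_hom f && (lker f == 0%VS).
Definition is_epi M N (f : 'Hom(M, N)) : bool := is_hom f && (limg f == fullv).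

Lemma is_monoP M N (f : 'Hom(M, N)) :
  reflect (is_hom f /\ forall u, f u = 0 -> u = 0) (is_mono f).
Proof. by apply: (iffP andP) => -[hf] /lker_eq0P. Qed.

Lemma is_epiP M N (f : 'Hom(M, N)) :
  reflect (is_hom f /\ forall v, exists u, f u = v) (is_epi f).
Proof. by apply: (iffP andP) => -[hf] /limg_fullP. Qed.

Lemma mono_hom M N (f : 'Hom(M, N)) : is_mono f -> is_hom f.
Proof. by case/andP. Qed.

Lemma mono_lker0 M N (f : 'Hom(M, N)) : is_mono f -> lker f == 0%VS.
Proof. by case/andP. Qed.

Lemma mono_inj M N (f : 'Hom(M, N)) : is_mono f -> injective f.
Proof. by move/mono_lker0/lker0P. Qed.

Lemma mono_eq0 M N (f : 'Hom(M, N)) u : is_mono f -> f u = 0 -> u = 0.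
Proof. by case/is_monoP=> _; apply. Qed.

Lemma epi_hom M N (f : 'Hom(M, N)) : is_epi f -> is_hom f.
Proof. by case/andP. Qed.

Lemma epi_limg M N (f : 'Hom(M, N)) : is_epi f -> limg f = fullv.
Proof. by case/andP=> _ /eqP. Qed.

Lemma epi_onto M N (f : 'Hom(M, N)) : is_epi f -> forall v, exists u, f u = v.
Proof. by case/is_epiP. Qed.

Lemma is_isoE M N (f : 'Hom(M, N)) : is_iso f = is_mono f && is_epi f.
Proof. by rewrite /is_mono /is_epi andbACA andbb. Qed.

Lemma is_mono_id M : is_mono (\1%VF : 'Hom(M, M)).
Proof. by apply/is_monoP; split=> [|u]; [exact: is_hom_id | rewrite id_lfunE]. Qed.

Lemma mono_comp L M N (f : 'Hom(L, M)) (g : 'Hom(M, N)) :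
  is_mono f -> is_mono g -> is_mono (g \o f)%VF.
Proof.
move=> mf mg; apply/is_monoP; split=> [|u]; first exact: is_hom_comp (mono_hom mf) (mono_hom mg).
by rewrite comp_lfunE => /(mono_eq0 mg)/(mono_eq0 mf).
Qed.

Lemma epi_comp L M N (f : 'Hom(L, M)) (g : 'Hom(M, N)) :
  is_epi f -> is_epi g -> is_epi (g \o f)%VF.
Proof.
move=> ef eg; apply/andP; split; first exact: is_hom_comp (epi_hom ef) (epi_hom eg).
by rewrite limg_comp (epi_limg ef) (epi_limg eg).
Qed.

Lemma mono_of_comp L M N (f : 'Hom(L, M)) (g : 'Hom(M, N)) :
  is_hom f -> is_mono (g \o f)%VF -> is_mono f.
Proof.
move=> hf /is_monoP[_ inj]; apply/is_monoP; split=> // u fu0.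
by apply: inj; rewrite comp_lfunE fu0 linear0.
Qed.

Lemma iso_inv M N (f : 'Hom(M, N)) : is_iso f ->
  exists g : 'Hom(N, M), [/\ is_iso g, cancel f g & cancel g f].
Proof.
rewrite is_isoE => /andP[mf ef].
have fK : cancel f (f^-1)%VF := lker0_lfunK (mono_lker0 mf).
have Kf : cancel (f^-1)%VF f by move=> v; rewrite limg_lfunVK // epi_limg ?memvf.
exists (f^-1)%VF; split=> //; rewrite is_isoE.
have hV : is_hom (f^-1 : 'Hom(N, M))%VF.
  apply/is_homP; split=> x v; apply: (mono_inj mf).
    by rewrite (hom_idemE (mono_hom mf)) !Kf.
  by rewrite (hom_arrowE (mono_hom mf)) !Kf.
apply/andP; split; first by apply/is_monoP; split=> // v /(congr1 f); rewrite Kf linear0.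
by apply/is_epiP; split=> // u; exists (f u).
Qed.

Lemma isom_epimono M N : isom M N -> exists2 f : 'Hom(M, N), is_mono f & is_epi f.
Proof. by case=> f; rewrite is_isoE => /andP[mf ef]; exists f. Qed.

Lemma isomI M N (f : 'Hom(M, N)) : is_mono f -> is_epi f -> isom M N.
Proof. by move=> mf ef; exists f; rewrite is_isoE mf. Qed.

Lemma isom_sym M N : isom M N -> isom N M.
Proof. by case=> _ /iso_inv[g [iso_g _ _]]; exists g. Qed.

Lemma isom_trans L M N : isom L M -> isom M N -> isom L N.
Proof.
move=> /isom_epimono[f mf ef] /isom_epimono[g mg eg].
exact: isomI (mono_comp mf mg) (epi_comp ef eg).
Qed.

Lemma mono_factor N X Y (f : 'Hom(X, Y)) (h : 'Hom(N, Y)) :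
  is_mono f -> is_hom h -> (limg h <= limg f)%VS ->
  exists2 h' : 'Hom(N, X), is_hom h' & forall u, f (h' u) = h u.
Proof.
move=> mf hh hf; have fE u : f ((f^-1 \o h)%VF u) = h u.
  by rewrite comp_lfunE limg_lfunVK // (subvP hf) ?memv_img ?memvf.
exists (f^-1 \o h)%VF => //; apply/is_homP; split=> x u; apply: (mono_inj mf).
  by rewrite (hom_idemE (mono_hom mf)) !fE (hom_idemE hh).
by rewrite (hom_arrowE (mono_hom mf)) !fE (hom_arrowE hh).
Qed.

Lemma epi_factor N Y Z (g : 'Hom(Y, Z)) (h : 'Hom(Y, N)) :
  is_epi g -> is_hom h -> (lker g <= lker h)%VS ->
  exists2 h' : 'Hom(Z, N), is_hom h' & forall u, h' (g u) = h u.
Proof.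
move=> eg hh gh; have hE u : (h \o g^-1)%VF (g u) = h u.
  rewrite comp_lfunE; apply/eqP; rewrite -subr_eq0 -linearB -memv_ker (subvP gh) //.
  by rewrite memv_ker linearB /= limg_lfunVK ?subrr // memv_img ?memvf.
exists (h \o g^-1)%VF => //; apply/is_homP; split=> x v; have [u <-] := epi_onto eg v.
  by rewrite -(hom_idemE (epi_hom eg)) !hE (hom_idemE hh).
by rewrite -(hom_arrowE (epi_hom eg)) !hE (hom_arrowE hh).
Qed.

Lemma epi_factor_mono L M N (g : 'Hom(L, M)) (h : 'Hom(L, N)) :
  is_epi g -> is_hom h -> lker g = lker h ->
  exists2 h' : 'Hom(M, N), is_mono h' & forall u, h' (g u) = h u.
Proof.
move=> eg hh same_ker; have [|h' hh' h'E] := epi_factor eg hh; first by rewrite same_ker.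
exists h' => //; apply/is_monoP; split=> // v; have [u <-] := epi_onto eg v.
by rewrite h'E => hu0; apply/eqP; rewrite -memv_ker same_ker memv_ker hu0.
Qed.

Lemma epi_same_ker_iso L M N (g : 'Hom(L, M)) (g' : 'Hom(L, N)) :
  is_epi g -> is_epi g' -> lker g = lker g' ->
  exists2 f : 'Hom(M, N), is_iso f & forall u, f (g u) = g' u.
Proof.
move=> eg eg' same_ker; have [f mf fE] := epi_factor_mono eg (epi_hom eg') same_ker.
exists f => //; rewrite is_isoE mf; apply/is_epiP; split=> [|w]; first exact: mono_hom.
by have [u <-] := epi_onto eg' w; exists (g u).
Qed.

End Homomorphisms.

Section Submodules.
Variables (k : fieldType) (Q : quiver).
Implicit Types L M N X Y Z : kQmodule k Q.

Lemma is_submodP M (X : {vspace M}) :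
  reflect ((forall i u, u \in X -> idem M i u \in X) /\
           (forall a u, u \in X -> arrow M a u \in X)) (is_submod X).
Proof.
apply: (iffP idP) => [sX|[idemX arrowX]].
  by split=> x u uX; [exact: submod_idem|exact: submod_arrow].
by apply/andP; split; apply/forallP=> x; apply/subvP=> _ /memv_imgP[u uX ->]; auto.
Qed.

Lemma is_submod_ker M N (f : 'Hom(M, N)) : is_hom f -> is_submod (lker f).
Proof.
move=> hf; apply/is_submodP; split=> x u; rewrite !memv_ker => /eqP fu0.
  by rewrite (hom_idemE hf) fu0 linear0.
by rewrite (hom_arrowE hf) fu0 linear0.
Qed.

Lemma is_submod_img M N (f : 'Hom(M, N)) (X : {vspace M}) :
  is_hom f -> is_submod X -> is_submod (f @: X)%VS.
Proof.
move=> hf sX; apply/is_submodP; split=> x _ /memv_imgP[u uX ->].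
  by rewrite -(hom_idemE hf) memv_img // submod_idem.
by rewrite -(hom_arrowE hf) memv_img // submod_arrow.
Qed.

Lemma is_submod_preim M N (f : 'Hom(M, N)) (X : {vspace N}) :
  is_hom f -> is_submod X -> is_submod (f @^-1: X)%VS.
Proof.
move=> hf sX; apply/is_submodP; split=> x u; rewrite -!memv_preim => uX.
  by rewrite (hom_idemE hf) submod_idem.
by rewrite (hom_arrowE hf) submod_arrow.
Qed.

Lemma is_submodf M : is_submod (fullv : {vspace M}).
Proof. by apply/is_submodP; split=> x u _; apply: memvf. Qed.

Lemma is_submod0 M : is_submod (0%VS : {vspace M}).
Proof. by apply/is_submodP; split=> x u; rewrite !memv0 => /eqP->; rewrite linear0. Qed.

Lemma is_submod_limg M N (f : 'Hom(M, N)) : is_hom f -> is_submod (limg f).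
Proof. by move=> hf; apply: is_submod_img hf (is_submodf M). Qed.

Lemma is_submod_add M (X Y : {vspace M}) : is_submod X -> is_submod Y -> is_submod (X + Y)%VS.
Proof.
move=> sX sY; apply/is_submodP; split=> x _ /memv_addP[u uX [v vY ->]].
  by rewrite linearD memv_add ?submod_idem.
by rewrite linearD memv_add ?submod_arrow.
Qed.

Lemma is_submod_cap M (X Y : {vspace M}) : is_submod X -> is_submod Y -> is_submod (X :&: Y)%VS.
Proof.
move=> sX sY; apply/is_submodP; split=> x u; rewrite !memv_cap => /andP[uX uY].
  by rewrite !submod_idem.
by rewrite !submod_arrow.
Qed.

Lemma limg_quo_projS M (X Y Z : {vspace M}) : (X <= Z)%VS ->
  (quo_proj X @: Y <= quo_proj X @: Z)%VS = (Y <= Z)%VS.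
Proof.
move=> XZ; apply/idP/idP => [YZ|]; last exact: limgS.
apply/subvP=> u uY; have /(subvP YZ)/memv_imgP[v vZ uv] := memv_img (quo_proj X) uY.
rewrite -(subrK v u) memvD // (subvP XZ) // -quo_proj0 linearB subr_eq0.
exact/eqP.
Qed.

Definition sub_incl M (X : {vspace M}) (sX : is_submod X) : 'Hom(submod sX, M) :=
  linfun vsval.

Lemma sub_inclE M (X : {vspace M}) (sX : is_submod X) u : sub_incl sX u = vsval u.
Proof. by rewrite lfunE. Qed.

Lemma sub_incl_mono M (X : {vspace M}) (sX : is_submod X) : is_mono (sub_incl sX).
Proof.
apply/is_monoP; split=> [|u]; last by rewrite sub_inclE => u0; apply: subvs_inj.
apply/is_homP; split=> x u; rewrite !sub_inclE [X in vsval X]res_lfunE vsprojK //.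
  exact: submod_idem sX (subvsP u).
exact: submod_arrow sX (subvsP u).
Qed.

Lemma sub_incl_hom M (X : {vspace M}) (sX : is_submod X) : is_hom (sub_incl sX).
Proof. exact: mono_hom (sub_incl_mono sX). Qed.

Lemma limg_sub_incl M (X : {vspace M}) (sX : is_submod X) : limg (sub_incl sX) = X.
Proof.
apply/vspaceP=> u; apply/memv_imgP/idP => [[v _ ->]|uX]; first by rewrite sub_inclE subvsP.
by exists (vsproj X u); rewrite ?memvf // sub_inclE vsprojK.
Qed.

Lemma quo_proj_epi M (X : {vspace M}) (sX : is_submod X) :
  is_epi (quo_proj X : 'Hom(M, quomod sX)).
Proof. by rewrite /is_epi quo_proj_hom limg_quo_proj eqxx. Qed.

Lemma sub_factor M N (X : {vspace M}) (sX : is_submod X) (f : 'Hom(N, M)) :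
  is_hom f -> (limg f <= X)%VS ->
  exists2 h : 'Hom(N, submod sX), is_hom h & forall u, vsval (h u) = f u.
Proof.
move=> hf fX; have [|h hh hE] := mono_factor (sub_incl_mono sX) hf.
  by rewrite limg_sub_incl.
by exists h => // u; rewrite -sub_inclE hE.
Qed.

Lemma quo_factor M N (X : {vspace M}) (sX : is_submod X) (f : 'Hom(M, N)) :
  is_hom f -> (X <= lker f)%VS ->
  exists2 h : 'Hom(quomod sX, N), is_hom h & forall u, h (quo_proj X u) = f u.
Proof. by move=> hf Xf; apply: epi_factor (quo_proj_epi sX) hf _; rewrite lker_quo_proj. Qed.

Lemma img_factor M N (f : 'Hom(M, N)) (sI : is_submod (limg f)) : is_hom f ->
  exists2 h : 'Hom(M, submod sI), is_epi h & forall u, vsval (h u) = f u.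
Proof.
move=> hf; have [h hh hE] := sub_factor sI hf (subvv _); exists h => //.
apply/is_epiP; split=> // w; have /memv_imgP[u _ wE] := subvsP w.
by exists u; apply: subvs_inj; rewrite hE wE.
Qed.

Lemma mono_isom_img M N (f : 'Hom(M, N)) (sI : is_submod (limg f)) :
  is_mono f -> isom M (submod sI).
Proof.
move=> mf; have [h eh hE] := img_factor sI (mono_hom mf); apply: (isomI _ eh).
apply/is_monoP; split=> [|u hu0]; first exact: epi_hom.
by apply: (mono_eq0 mf); rewrite -hE hu0 linear0.
Qed.

Definition is_ses X Y Z (f : 'Hom(X, Y)) (g : 'Hom(Y, Z)) :=
  [/\ is_mono f, is_epi g & limg f = lker g].

Lemma short_exactP X Y Z :
  short_exact X Y Z <-> exists (f : 'Hom(X, Y)) (g : 'Hom(Y, Z)), is_ses f g.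
Proof.
split=> -[f [g]].
  case=> hf hg f0 fg g1; exists f, g.
  by split; rewrite // /is_mono /is_epi ?hf ?hg ?f0 ?g1 eqxx.
by case=> /andP[hf /eqP f0] /andP[hg /eqP g1] fg; exists f, g.
Qed.

Lemma ses_short_exact X Y Z (f : 'Hom(X, Y)) (g : 'Hom(Y, Z)) : is_ses f g -> short_exact X Y Z.
Proof. by move=> fg; apply/short_exactP; exists f, g. Qed.

Lemma ses_comp0 X Y Z (f : 'Hom(X, Y)) (g : 'Hom(Y, Z)) u : is_ses f g -> g (f u) = 0.
Proof. by case=> _ _ fg; apply/eqP; rewrite -memv_ker -fg memv_img ?memvf. Qed.

Lemma sub_quo_ses M (X : {vspace M}) (sX : is_submod X) :
  is_ses (sub_incl sX) (quo_proj X : 'Hom(M, quomod sX)).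
Proof. by split; rewrite ?sub_incl_mono ?quo_proj_epi ?limg_sub_incl ?lker_quo_proj. Qed.

Lemma ker_ses M N (g : 'Hom(M, N)) (sK : is_submod (lker g)) :
  is_epi g -> is_ses (sub_incl sK) g.
Proof. by move=> eg; split; rewrite ?sub_incl_mono ?limg_sub_incl. Qed.

Lemma hall_setP L M N (Y : {vspace L}) :
  (exists sY : is_submod Y, isom (submod sY) N /\ isom (quomod sY) M) <->
  exists (f : 'Hom(N, L)) (g : 'Hom(L, M)), is_ses f g /\ lker g = Y.
Proof.
split=> [[sY [/isom_sym/isom_epimono[f mf ef] /isom_epimono[g mg eg]]]|].
  exists (sub_incl sY \o f)%VF, (g \o quo_proj Y)%VF.
  have kerE : lker (g \o (quo_proj Y : 'Hom(L, quomod sY)))%VF = Y.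
    apply/vspaceP=> u; rewrite memv_ker comp_lfunE -quo_proj0.
    by apply/eqP/eqP => [/(mono_eq0 mg)|->]; rewrite ?linear0.
  split=> //; split; first exact: mono_comp mf (sub_incl_mono sY).
    exact: epi_comp (quo_proj_epi sY) eg.
  by rewrite kerE limg_comp (epi_limg ef) limg_sub_incl.
move=> [f [g [[mf eg fg] <-]]]; have sY := is_submod_ker (epi_hom eg); exists sY; split.
  by move: (sY); rewrite -fg => sI; apply/isom_sym/mono_isom_img.
have [|h iso_h _] := epi_same_ker_iso (quo_proj_epi sY) eg; first by rewrite lker_quo_proj.
by exists h.
Qed.

End Submodules.

Section Dimensions.
Variables (k : fieldType) (Q : quiver).
Implicit Types L M N X Y Z : kQmodule k Q.

Definition vertex_dim M i : nat := \dim (limg (idem M i)).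

Lemma idem_idem M i (u : M) : idem M i (idem M i u) = idem M i u.
Proof. by rewrite idem_app eqxx. Qed.

Lemma dimvecE M i : dimvec M i = (vertex_dim M i)%:Z. Proof. by rewrite ffunE. Qed.

Lemma dim_sum_vertex_dim M : \dim {:M} = (\sum_i vertex_dim M i)%N.
Proof.
have -> : fullv = (\sum_i limg (idem M i))%VS.
  apply/vspaceP=> u; rewrite memvf; apply/esym/memv_sumP.
  exists (fun i => idem M i u) => [i _|]; first by rewrite memv_img ?memvf.
  by rewrite idem_sum_app.
have /directvP -> /= : directv (\sum_i limg (idem M i)) => //.
apply/directv_sum_independent => v vI v0 i _.
have vE j : idem M i (v j) = if i == j then v j else 0.
  by have /memv_imgP[u _ ->] := vI j isT; rewrite idem_app; case: eqP => // ->.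
have := congr1 (idem M i) v0; rewrite linear0 linear_sum /= (bigD1 i) //= vE eqxx.
by rewrite big1 ?addr0 // => j ji; rewrite vE eq_sym (negPf ji).
Qed.

Lemma vertex_dim_ses X Y Z (f : 'Hom(X, Y)) (g : 'Hom(Y, Z)) i : is_ses f g ->
  vertex_dim Y i = (vertex_dim X i + vertex_dim Z i)%N.
Proof.
move=> [mf eg fg].
have memI M (u : M) : reflect (idem M i u = u) (u \in limg (idem M i)).
  by apply: limg_idempotentP; apply: idem_idem.
rewrite /vertex_dim -(limg_ker_dim g (limg (idem Y i))); congr (_ + _)%N; last congr (\dim _).
  rewrite -(limg_dim_lker0 (limg (idem X i)) (mono_lker0 mf)); congr (\dim _).
  rewrite -fg; apply/vspaceP=> w; rewrite memv_cap; apply/andP/memv_imgP.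
    case=> /memI wi /memv_imgP[u _ wE]; exists u => //; apply/memI/(mono_inj mf).
    by rewrite (hom_idemE (mono_hom mf)) -wE.
  case=> u /memI ui ->; rewrite memv_img ?memvf //; split=> //; apply/memI.
  by rewrite -(hom_idemE (mono_hom mf)) ui.
apply/vspaceP=> w; apply/memv_imgP/memI => [[u /memI ui ->]|wi].
  by rewrite -(hom_idemE (epi_hom eg)) ui.
have [v vE] := epi_onto eg w; exists (idem Y i v); first by rewrite memv_img ?memvf.
by rewrite (hom_idemE (epi_hom eg)) vE.
Qed.

Lemma dimvec_ses X Y Z (f : 'Hom(X, Y)) (g : 'Hom(Y, Z)) : is_ses f g ->
  dimvec Y = dimvec X + dimvec Z.
Proof. by move=> fg; apply/ffunP=> i; rewrite [RHS]ffunE !dimvecE (vertex_dim_ses i fg). Qed.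

Lemma dim_ses X Y Z (f : 'Hom(X, Y)) (g : 'Hom(Y, Z)) : is_ses f g ->
  \dim {:Y} = (\dim {:X} + \dim {:Z})%N.
Proof.
move=> fg; rewrite !dim_sum_vertex_dim -big_split; apply: eq_bigr => i _.
exact: vertex_dim_ses fg.
Qed.

Lemma dim_submod M (X : {vspace M}) (sX : is_submod X) : \dim {:submod sX} = \dim X.
Proof. by rewrite dimvf. Qed.

Lemma dim_quomod M (X : {vspace M}) (sX : is_submod X) :
  \dim {:quomod sX} = (\dim {:M} - \dim X)%N.
Proof. by rewrite dimvf -dimv_compl. Qed.

Lemma vertex_dim_isom M N i : isom M N -> vertex_dim M i = vertex_dim N i.
Proof.
have le (L L' : kQmodule k Q) : isom L L' -> (vertex_dim L i <= vertex_dim L' i)%N.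
  case/isom_epimono=> f mf _; rewrite /vertex_dim -(limg_dim_lker0 _ (mono_lker0 mf)).
  apply/dimvS/subvP=> _ /memv_imgP[_ /memv_imgP[u _ ->] ->].
  by rewrite (hom_idemE (mono_hom mf)) memv_img ?memvf.
by move=> iMN; apply/eqP; rewrite eqn_leq !le //; apply: isom_sym.
Qed.

Lemma dimvec_isom M N : isom M N -> dimvec M = dimvec N.
Proof. by move=> iMN; apply/ffunP=> i; rewrite !dimvecE (vertex_dim_isom i iMN). Qed.

Lemma is_zeroP M : is_zero M <-> forall u : M, u = 0.
Proof.
split=> [/eqP|zero_M].
  by rewrite dimv_eq0 => /eqP M0 u; apply/eqP; rewrite -memv0 -M0 memvf.
by apply/eqP; rewrite dimv_eq0; apply/eqP/vspaceP=> u; rewrite memvf (zero_M u) mem0v.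
Qed.

Lemma is_zero_submod M (X : {vspace M}) (sX : is_submod X) : is_zero (submod sX) <-> X = 0%VS.
Proof. by rewrite /is_zero dim_submod; split=> [/eqP|->]; rewrite ?dimv0 // dimv_eq0 => /eqP. Qed.

Lemma is_zero_quomod M (X : {vspace M}) (sX : is_submod X) :
  is_zero (quomod sX) <-> X = fullv.
Proof.
rewrite is_zeroP; split=> [zero_quo|X1 u].
  by apply/vspaceP=> u; rewrite memvf -quo_proj0; apply/eqP/zero_quo.
by have [v <-] := epi_onto (quo_proj_epi sX) u; apply/eqP; rewrite quo_proj0 X1 memvf.
Qed.

Lemma is_zero_dimvec M : is_zero M <-> dimvec M = 0.
Proof.
rewrite /is_zero dim_sum_vertex_dim; split=> [/eqP|dimvec0].
  rewrite sum_nat_eq0 => /forallP all0; apply/ffunP=> i.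
  by rewrite dimvecE (eqP (all0 i)) ffunE.
by rewrite big1 // => i _; move/ffunP/(_ i): dimvec0; rewrite dimvecE ffunE => -[].
Qed.

Lemma is_zero_isom M N : isom M N -> is_zero M -> is_zero N.
Proof. by move=> iMN; rewrite !is_zero_dimvec (dimvec_isom iMN). Qed.

Lemma is_zero_mono M N (f : 'Hom(M, N)) : is_mono f -> is_zero N -> is_zero M.
Proof.
by move=> mf /is_zeroP zero_N; apply/is_zeroP=> u; apply: (mono_eq0 mf); apply: zero_N.
Qed.

Lemma epi_neq0 M N (f : 'Hom(M, N)) : is_epi f -> ~ is_zero N -> f != 0.
Proof.
move=> ef nzN; rewrite -limg_eq0 (epi_limg ef); apply/eqP=> N0; apply: nzN.
by rewrite /is_zero N0 dimv0.
Qed.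

Lemma mono_dimvec_iso M N (f : 'Hom(M, N)) : is_mono f -> dimvec M = dimvec N -> is_iso f.
Proof.
move=> mf same_dim; rewrite is_isoE mf /is_epi (mono_hom mf) eqEdim subvf /=.
rewrite (limg_dim_lker0 _ (mono_lker0 mf)) !dim_sum_vertex_dim; apply: eq_leq.
by apply: eq_bigr => i _; move/ffunP/(_ i): same_dim; rewrite !dimvecE => -[].
Qed.

Definition dimhom M N : nat := \dim (homs M N).

Lemma dimhom_gt0P M N : (0 < dimhom M N)%N <-> exists2 f : 'Hom(M, N), is_hom f & f != 0.
Proof.
rewrite lt0n dimv_eq0; split=> [nz|[f hf]]; last first.
  by apply: contra_neq => /eqP; rewrite -subv0 => /subvP/(_ f);
    rewrite mem_homs memv0 => /(_ hf)/eqP.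
by exists (vpick (homs M N)); rewrite -?mem_homs ?memv_pick // vpick0.
Qed.

Lemma dimhom_eq0P M N : dimhom M N = 0%N <-> forall f : 'Hom(M, N), is_hom f -> f = 0.
Proof.
split=> [dim0 f hf|all0].
  by apply: contra_eq dim0 => f0; rewrite -lt0n; apply/dimhom_gt0P; exists f.
apply/eqP; rewrite -leqn0 leqNgt; apply/negP=> /dimhom_gt0P[f hf].
by rewrite (all0 f hf) eqxx.
Qed.

Lemma dimhom_self0 M : dimhom M M = 0%N -> is_zero M.
Proof.
move/dimhom_eq0P/(_ _ (is_hom_id M))/lfunP=> id0; apply/is_zeroP=> u.
by have := id0 u; rewrite id_lfunE zero_lfunE.
Qed.

Lemma dimhom_self_gt0 M : ~ is_zero M -> (0 < dimhom M M)%N.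
Proof. by move=> nz; rewrite lt0n; apply/eqP=> /dimhom_self0. Qed.

Lemma dimhom_mono N X Y (f : 'Hom(X, Y)) : is_mono f -> (dimhom N X <= dimhom N Y)%N.
Proof.
move=> mf; rewrite /dimhom -(limg_dim_lker0 _ (postcomp_inj N (mono_lker0 mf))).
apply/dimvS/subvP=> _ /memv_imgP[h + ->]; rewrite postcompE !mem_homs => hh.
exact: is_hom_comp hh (mono_hom mf).
Qed.

Lemma dimhom_epi N Y Z (g : 'Hom(Y, Z)) : is_epi g -> (dimhom Z N <= dimhom Y N)%N.
Proof.
move=> /andP[hg onto]; rewrite /dimhom -(limg_dim_lker0 _ (precomp_inj N onto)).
apply/dimvS/subvP=> _ /memv_imgP[h + ->]; rewrite precompE !mem_homs => hh.
exact: is_hom_comp hg hh.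
Qed.

Lemma dimhom_isoml M M' N : isom M M' -> dimhom M N = dimhom M' N.
Proof.
move=> iso; apply/eqP; rewrite eqn_leq.
have [f _ ef] := isom_epimono iso; have [g _ eg] := isom_epimono (isom_sym iso).
by rewrite (dimhom_epi N ef) (dimhom_epi N eg).
Qed.

Lemma dimhom_isomr M M' N : isom M M' -> dimhom N M = dimhom N M'.
Proof.
move=> iso; apply/eqP; rewrite eqn_leq.
have [f mf _] := isom_epimono iso; have [g mg _] := isom_epimono (isom_sym iso).
by rewrite (dimhom_mono N mf) (dimhom_mono N mg).
Qed.

Lemma dimhom_postcomp N X Y Z (f : 'Hom(X, Y)) (g : 'Hom(Y, Z)) : is_ses f g ->
  dimhom N Y = (dimhom N X + \dim (postcomp N g @: homs N Y))%N.
Proof.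
move=> fg; have [mf _ imf] := fg; rewrite /dimhom -(limg_ker_dim (postcomp N g) (homs N Y)).
rewrite -(limg_dim_lker0 (homs N X) (postcomp_inj N (mono_lker0 mf))); congr (\dim _ + _)%N.
apply/vspaceP=> h; rewrite memv_cap memv_ker postcompE mem_homs; apply/andP/memv_imgP.
  case=> hh /eqP/lfunP gh0; have [|h' hh' h'E] := mono_factor mf hh.
    rewrite imf; apply/subvP=> _ /memv_imgP[x _ ->]; rewrite memv_ker -comp_lfunE gh0.
    by rewrite zero_lfunE.
  exists h'; first by rewrite mem_homs.
  by rewrite postcompE; apply/lfunP=> x; rewrite comp_lfunE h'E.
case=> h'; rewrite mem_homs postcompE => hh' ->; split; first exact: is_hom_comp hh' (mono_hom mf).
by apply/eqP/lfunP=> x; rewrite !comp_lfunE zero_lfunE (ses_comp0 _ fg).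
Qed.

Lemma dimhom_precomp N X Y Z (f : 'Hom(X, Y)) (g : 'Hom(Y, Z)) : is_ses f g ->
  dimhom Y N = (dimhom Z N + \dim (precomp N f @: homs Y N))%N.
Proof.
move=> fg; have [_ eg imf] := fg; have [hg onto] := andP eg.
rewrite /dimhom -(limg_ker_dim (precomp N f) (homs Y N)).
rewrite -(limg_dim_lker0 (homs Z N) (precomp_inj N onto)); congr (\dim _ + _)%N.
apply/vspaceP=> h; rewrite memv_cap memv_ker precompE mem_homs; apply/andP/memv_imgP.
  case=> hh /eqP/lfunP hf0; have [|h' hh' h'E] := epi_factor eg hh.
    rewrite -imf; apply/subvP=> _ /memv_imgP[x _ ->]; rewrite memv_ker -comp_lfunE hf0.
    by rewrite zero_lfunE.
  exists h'; first by rewrite mem_homs.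
  by rewrite precompE; apply/lfunP=> x; rewrite comp_lfunE h'E.
case=> h'; rewrite mem_homs precompE => hh' ->; split; first exact: is_hom_comp hg hh'.
by apply/eqP/lfunP=> x; rewrite !comp_lfunE zero_lfunE (ses_comp0 _ fg) linear0.
Qed.

Lemma dimhom_sesr N X Y Z (f : 'Hom(X, Y)) (g : 'Hom(Y, Z)) : is_ses f g ->
  (dimhom N Y <= dimhom N X + dimhom N Z)%N.
Proof.
move=> fg; have [_ eg _] := fg; rewrite (dimhom_postcomp N fg) leq_add2l.
apply/dimvS/subvP=> _ /memv_imgP[h + ->]; rewrite postcompE !mem_homs => hh.
exact: is_hom_comp hh (epi_hom eg).
Qed.

Lemma dimhom_sesl N X Y Z (f : 'Hom(X, Y)) (g : 'Hom(Y, Z)) : is_ses f g ->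
  (dimhom Y N <= dimhom X N + dimhom Z N)%N.
Proof.
move=> fg; have [mf _ _] := fg; rewrite (dimhom_precomp N fg) addnC leq_add2r.
apply/dimvS/subvP=> _ /memv_imgP[h + ->]; rewrite precompE !mem_homs => hh.
exact: is_hom_comp (mono_hom mf) hh.
Qed.

End Dimensions.

Section DirectSums.
Variables (k : fieldType) (Q : quiver).
Implicit Types L M N X Y Z : kQmodule k Q.

Definition dsum_inl X Y : 'Hom(X, dsum X Y) := linfun (fun u : X => (u, 0) : dsum X Y).
Definition dsum_inr X Y : 'Hom(Y, dsum X Y) := linfun (fun u : Y => (0, u) : dsum X Y).
Definition dsum_fst X Y : 'Hom(dsum X Y, X) := linfun (fun u : dsum X Y => u.1).
Definition dsum_snd X Y : 'Hom(dsum X Y, Y) := linfun (fun u : dsum X Y => u.2).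

Lemma dsum_pairD X Y (x x' : X) (y y' : Y) :
  (x, y) + (x', y') = (x + x', y + y') :> dsum X Y.
Proof. by []. Qed.

Lemma dsum_pairZ X Y c (x : X) (y : Y) : c *: ((x, y) : dsum X Y) = (c *: x, c *: y).
Proof. by []. Qed.

Lemma dsum_inlE X Y u : dsum_inl X Y u = (u, 0).
Proof. by rewrite linfunE // => c v w; rewrite dsum_pairZ dsum_pairD scaler0 addr0. Qed.

Lemma dsum_inrE X Y u : dsum_inr X Y u = (0, u).
Proof. by rewrite linfunE // => c v w; rewrite dsum_pairZ dsum_pairD scaler0 addr0. Qed.

Lemma dsum_fstE X Y u : dsum_fst X Y u = u.1. Proof. by rewrite linfunE. Qed.
Lemma dsum_sndE X Y u : dsum_snd X Y u = u.2. Proof. by rewrite linfunE. Qed.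

Lemma idem_dsum X Y i (u : dsum X Y) : idem (dsum X Y) i u = (idem X i u.1, idem Y i u.2).
Proof. by rewrite [LHS]lfunE. Qed.

Lemma arrow_dsum X Y a (u : dsum X Y) : arrow (dsum X Y) a u = (arrow X a u.1, arrow Y a u.2).
Proof. by rewrite [LHS]lfunE. Qed.

Lemma dsum_inl_mono X Y : is_mono (dsum_inl X Y).
Proof.
apply/is_monoP; split=> [|u]; last by rewrite dsum_inlE => -[].
by apply/is_homP; split=> x u; rewrite !dsum_inlE ?idem_dsum ?arrow_dsum /= linear0.
Qed.

Lemma dsum_inr_mono X Y : is_mono (dsum_inr X Y).
Proof.
apply/is_monoP; split=> [|u]; last by rewrite dsum_inrE => -[].
by apply/is_homP; split=> x u; rewrite !dsum_inrE ?idem_dsum ?arrow_dsum /= linear0.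
Qed.

Lemma dsum_fst_epi X Y : is_epi (dsum_fst X Y).
Proof.
apply/is_epiP; split=> [|u]; last by exists (u, 0); rewrite dsum_fstE.
by apply/is_homP; split=> x u; rewrite !dsum_fstE ?idem_dsum ?arrow_dsum.
Qed.

Lemma dsum_snd_epi X Y : is_epi (dsum_snd X Y).
Proof.
apply/is_epiP; split=> [|u]; last by exists (0, u); rewrite dsum_sndE.
by apply/is_homP; split=> x u; rewrite !dsum_sndE ?idem_dsum ?arrow_dsum.
Qed.

Lemma dsum_inl_hom X Y : is_hom (dsum_inl X Y). Proof. exact: mono_hom (dsum_inl_mono X Y). Qed.
Lemma dsum_inr_hom X Y : is_hom (dsum_inr X Y). Proof. exact: mono_hom (dsum_inr_mono X Y). Qed.
Lemma dsum_fst_hom X Y : is_hom (dsum_fst X Y). Proof. exact: epi_hom (dsum_fst_epi X Y). Qed.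
Lemma dsum_snd_hom X Y : is_hom (dsum_snd X Y). Proof. exact: epi_hom (dsum_snd_epi X Y). Qed.

Lemma dsum_ses X Y : is_ses (dsum_inl X Y) (dsum_snd X Y).
Proof.
split; [exact: dsum_inl_mono | exact: dsum_snd_epi |].
apply/vspaceP=> -[u v]; rewrite memv_ker dsum_sndE /=; apply/memv_imgP/eqP => [[w _]|->].
  by rewrite dsum_inlE => -[].
by exists u; rewrite ?memvf ?dsum_inlE.
Qed.

Definition dsum_copair L X Y (f : 'Hom(X, L)) (g : 'Hom(Y, L)) : 'Hom(dsum X Y, L) :=
  ((f \o dsum_fst X Y) + (g \o dsum_snd X Y))%VF.
Definition dsum_pair L X Y (f : 'Hom(L, X)) (g : 'Hom(L, Y)) : 'Hom(L, dsum X Y) :=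
  ((dsum_inl X Y \o f) + (dsum_inr X Y \o g))%VF.

Lemma dsum_copairE L X Y (f : 'Hom(X, L)) (g : 'Hom(Y, L)) u :
  dsum_copair f g u = f u.1 + g u.2.
Proof. by rewrite add_lfunE !comp_lfunE dsum_fstE dsum_sndE. Qed.

Lemma dsum_pairE L X Y (f : 'Hom(L, X)) (g : 'Hom(L, Y)) u : dsum_pair f g u = (f u, g u).
Proof. by rewrite add_lfunE !comp_lfunE dsum_inlE dsum_inrE dsum_pairD addr0 add0r. Qed.

Lemma dsum_copair_hom L X Y (f : 'Hom(X, L)) (g : 'Hom(Y, L)) :
  is_hom f -> is_hom g -> is_hom (dsum_copair f g).
Proof.
move=> hf hg; apply: is_homD; first exact: is_hom_comp (dsum_fst_hom X Y) hf.
exact: is_hom_comp (dsum_snd_hom X Y) hg.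
Qed.

Lemma dsum_pair_hom L X Y (f : 'Hom(L, X)) (g : 'Hom(L, Y)) :
  is_hom f -> is_hom g -> is_hom (dsum_pair f g).
Proof.
move=> hf hg; apply: is_homD; first exact: is_hom_comp hf (dsum_inl_hom X Y).
exact: is_hom_comp hg (dsum_inr_hom X Y).
Qed.

Lemma dsum_copair_eta (L : vectType k) X Y (h : 'Hom(dsum X Y, L)) u :
  h u = (h \o dsum_inl X Y)%VF u.1 + (h \o dsum_inr X Y)%VF u.2.
Proof.
case: u => x y; rewrite !comp_lfunE -linearD /= dsum_inlE dsum_inrE dsum_pairD.
by rewrite addr0 add0r.
Qed.

Lemma dimhom_dsuml N X Y : dimhom (dsum X Y) N = (dimhom X N + dimhom Y N)%N.
Proof.
rewrite (dimhom_precomp N (dsum_ses X Y)) addnC; congr (\dim _ + _)%N.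
apply/vspaceP=> h; rewrite mem_homs; apply/memv_imgP/idP => [[h' + ->]|hh].
  by rewrite mem_homs precompE; apply: is_hom_comp (dsum_inl_hom X Y).
exists (h \o dsum_fst X Y)%VF; first by rewrite mem_homs; apply: is_hom_comp (dsum_fst_hom X Y) hh.
by rewrite precompE; apply/lfunP=> u; rewrite !comp_lfunE dsum_inlE dsum_fstE.
Qed.

Lemma dimhom_dsumr N X Y : dimhom N (dsum X Y) = (dimhom N X + dimhom N Y)%N.
Proof.
rewrite (dimhom_postcomp N (dsum_ses X Y)); congr (_ + \dim _)%N.
apply/vspaceP=> h; rewrite mem_homs; apply/memv_imgP/idP => [[h' + ->]|hh].
  by rewrite mem_homs postcompE => hh'; apply: is_hom_comp hh' (dsum_snd_hom X Y).
exists (dsum_inr X Y \o h)%VF; first by rewrite mem_homs; apply: is_hom_comp hh (dsum_inr_hom X Y).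
by rewrite postcompE; apply/lfunP=> u; rewrite !comp_lfunE dsum_inrE dsum_sndE.
Qed.

Lemma isom_dsum X X' Y Y' : isom X X' -> isom Y Y' -> isom (dsum X Y) (dsum X' Y').
Proof.
move=> /isom_epimono[f mf ef] /isom_epimono[g mg eg].
have hh : is_hom (dsum_pair (f \o dsum_fst X Y)%VF (g \o dsum_snd X Y)%VF).
  apply: dsum_pair_hom; first exact: is_hom_comp (dsum_fst_hom X Y) (mono_hom mf).
  exact: is_hom_comp (dsum_snd_hom X Y) (mono_hom mg).
have hE u v : dsum_pair (f \o dsum_fst X Y)%VF (g \o dsum_snd X Y)%VF (u, v) = (f u, g v).
  by rewrite dsum_pairE !comp_lfunE dsum_fstE dsum_sndE.
apply: (isomI (f := dsum_pair (f \o dsum_fst X Y)%VF (g \o dsum_snd X Y)%VF)).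
  by apply/is_monoP; split=> // -[u v]; rewrite hE => -[/(mono_eq0 mf)-> /(mono_eq0 mg)->].
apply/is_epiP; split=> // -[x y]; have [u <-] := epi_onto ef x; have [v <-] := epi_onto eg y.
by exists (u, v).
Qed.

Lemma isom_dsum0r X Y : is_zero Y -> isom (dsum X Y) X.
Proof.
move/is_zeroP=> Y0; apply: isomI (dsum_fst_epi X Y); apply/is_monoP.
by split=> [|[u v]]; [exact: dsum_fst_hom | rewrite dsum_fstE /= => ->; rewrite (Y0 v)].
Qed.

Lemma isom_dsum0l X Y : is_zero X -> isom (dsum X Y) Y.
Proof.
move/is_zeroP=> X0; apply: isomI (dsum_snd_epi X Y); apply/is_monoP.
by split=> [|[u v]]; [exact: dsum_snd_hom | rewrite dsum_sndE /= => ->; rewrite (X0 u)].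
Qed.

Lemma ses_split X Y Z (f : 'Hom(X, Y)) (g : 'Hom(Y, Z)) (s : 'Hom(Z, Y)) :
  is_ses f g -> is_hom s -> (forall z, g (s z) = z) -> isom (dsum X Z) Y.
Proof.
move=> fg hs gs; have [mf _ imf] := fg.
have hh := dsum_copair_hom (mono_hom mf) hs.
apply: (@isomI _ _ _ _ (dsum_copair f s)).
  apply/is_monoP; split=> // -[x z]; rewrite dsum_copairE /= => fs0.
  have z0 : z = 0 by have := congr1 g fs0; rewrite linearD /= (ses_comp0 _ fg) add0r gs linear0.
  by move: fs0; rewrite z0 linear0 addr0 => /(mono_eq0 mf)->.
apply/is_epiP; split=> // y; have : y - s (g y) \in limg f.
  by rewrite imf memv_ker linearB /= gs subrr.
by case/memv_imgP=> x _ xE; exists (x, g y); rewrite dsum_copairE /= -xE subrK.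
Qed.

Section InternalSum.
Variables (M : kQmodule k Q) (A B : {vspace M}) (sA : is_submod A) (sB : is_submod B).
Let incl := dsum_copair (sub_incl sA) (sub_incl sB).

Lemma internal_sum_mono : (A :&: B = 0)%VS -> is_mono incl.
Proof.
move=> AB0; apply/is_monoP; split.
  by apply: dsum_copair_hom; apply: sub_incl_hom.
move=> [a b]; rewrite dsum_copairE /= !sub_inclE => /eqP; rewrite addr_eq0 => /eqP ab.
have a0 : vsval a = 0 by apply/eqP; rewrite -memv0 -AB0 memv_cap subvsP ab memvN subvsP.
have b0 : vsval b = 0 by apply/eqP; rewrite -oppr_eq0 -ab a0.
by congr pair; apply: subvs_inj; rewrite ?a0 ?b0 linear0.
Qed.

Lemma internal_sum_epi : (A + B = fullv)%VS -> is_epi incl.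
Proof.
move=> AB1; apply/is_epiP; split=> [|u]; first by apply: dsum_copair_hom; apply: sub_incl_hom.
have : u \in (A + B)%VS by rewrite AB1 memvf.
case/memv_addP=> a aA [b bB ->]; exists (vsproj A a, vsproj B b).
by rewrite dsum_copairE /= !sub_inclE !vsprojK.
Qed.

End InternalSum.

Lemma indecomposable_no_complement M (A B : {vspace M}) : indecomposable M ->
  is_submod A -> is_submod B -> (A :&: B = 0)%VS -> (A + B = fullv)%VS ->
  A = 0%VS \/ B = 0%VS.
Proof.
move=> [_ indec] sA sB AB0 AB1.
have /isom_sym/indec := isomI (internal_sum_mono sA sB AB0) (internal_sum_epi sA sB AB1).
by rewrite !is_zero_submod.
Qed.

End DirectSums.

(** * The Euler form and the translate *)

Section PathAction.
Variables (k : fieldType) (Q : quiver) (N : kQmodule k Q).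

Definition path_action i (s : seq (arr Q)) (u : N) : N :=
  foldl (fun v a => arrow N a v) (idem N i u) s.

Lemma path_action_linear i s : linear (path_action i s).
Proof.
move=> c u v; rewrite /path_action linearP /=; move: (idem N i u) (idem N i v).
by elim: s => //= a s IH x y; rewrite linearP IH.
Qed.

Lemma path_action_idem i s j u :
  path_action i s (idem N j u) = if i == j then path_action i s u else 0.
Proof.
rewrite /path_action idem_app; case: eqP => // _.
by elim: s => //= a s; rewrite linear0.
Qed.

Lemma arrow_src a (u : N) : arrow N a (idem N (src a) u) = arrow N a u.
Proof. by rewrite -[RHS]arrow_app -[LHS]arrow_app idem_app eqxx. Qed.

Lemma arrow_tgt a (u : N) : idem N (tgt a) (arrow N a u) = arrow N a u.
Proof. by rewrite -[in LHS]arrow_app idem_app eqxx arrow_app. Qed.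

Lemma arrow_idem a i (u : N) : arrow N a (idem N i u) = if src a == i then arrow N a u else 0.
Proof. by rewrite -arrow_src idem_app; case: eqP => _; rewrite ?arrow_src ?linear0. Qed.

Lemma idem_arrow a i (u : N) : idem N i (arrow N a u) = if i == tgt a then arrow N a u else 0.
Proof. by rewrite -arrow_tgt idem_app; case: eqP => [->|_]; rewrite ?arrow_tgt. Qed.

Lemma path_action_rcons i s a u : path_action i (rcons s a) u = arrow N a (path_action i s u).
Proof. by rewrite /path_action foldl_rcons. Qed.

Lemma path_action_cons a s u :
  path_action (src a) (a :: s) u = path_action (tgt a) s (arrow N a u).
Proof. by rewrite /path_action /= arrow_src arrow_tgt. Qed.

Lemma path_action_end i s u : idem N (qend i s) (path_action i s u) = path_action i s u.
Proof.
case/lastP: s => [|s a]; first exact: idem_idem.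
by rewrite path_action_rcons /qend map_rcons last_rcons arrow_tgt.
Qed.

End PathAction.

Lemma hom_path_action (k : fieldType) (Q : quiver) (M N : kQmodule k Q) (g : 'Hom(M, N)) j s u :
  is_hom g -> g (path_action j s u) = path_action j s (g u).
Proof.
move=> hg; elim/last_ind: s => [|s a IH]; first exact: hom_idemE.
by rewrite !path_action_rcons (hom_arrowE hg) IH.
Qed.

Section Paths.
Variable Q : quiver.

Lemma is_qpath_cat (i : vtx Q) s t :
  is_qpath i (s ++ t) = is_qpath i s && is_qpath (qend i s) t.
Proof. by elim: s i => //= a s IH i; rewrite IH andbA. Qed.

Lemma is_qpath_rcons (i : vtx Q) s a :
  is_qpath i (rcons s a) = is_qpath i s && (src a == qend i s).
Proof. by rewrite -cats1 is_qpath_cat /= andbT. Qed.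

Lemma qpathP (p : qpath Q) : is_qpath (pstart p) (parrows p).
Proof. exact: (valP p). Qed.

Lemma qpath_inj (p q : qpath Q) : pstart p = pstart q -> parrows p = parrows q -> p = q.
Proof.
move=> same_start same_arrows; apply: val_inj.
rewrite [LHS]surjective_pairing [RHS]surjective_pairing.
by congr (_, _) => //; exact: val_inj.
Qed.

Lemma pval_path (k : fieldType) (U : vectType k) (f : {ffun qpath Q -> U}) i s p :
  pstart p = i -> parrows p = s -> pval f i s = f p.
Proof. by move=> <- <-; exact: pvalE. Qed.

Hypothesis acyclicQ : acyclic Q.

Lemma acyclic_no_loop (a : arr Q) : src a != tgt a.
Proof.
apply/eqP=> loop; have := acyclicQ (i := src a) (s := [:: a]).
by rewrite /= eqxx => /(_ isT (esym loop)).
Qed.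

Lemma qpath_size (i : vtx Q) s : is_qpath i s -> (size s < #|vtx Q|)%N.
Proof.
move=> path_s; suff visited_uniq : uniq (i :: map (@tgt Q) s).
  have := max_card (mem (i :: map (@tgt Q) s)).
  by rewrite (card_uniqP visited_uniq) /= size_map.
elim: s i path_s => //= a s IH i /andP[/eqP ai path_s]; rewrite -/(uniq (_ :: _)).
have /= -> := IH _ path_s; rewrite andbT; apply/negP=> /(nthP i)[j].
rewrite /= size_map => js back; have : take j.+1 (a :: s) = [::]; last by [].
apply: (acyclicQ (i := i)).
  have : is_qpath i (a :: s) by rewrite /= ai eqxx.
  by rewrite -{1}(cat_take_drop j.+1 (a :: s)) is_qpath_cat => /andP[].
rewrite /qend map_take (last_nth i) size_takel ?size_map //.
by rewrite -[RHS]back -[LHS]/(nth i (take j.+1 (map (@tgt Q) (a :: s))) j) nth_take.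
Qed.

Lemma exists_qpath (i : vtx Q) s : is_qpath i s ->
  exists p : qpath Q, pstart p = i /\ parrows p = s.
Proof. by move=> path_s; apply: qpath_ex => //; apply/ltnW/(qpath_size path_s). Qed.

Fact trivial_path_subproof (i : vtx Q) :
  exists p : qpath Q, (pstart p == i) && (parrows p == [::]).
Proof. by have [p [ps pa]] := @exists_qpath i [::] isT; exists p; rewrite ps pa !eqxx. Qed.

Definition trivial_path i : qpath Q := xchoose (trivial_path_subproof i).

Lemma trivial_path_start i : pstart (trivial_path i) = i.
Proof. by case/andP: (xchooseP (trivial_path_subproof i)) => /eqP. Qed.

Lemma trivial_path_arrows i : parrows (trivial_path i) = [::].
Proof. by case/andP: (xchooseP (trivial_path_subproof i)) => _ /eqP. Qed.

Lemma trivial_path_end i : pend (trivial_path i) = i.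
Proof. by rewrite /pend trivial_path_start trivial_path_arrows. Qed.

Lemma acyclic_exists_initial (P : vtx Q -> Prop) : (exists i, P i) ->
  exists2 i, P i & forall a, tgt a = i -> ~ P (src a).
Proof.
move=> [i0 Pi0]; apply: contrapT => no_initial.
have step i : P i -> exists2 a, tgt a = i & P (src a).
  move=> Pi; apply: contrapT => no_arrow; apply: no_initial; exists i => // a ai Pa.
  by apply: no_arrow; exists a.
suff : exists i s, [/\ P i, is_qpath i s & size s = #|vtx Q|].
  by case=> i [s [_ /qpath_size + size_s]]; rewrite size_s ltnn.
elim: #|vtx Q| => [|n [i [s [Pi path_s size_s]]]]; first by exists i0, [::].
have [a ai Pa] := step i Pi; exists (src a), (a :: s).
by rewrite /= eqxx ai path_s size_s.
Qed.

End Paths.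

(* Ext^1(M, N) is the cokernel of the coboundary from the vertex-preserving   *)
(* maps to the arrowwise maps; its dual for the trace pairing is the space of *)
(* dual cocycles, which is Hom(N, tau M).                                     *)
Section Cochains.
Variables (k : fieldType) (Q : quiver).

Definition block_maps (M N : kQmodule k Q) i j : {vspace 'Hom(M, N)} :=
  vspace_of (fun f : 'Hom(M, N) => forall u, f u = idem N j (f (idem M i u))).

Lemma block_mapsP (M N : kQmodule k Q) i j (f : 'Hom(M, N)) :
  reflect (forall u, f u = idem N j (f (idem M i u))) (f \in block_maps M N i j).
Proof.
apply: vspace_ofP; split=> [u|c g h gE hE u]; first by rewrite !zero_lfunE linear0.
by rewrite !(add_lfunE, scale_lfunE) linearP /= -gE -hE.
Qed.

Section BlockFamilies.
Variables (I : finType) (s t : I -> vtx Q) (M N : kQmodule k Q).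

Definition block_families : {vspace {ffun I -> 'Hom(M, N)}} :=
  vspace_of (fun x : {ffun I -> 'Hom(M, N)} => forall i, x i \in block_maps M N (s i) (t i)).

Lemma mem_block_families x :
  x \in block_families <-> forall i, x i \in block_maps M N (s i) (t i).
Proof.
suff block_subspace : subspace_pred
    (fun x : {ffun I -> 'Hom(M, N)} => forall i, x i \in block_maps M N (s i) (t i)).
  by split=> /(vspace_ofP _ block_subspace).
by split=> [i|c y z yB zB i]; rewrite !ffunE ?mem0v // memvD ?memvZ.
Qed.

Lemma block_familiesP (x : {ffun I -> 'Hom(M, N)}) :
  reflect (forall i u, x i u = idem N (t i) (x i (idem M (s i) u))) (x \in block_families).
Proof.
apply: (iffP idP) => [/mem_block_families xB i|xE]; first exact/block_mapsP.
by apply/mem_block_families=> i; apply/block_mapsP/xE.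
Qed.

Lemma dim_block_families :
  \dim block_families = (\sum_i vertex_dim M (s i) * vertex_dim N (t i))%N.
Proof.
rewrite (dim_ffun_family mem_block_families); apply: eq_bigr => i _.
apply: dim_hom_idempotents => [||f]; try exact: idem_idem.
by split=> /block_mapsP.
Qed.

End BlockFamilies.

Section Complex.
Variables M N : kQmodule k Q.

Definition graded_maps : {vspace 'Hom(M, N)} :=
  vspace_of (fun f : 'Hom(M, N) => forall i u, f (idem M i u) = idem N i (f u)).

Lemma graded_mapsP (f : 'Hom(M, N)) :
  reflect (forall i u, f (idem M i u) = idem N i (f u)) (f \in graded_maps).
Proof.
apply: vspace_ofP; split=> [i u|c g h gE hE i u]; first by rewrite !zero_lfunE linear0.
by rewrite !(add_lfunE, scale_lfunE) linearP /= gE hE.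
Qed.

Lemma dim_graded_maps : \dim graded_maps = (\sum_i vertex_dim M i * vertex_dim N i)%N.
Proof.
rewrite -(dim_block_families id id).
apply: (dimv_linear_bij (f := fun f : 'Hom(M, N) => [ffun i => (idem N i \o f)%VF])).
- by move=> c f g; apply/ffunP=> i; rewrite !ffunE comp_lfunDr comp_lfunZr.
- move=> f _ /ffunP blocks0; apply/lfunP=> u; rewrite -(idem_sum_app (f u)) zero_lfunE.
  by apply: big1 => i _; rewrite -comp_lfunE; have := blocks0 i; rewrite !ffunE => ->;
    rewrite zero_lfunE.
move=> x; split=> [/block_familiesP xE|[f /graded_mapsP fE <-]]; last first.
  by apply/block_familiesP=> i u; rewrite ffunE !comp_lfunE fE !idem_idem.
have x_out i j u : idem N i (x j u) = if i == j then x j u else 0.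
  by rewrite xE idem_app; case: eqP => // ->.
exists (\sum_i x i); last first.
  apply/ffunP=> i; apply/lfunP=> u; rewrite ffunE comp_lfunE sum_lfunE linear_sum /=.
  rewrite (bigD1 i) //= big1 ?addr0 ?x_out ?eqxx // => j ji.
  by rewrite x_out eq_sym (negPf ji).
apply/graded_mapsP=> i u; rewrite !sum_lfunE linear_sum /=; apply: eq_bigr => j _.
rewrite x_out; case: (eqVneq i j) => [->|ij]; first by rewrite xE idem_idem -xE.
by rewrite xE idem_app eq_sym (negPf ij) !linear0.
Qed.

Definition coboundary (f : 'Hom(M, N)) : {ffun arr Q -> 'Hom(M, N)} :=
  [ffun a => ((arrow N a \o f) - (f \o arrow M a))%VF].

Lemma coboundaryE f a u : coboundary f a u = arrow N a (f u) - f (arrow M a u).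
Proof. by rewrite ffunE add_lfunE opp_lfunE !comp_lfunE. Qed.

Lemma coboundary_linear : linear coboundary.
Proof.
move=> c f g; apply/ffunP=> a; apply/lfunP=> u; rewrite coboundaryE !ffunE.
rewrite !(add_lfunE, opp_lfunE, scale_lfunE, comp_lfunE) linearP /= scalerBr opprD.
by rewrite addrACA.
Qed.

Definition arrow_maps : {vspace {ffun arr Q -> 'Hom(M, N)}} :=
  block_families (@src Q) (@tgt Q) M N.

Definition coboundaries : {vspace {ffun arr Q -> 'Hom(M, N)}} :=
  (linfun coboundary @: graded_maps)%VS.

Lemma coboundariesP x :
  reflect (exists2 f, f \in graded_maps & coboundary f = x) (x \in coboundaries).
Proof.
apply: (iffP memv_imgP) => -[f fG]; [move=> -> | move=> <-]; exists f; rewrite ?linfunE //;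
exact: coboundary_linear.
Qed.

Lemma coboundaries_sub : (coboundaries <= arrow_maps)%VS.
Proof.
apply/subvP=> _ /coboundariesP[f /graded_mapsP fE <-]; apply/block_familiesP=> a u.
by rewrite !coboundaryE linearB /= arrow_tgt arrow_src -fE arrow_tgt fE arrow_src.
Qed.

Lemma homs_graded : homs M N = (graded_maps :&: lker (linfun coboundary))%VS.
Proof.
apply/vspaceP=> f; rewrite mem_homs memv_cap memv_ker (linfunE coboundary_linear).
apply/is_homP/andP => [[idemC arrowC]|[/graded_mapsP idemC /eqP/ffunP cobd0]].
  split; first exact/graded_mapsP.
  by apply/eqP/ffunP=> a; apply/lfunP=> u; rewrite coboundaryE !ffunE zero_lfunE arrowC subrr.
split=> // a u; apply/eqP; rewrite eq_sym -subr_eq0 -coboundaryE cobd0 ffunE zero_lfunE.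
exact: eqxx.
Qed.

Lemma dimhom_coboundaries : (dimhom M N + \dim coboundaries)%N = \dim graded_maps.
Proof. by rewrite /dimhom homs_graded limg_ker_dim. Qed.

Definition coarrow_maps : {vspace {ffun arr Q -> 'Hom(N, M)}} :=
  block_families (@tgt Q) (@src Q) N M.

Definition dual_cocycle (h : {ffun arr Q -> 'Hom(N, M)}) :=
  h \in coarrow_maps /\ forall u, \sum_a h a (arrow N a u) = \sum_a arrow M a (h a u).

Definition dual_cocycles : {vspace {ffun arr Q -> 'Hom(N, M)}} := vspace_of dual_cocycle.

Lemma dual_cocyclesP h : reflect (dual_cocycle h) (h \in dual_cocycles).
Proof.
apply: vspace_ofP; split=> [|c x y [xC xE] [yC yE]].
  by split=> [|u]; rewrite ?mem0v // !big1 // => a _; rewrite ffunE zero_lfunE ?linear0.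
split=> [|u]; first by rewrite memvD ?memvZ.
transitivity (c *: (\sum_a x a (arrow N a u)) + \sum_a y a (arrow N a u)).
  rewrite scaler_sumr -big_split; apply: eq_bigr => a _.
  by rewrite !ffunE add_lfunE scale_lfunE.
rewrite xE yE scaler_sumr -big_split; apply: eq_bigr => a _.
by rewrite !ffunE add_lfunE scale_lfunE linearP.
Qed.

Definition arrow_pairing (x : {ffun arr Q -> 'Hom(M, N)}) (h : {ffun arr Q -> 'Hom(N, M)}) : k :=
  \sum_a lftrace (x a) (h a).

Lemma arrow_pairing_linearl h : linear (fun x => arrow_pairing x h : k^o).
Proof.
move=> c x y; rewrite /arrow_pairing scaler_sumr -big_split; apply: eq_bigr => a _.
by rewrite !ffunE lftrace_linearl.
Qed.

Lemma arrow_pairing_linearr x : linear (arrow_pairing x : _ -> k^o).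
Proof.
move=> c h h'; rewrite /arrow_pairing scaler_sumr -big_split; apply: eq_bigr => a _.
by rewrite !ffunE lftrace_linearr.
Qed.

Lemma arrow_pairing_nondeg h : h \in coarrow_maps ->
  (forall x, x \in arrow_maps -> arrow_pairing x h = 0) -> h = 0.
Proof.
move/block_familiesP=> hE pairing0; apply/ffunP=> a; rewrite ffunE.
apply: (@lftrace_nondeg_in k M N (idem M (src a)) (idem N (tgt a))) => //; try exact: idem_idem.
move=> f fE; pose x : {ffun arr Q -> 'Hom(M, N)} := [ffun b => if b == a then f else 0].
have := pairing0 x; rewrite /arrow_pairing (bigD1 a) //= big1 => [|b ba].
  rewrite addr0 ffunE eqxx; apply; apply/block_familiesP=> b u; rewrite ffunE.
  by case: eqP => [->|_]; rewrite ?zero_lfunE ?linear0.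
by rewrite ffunE (negPf ba) lftrace0l.
Qed.

Definition codifferential (h : {ffun arr Q -> 'Hom(N, M)}) : 'Hom(N, M) :=
  \sum_a ((h a \o arrow N a) - (arrow M a \o h a))%VF.

Lemma codifferentialE h u :
  codifferential h u = \sum_a h a (arrow N a u) - \sum_a arrow M a (h a u).
Proof.
by rewrite sum_lfunE -sumrB; apply: eq_bigr => a _; rewrite add_lfunE opp_lfunE !comp_lfunE.
Qed.

Lemma arrow_pairing_coboundary f h :
  arrow_pairing (coboundary f) h = lftrace f (codifferential h).
Proof.
rewrite /codifferential linear_sum; apply: eq_bigr => a _.
by rewrite ffunE lftraceBl linearB /= lftrace_compl lftrace_compr.
Qed.

End Complex.

Lemma codifferential_graded M N h : h \in coarrow_maps M N ->
  codifferential h \in graded_maps N M.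
Proof.
move=> /block_familiesP hE; apply/graded_mapsP=> i u.
rewrite !codifferentialE linearB /=; congr (_ - _); rewrite linear_sum; apply: eq_bigr => a _ /=.
  rewrite arrow_idem [in RHS]hE idem_app [src a == i]eq_sym.
  by case: eqP => [->|_]; rewrite ?linear0 // -hE.
rewrite idem_arrow [in LHS]hE idem_app [tgt a == i]eq_sym.
by case: eqP => _; rewrite ?linear0 // -hE.
Qed.

Lemma graded_trace_nondeg (M N : kQmodule k Q) (g : 'Hom(N, M)) : g \in graded_maps N M ->
  (forall f, f \in graded_maps M N -> lftrace f g = 0) -> g = 0.
Proof.
move=> /graded_mapsP gE trace0; apply: lftrace_nondeg => f.
have <- : lftrace (\sum_i (idem N i \o (f \o idem M i)))%VF g = lftrace f g.
  rewrite lftrace_suml; under eq_bigr do rewrite lftrace_compl lftrace_compr.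
  rewrite -linear_sum; congr (lftrace f _); apply/lfunP=> u.
  rewrite sum_lfunE -[RHS]idem_sum_app; apply: eq_bigr => i _.
  by rewrite !comp_lfunE gE idem_idem.
apply: trace0; apply/graded_mapsP=> i u; rewrite !sum_lfunE linear_sum /=.
apply: eq_bigr => j _; rewrite !comp_lfunE !idem_app [j == i]eq_sym.
by case: eqP => [->|_]; rewrite ?linear0.
Qed.

Lemma dim_dual_cocycles M N :
  (\dim (dual_cocycles M N) + \dim (coboundaries M N))%N = \dim (arrow_maps M N).
Proof.
apply: (dim_orthogonal (@arrow_pairing_linearl M N) (@arrow_pairing_linearr M N)
  (B := coarrow_maps M N)) => [h||| h]; [exact: arrow_pairing_nondeg | | exact: coboundaries_sub |].
  by rewrite !dim_block_families; apply: eq_bigr => a _; rewrite mulnC.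
have codiff0P : codifferential h = 0 <-> forall u,
  \sum_a h a (arrow N a u) = \sum_a arrow M a (h a u).
  split=> [diff0 u|hE]; last by apply/lfunP=> u; rewrite codifferentialE hE subrr zero_lfunE.
  by apply/eqP; rewrite -subr_eq0 -codifferentialE diff0 zero_lfunE.
split=> [/dual_cocyclesP[hC /codiff0P diff0]|[hC pairing0]].
  split=> // _ /coboundariesP[f _ <-].
  by rewrite arrow_pairing_coboundary diff0; apply: linear0.
apply/dual_cocyclesP; split=> //; apply/codiff0P.
apply: graded_trace_nondeg => [|f fG]; first exact: codifferential_graded.
by rewrite -arrow_pairing_coboundary; apply: pairing0; apply/coboundariesP; exists f.
Qed.

End Cochains.

Section TranslateHom.
Variables (k : fieldType) (Q : quiver).
Hypothesis acyclicQ : acyclic Q.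
Variables M N : kQmodule k Q.
Local Notation W := {ffun qpath Q -> {ffun arr Q -> M}}.
Local Notation trivial_path := (trivial_path acyclicQ).

Definition tau_of_cocycle (h : {ffun arr Q -> 'Hom(N, M)}) (n : N) : W :=
  [ffun p => [ffun a => h a (path_action (pstart p) (parrows p) n)]].

Lemma tau_of_cocycle_in h n : dual_cocycle h -> tau_of_cocycle h n \in tau_space M.
Proof.
case=> /block_familiesP hE cocycle; apply/tau_spaceP; split=> [p a|q].
  rewrite !ffunE -[path_action _ _ _]path_action_end -/(pend p).
  rewrite [LHS]hE idem_app; case: (eqVneq (pend p) (tgt a)) => [->//|_].
  by rewrite !linear0.
transitivity (\sum_a h a (arrow N a (path_action (pstart q) (parrows q) n))); last first.
  by rewrite cocycle; apply: eq_bigr => a _; rewrite !ffunE.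
apply: eq_bigr => a _.
case: (boolP (is_qpath (pstart q) (rcons (parrows q) a))) => [path_qa|no_path].
  have [p [ps pa]] := exists_qpath acyclicQ path_qa.
  by rewrite (pval_path _ ps pa) !ffunE ps pa path_action_rcons.
rewrite pval0 ?(negPf no_path) // ffunE -[path_action _ _ _]path_action_end arrow_idem.
by move: no_path; rewrite is_qpath_rcons qpathP /= => /negPf->; rewrite linear0.
Qed.

Definition tau_hom_of_cocycle (h : {ffun arr Q -> 'Hom(N, M)}) : 'Hom(N, tau M) :=
  linfun (fun n => vsproj (tau_space M) (tau_of_cocycle h n)).

Lemma tau_hom_of_cocycleE h n : dual_cocycle h ->
  vsval (tau_hom_of_cocycle h n) = tau_of_cocycle h n.
Proof.
move=> cocycle; rewrite linfunE ?vsprojK ?tau_of_cocycle_in // => c u v.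
rewrite -linearP; congr (vsproj _ _); apply/ffunP=> p; apply/ffunP=> a.
by rewrite !ffunE path_action_linear linearP.
Qed.

Lemma idem_tau i (x : tau M) p a :
  vsval (idem (tau M) i x) p a = if pstart p == i then vsval x p a else 0.
Proof.
rewrite [idem _ _ _]res_lfunE vsprojK.
  by rewrite lfunE /= ffunE; case: eqP => // _; rewrite ffunE.
exact: submod_idem (tau_submod M) (subvsP x).
Qed.

Lemma arrow_tau b (x : tau M) p a :
  vsval (arrow (tau M) b x) p a =
  if pstart p == tgt b then pval (vsval x) (src b) (b :: parrows p) a else 0.
Proof.
rewrite [arrow _ _ _]res_lfunE vsprojK.
  by rewrite lfunE /= ffunE; case: eqP => // _; rewrite ffunE.
exact: submod_arrow (tau_submod M) (subvsP x).
Qed.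

Lemma tau_hom_of_cocycle_hom h : dual_cocycle h -> is_hom (tau_hom_of_cocycle h).
Proof.
move=> cocycle; apply/is_homP; split=> [i n|b n]; apply: subvs_inj; apply/ffunP=> p;
  apply/ffunP=> a.
  rewrite idem_tau !tau_hom_of_cocycleE // !ffunE path_action_idem.
  by case: eqP => // _; rewrite linear0.
rewrite arrow_tau !tau_hom_of_cocycleE // !ffunE; case: eqP => [pb|/eqP/negPf pb]; last first.
  by rewrite -arrow_tgt path_action_idem pb linear0.
have path_bp : is_qpath (src b) (b :: parrows p) by rewrite /= eqxx -pb qpathP.
have [q [qs qa]] := exists_qpath acyclicQ path_bp.
by rewrite (pval_path _ qs qa) !ffunE qs qa pb path_action_cons.
Qed.

Definition cocycle_of_tau_hom (g : 'Hom(N, tau M)) : {ffun arr Q -> 'Hom(N, M)} :=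
  [ffun a => linfun (fun n => vsval (g n) (trivial_path (tgt a)) a)].

Lemma cocycle_of_tau_homE g a n :
  cocycle_of_tau_hom g a n = vsval (g n) (trivial_path (tgt a)) a.
Proof. by rewrite ffunE linfunE // => c u v; rewrite linearP /= !ffunE. Qed.

Lemma tau_hom_path (g : 'Hom(N, tau M)) n p a : is_hom g ->
  vsval (g n) p a = cocycle_of_tau_hom g a (path_action (pstart p) (parrows p) n).
Proof.
move=> hg; rewrite cocycle_of_tau_homE.
suff drop_path s i (q r : qpath Q) m : parrows q = s -> pstart q = i -> parrows r = [::] ->
    pstart r = pend q -> vsval (g m) q = vsval (g (path_action i s m)) r.
  case: (eqVneq (pend p) (tgt a)) => [pa|/negPf pa].
    rewrite (drop_path (parrows p) (pstart p) p (trivial_path (tgt a))) //.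
      exact: trivial_path_arrows.
    by rewrite trivial_path_start.
  have /tau_spaceP[supp _] := subvsP (g n); rewrite supp pa.
  by rewrite -[path_action _ _ _]path_action_end (hom_idemE hg) idem_tau trivial_path_start eq_sym
    pa.
elim: s i q m => [|b s IH] i q m qs qi rs rq; apply/ffunP=> c.
  have <- : q = r by apply: qpath_inj; rewrite ?qs ?rs // rq /pend qs.
  by rewrite -[path_action i [::] m]/(idem N i m) (hom_idemE hg) idem_tau qi eqxx.
have := qpathP q; rewrite qi qs /= => /andP[/eqP bi path_s].
have [q' [q's q'a]] := exists_qpath acyclicQ path_s.
have := IH (tgt b) q' (arrow N b m) q'a q's rs; rewrite -path_action_cons bi => <-; last first.
  by rewrite rq /pend q's q'a qs qi.
by rewrite (hom_arrowE hg) arrow_tau q's eqxx q'a bi (pval_path _ qi qs).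
Qed.

Lemma cocycle_of_tau_hom_coarrow (g : 'Hom(N, tau M)) : is_hom g ->
  cocycle_of_tau_hom g \in coarrow_maps M N.
Proof.
move=> hg; apply/block_familiesP=> a n.
rewrite !cocycle_of_tau_homE (hom_idemE hg) idem_tau trivial_path_start eqxx.
by have /tau_spaceP[supp _] := subvsP (g n); rewrite [LHS]supp trivial_path_end eqxx.
Qed.

Lemma cocycle_of_tau_hom_cocycle (g : 'Hom(N, tau M)) : is_hom g ->
  dual_cocycle (cocycle_of_tau_hom g).
Proof.
move=> hg; split=> [|n]; first exact: cocycle_of_tau_hom_coarrow.
rewrite -(idem_sum_app n); under eq_bigr do rewrite !linear_sum.
under [RHS]eq_bigr do rewrite !linear_sum.
rewrite exchange_big [RHS]exchange_big; apply: eq_bigr => i _ /=.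
have /tau_spaceP[_ /(_ (trivial_path i))] := subvsP (g (idem N i n)).
rewrite trivial_path_start trivial_path_arrows => rel_i.
transitivity (\sum_a pval (vsval (g (idem N i n))) i [:: a] a).
  apply: eq_bigr => a _; rewrite arrow_idem eq_sym; case: (eqVneq i (src a)) => [ia|ia].
    have path_a : is_qpath i [:: a] by rewrite /= ia eqxx.
    have [p [ps pa]] := exists_qpath acyclicQ path_a.
    rewrite (pval_path _ ps pa) tau_hom_path // ps pa ia.
    by rewrite /path_action /= idem_idem arrow_src.
  by rewrite linear0 pval0 ?ffunE //= eq_sym (negPf ia).
rewrite rel_i; apply: eq_bigr => a _.
by rewrite tau_hom_path // trivial_path_start trivial_path_arrows /path_action /= idem_idem.
Qed.

Lemma dimhom_tau : dimhom N (tau M) = \dim (dual_cocycles M N).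
Proof.
apply: (@dimv_linear_bij _ _ _ cocycle_of_tau_hom).
- move=> c g h; apply/ffunP=> a; apply/lfunP=> n.
  rewrite cocycle_of_tau_homE !ffunE !add_lfunE !scale_lfunE linearP /= !ffunE.
  by rewrite -!cocycle_of_tau_homE !ffunE.
- move=> g; rewrite mem_homs => hg g0; apply/lfunP=> n; apply: subvs_inj.
  by apply/ffunP=> p; apply/ffunP=> a; rewrite tau_hom_path // g0 !(ffunE, zero_lfunE).
move=> h; split=> [/dual_cocyclesP cocycle|[g]]; last first.
  by rewrite mem_homs => hg <-; apply/dual_cocyclesP/cocycle_of_tau_hom_cocycle.
exists (tau_hom_of_cocycle h); first by rewrite mem_homs tau_hom_of_cocycle_hom.
apply/ffunP=> a; apply/lfunP=> n; rewrite cocycle_of_tau_homE tau_hom_of_cocycleE // !ffunE.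
have /block_familiesP hE := cocycle.1.
by rewrite trivial_path_start trivial_path_arrows /path_action /= hE [RHS]hE idem_idem.
Qed.

Theorem euler_formula :
  (dimhom M N)%:Z - (dimhom N (tau M))%:Z = euler (dimvec M) (dimvec N).
Proof.
have := dimhom_coboundaries M N; have := dim_dual_cocycles M N.
rewrite dimhom_tau dim_graded_maps dim_block_families /euler.
rewrite (_ : \sum_i _ = (\sum_i vertex_dim M i * vertex_dim N i)%N%:Z); last first.
  by rewrite raddf_sum; apply: eq_bigr => i _; rewrite !dimvecE.
rewrite (_ : \sum_a _ = (\sum_a vertex_dim M (src a) * vertex_dim N (tgt a))%N%:Z); last first.
  by rewrite raddf_sum; apply: eq_bigr => i _; rewrite !dimvecE.
lia.
Qed.

Lemma coboundaries_ext0 : dimhom N (tau M) = 0%N -> coboundaries M N = arrow_maps M N.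
Proof.
move=> ext0; apply/eqP; rewrite eqEdim coboundaries_sub -(dim_dual_cocycles M N).
by rewrite -dimhom_tau ext0 leqnn.
Qed.

End TranslateHom.

Section Extensions.
Variables (k : fieldType) (Q : quiver).
Hypothesis acyclicQ : acyclic Q.
Implicit Types E L M N X Y Z : kQmodule k Q.

Lemma graded_lift M E Z (p : 'Hom(E, Z)) (f : 'Hom(M, Z)) : is_epi p -> is_hom f ->
  exists2 s, s \in graded_maps M E & forall u, p (s u) = f u.
Proof.
move=> ep hf; have pV z : p (p^-1%VF z) = z by rewrite limg_lfunVK // epi_limg ?memvf.
pose s : 'Hom(M, E) := (\sum_j (idem E j \o p^-1 \o f \o idem M j))%VF.
have sE u : s u = \sum_j idem E j (p^-1%VF (f (idem M j u))).
  by rewrite sum_lfunE; apply: eq_bigr => j _; rewrite !comp_lfunE.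
exists s => [|u]; last first.
  rewrite sE linear_sum -{2}(idem_sum_app u) linear_sum; apply: eq_bigr => j _ /=.
  by rewrite (hom_idemE (epi_hom ep)) pV -(hom_idemE hf) idem_idem.
apply/graded_mapsP=> j u; rewrite !sE linear_sum; apply: eq_bigr => l _ /=.
by rewrite !idem_app eq_sym; case: (eqVneq j l) => [->//|_]; rewrite !linear0.
Qed.

Lemma lift_ext0 M N E Z (i : 'Hom(N, E)) (p : 'Hom(E, Z)) (f : 'Hom(M, Z)) :
  dimhom N (tau M) = 0%N -> is_ses i p -> is_hom f ->
  exists2 s : 'Hom(M, E), is_hom s & forall u, p (s u) = f u.
Proof.
move=> ext0 ip hf; have [mi ep imi] := ip; have [s /graded_mapsP idem_s ps] := graded_lift ep hf.
pose x : {ffun arr Q -> 'Hom(M, N)} :=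
  [ffun a => (i^-1 \o ((arrow E a \o s) - (s \o arrow M a)))%VF].
have xE a u : i (x a u) = arrow E a (s u) - s (arrow M a u).
  rewrite ffunE comp_lfunE limg_lfunVK add_lfunE opp_lfunE !comp_lfunE //.
  by rewrite imi memv_ker linearB /= (hom_arrowE (epi_hom ep)) !ps (hom_arrowE hf) subrr.
have : x \in arrow_maps M N.
  apply/block_familiesP=> a u; apply: (mono_inj mi); rewrite (hom_idemE (mono_hom mi)) !xE.
  by rewrite linearB /= idem_s !arrow_src -idem_s !arrow_tgt.
rewrite -(coboundaries_ext0 acyclicQ ext0) => /coboundariesP[y /graded_mapsP idem_y yx].
exists (s - (i \o y))%VF => [|u]; last first.
  by rewrite add_lfunE opp_lfunE comp_lfunE linearB /= ps (ses_comp0 _ ip) subr0.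
apply/is_homP; split=> [j u|a u]; rewrite !(add_lfunE, opp_lfunE, comp_lfunE) linearB /=.
  by rewrite idem_s idem_y (hom_idemE (mono_hom mi)).
have := xE a u; rewrite -yx coboundaryE linearB /= (hom_arrowE (mono_hom mi)) => cobd.
rewrite -[s (arrow M a u)](subKr (arrow E a (s u))) -cobd opprB.
by rewrite [i _ - _]addrC addrA addrK.
Qed.

Lemma ses_split_ext0 X Y Z (f : 'Hom(X, Y)) (g : 'Hom(Y, Z)) : dimhom X (tau Z) = 0%N ->
  is_ses f g -> isom (dsum X Z) Y.
Proof.
move=> ext0 fg; have [s hs sE] := lift_ext0 ext0 fg (is_hom_id Z).
by apply: (ses_split fg hs) => z; rewrite sE id_lfunE.
Qed.

Section ExtensionModule.
Variables (M N : kQmodule k Q) (x : {ffun arr Q -> 'Hom(M, N)}).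
Hypothesis xA : x \in arrow_maps M N.
Local Notation T := (dsum N M).

Definition extension_arrow_fun a (u : T) : T := (arrow N a u.1 + x a u.2, arrow M a u.2).

Fact extension_arrow_linear a : linear (extension_arrow_fun a).
Proof.
move=> c u v; rewrite /extension_arrow_fun /= !linearP /= dsum_pairZ dsum_pairD.
by rewrite scalerDr addrACA.
Qed.

Definition extension_arrow a : 'End(T) := linfun (extension_arrow_fun a).

Lemma extension_arrowE a u : extension_arrow a u = extension_arrow_fun a u.
Proof. exact: linfunE (extension_arrow_linear a) u. Qed.

Fact extension_arrow_ax a :
  extension_arrow a = (idem T (tgt a) \o extension_arrow a \o idem T (src a))%VF.
Proof.
apply/lfunP=> u; rewrite !comp_lfunE !extension_arrowE !idem_dsum /extension_arrow_fun /=.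
by have /block_familiesP xE := xA; rewrite linearD /= -xE !arrow_src !arrow_tgt.
Qed.

Definition extension : kQmodule k Q :=
  @KQModule k Q T (idem T) extension_arrow (@idemM k Q T) (@idem_sum k Q T) extension_arrow_ax.

Lemma arrow_extension a (u : extension) :
  arrow extension a u = (arrow N a u.1 + x a u.2, arrow M a u.2).
Proof. exact: extension_arrowE. Qed.

Definition extension_in : 'Hom(N, extension) := dsum_inl N M.
Definition extension_out : 'Hom(extension, M) := dsum_snd N M.

Lemma extension_ses : is_ses extension_in extension_out.
Proof.
have [/andP[hin in0] /andP[hout out1] exact_mid] := dsum_ses N M.
split=> //; apply/andP; split=> //; apply/is_homP; split=> [j u|a u].
- exact: hom_idemE hin j u.
- by rewrite arrow_extension /extension_in !dsum_inlE /= !linear0 addr0.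
- exact: hom_idemE hout j u.
by rewrite [X in extension_out X]arrow_extension /extension_out !dsum_sndE.
Qed.

Lemma extension_retract_coboundary (r : 'Hom(extension, N)) :
  is_hom r -> cancel extension_in r -> x \in coboundaries M N.
Proof.
move=> hr rE; pose t : 'Hom(M, N) := (r \o dsum_inr N M)%VF.
have tE m : t m = r (0, m) by rewrite comp_lfunE dsum_inrE.
apply/coboundariesP; exists t.
  apply/graded_mapsP=> j m; rewrite !tE -(hom_idemE hr); congr (r _).
  by rewrite [RHS](@idem_dsum k Q N M) /= linear0.
apply/ffunP=> a; apply/lfunP=> m; rewrite coboundaryE !tE -(hom_arrowE hr).
rewrite arrow_extension /= linear0 add0r.
have -> : (x a m, arrow M a m) = extension_in (x a m) + (0, arrow M a m) :> extension.
  by rewrite [extension_in _]dsum_inlE [RHS]dsum_pairD addr0 add0r.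
by rewrite linearD /= rE addrK.
Qed.

End ExtensionModule.

Lemma exists_nonsplit_ses M N : (0 < dimhom N (tau M))%N ->
  exists E (f : 'Hom(N, E)) (g : 'Hom(E, M)),
    is_ses f g /\ forall r : 'Hom(E, N), is_hom r -> ~ cancel f r.
Proof.
move=> ext_gt0; have : ~~ (arrow_maps M N <= coboundaries M N)%VS.
  apply: contraL ext_gt0 => /dimvS; rewrite -(dim_dual_cocycles M N) -(dimhom_tau acyclicQ); lia.
case/subvPn=> x xA xB; exists (extension xA), (extension_in xA), (extension_out xA); split.
  exact: extension_ses.
by move=> r hr rE; case/negP: xB; apply: extension_retract_coboundary hr rE.
Qed.

End Extensions.

(** * Modules killed by a power of the translate *)

Section TranslateFunctor.
Variables (k : fieldType) (Q : quiver).
Implicit Types M N X Y Z : kQmodule k Q.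

Definition pointwise M N (f : 'Hom(M, N)) (x : {ffun qpath Q -> {ffun arr Q -> M}}) :
  {ffun qpath Q -> {ffun arr Q -> N}} := [ffun p => [ffun a => f (x p a)]].

Lemma pointwise_linear M N (f : 'Hom(M, N)) : linear (pointwise f).
Proof. by move=> c x y; apply/ffunP=> p; apply/ffunP=> a; rewrite !ffunE linearP. Qed.

Lemma pval_pointwise M N (f : 'Hom(M, N)) x i s a :
  pval (pointwise f x) i s a = f (pval x i s a).
Proof.
by rewrite !pval_coord linear_sum; apply: eq_bigr => p _; rewrite !ffunE.
Qed.

Lemma pointwise_tau_space M N (f : 'Hom(M, N)) x : is_hom f ->
  x \in tau_space M -> pointwise f x \in tau_space N.
Proof.
move=> hf /tau_spaceP[supp rel]; apply/tau_spaceP; split=> [p a|q].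
  rewrite !ffunE supp; case: eqP => // _; last by rewrite linear0.
  by rewrite (hom_idemE hf) idem_idem.
under eq_bigr do rewrite pval_pointwise.
rewrite -linear_sum rel linear_sum; apply: eq_bigr => a _ /=.
by rewrite !ffunE (hom_arrowE hf).
Qed.

Definition tau_map M N (f : 'Hom(M, N)) : 'Hom(tau M, tau N) :=
  linfun (fun x : tau M => vsproj (tau_space N) (pointwise f (vsval x))).

Lemma tau_mapE M N (f : 'Hom(M, N)) x : is_hom f ->
  vsval (tau_map f x) = pointwise f (vsval x).
Proof.
move=> hf; rewrite linfunE ?vsprojK //; first exact: pointwise_tau_space (subvsP x).
by move=> c u v; rewrite linearP pointwise_linear linearP.
Qed.

Lemma tau_map_hom M N (f : 'Hom(M, N)) : is_hom f -> is_hom (tau_map f).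
Proof.
move=> hf; apply/is_homP; split=> [i x|b x]; apply: subvs_inj; apply/ffunP=> p;
  apply/ffunP=> a.
  rewrite tau_mapE // !ffunE !idem_tau tau_mapE // !ffunE.
  by case: eqP => // _; rewrite linear0.
rewrite tau_mapE // !ffunE !arrow_tau tau_mapE // pval_pointwise.
by case: eqP => // _; rewrite linear0.
Qed.

Lemma tau_map_mono M N (f : 'Hom(M, N)) : is_mono f -> is_mono (tau_map f).
Proof.
move=> mf; have hf := mono_hom mf; apply/is_monoP; split=> [|x]; first exact: tau_map_hom.
move/(congr1 vsval); rewrite tau_mapE // linear0 => fx0.
apply: subvs_inj; rewrite linear0; apply/ffunP=> p; apply/ffunP=> a.
apply: (mono_inj mf); move/ffunP/(_ p)/ffunP/(_ a): fx0.
by rewrite !ffunE linear0.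
Qed.

Lemma tau_map_left_exact X Y Z (f : 'Hom(X, Y)) (g : 'Hom(Y, Z)) :
  is_mono f -> is_hom g -> limg f = lker g -> (lker (tau_map g) <= limg (tau_map f))%VS.
Proof.
move=> mf hg fg; have hf := mono_hom mf; apply/subvP=> y.
rewrite memv_ker => /eqP/(congr1 vsval); rewrite (tau_mapE _ hg) linear0 => gy0.
have pointwise_preimage p a : exists x : X, f x == vsval y p a.
  have : vsval y p a \in limg f.
    by rewrite fg memv_ker; move/ffunP/(_ p)/ffunP/(_ a): gy0; rewrite !ffunE => ->.
  by case/memv_imgP=> x _ ->; exists x.
pose z : {ffun qpath Q -> {ffun arr Q -> X}} :=
  [ffun p => [ffun a => xchoose (pointwise_preimage p a)]].
have fz : pointwise f z = vsval y.
  apply/ffunP=> p; apply/ffunP=> a; rewrite !ffunE.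
  exact/eqP/(xchooseP (pointwise_preimage p a)).
have fzE p a : f (z p a) = vsval y p a by rewrite -fz !ffunE.
have /tau_spaceP[supp rel] := subvsP y.
have z_tau : z \in tau_space X.
  apply/tau_spaceP; split=> [p a|q]; apply: (mono_inj mf).
    rewrite fzE supp; case: eqP => _; last by rewrite linear0.
    by rewrite (hom_idemE hf) fzE.
  have := rel q; rewrite -fz; under eq_bigr do rewrite pval_pointwise.
  rewrite -linear_sum /= => ->; rewrite linear_sum; apply: eq_bigr => a _ /=.
  by rewrite (hom_arrowE hf) fz fzE.
apply/memv_imgP; exists (vsproj (tau_space X) z); first exact: memvf.
by apply: subvs_inj; rewrite tau_mapE // vsprojK.
Qed.

End TranslateFunctor.


Section TorsionPair.
Variables (k : fieldType) (Q : quiver).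
Implicit Types A B L M N X Y Z : kQmodule k Q.

(* The tau-nilpotent modules are the direct sums of indecomposable            *)
(* preprojective modules; the torsion modules are those without such summand. *)
Definition tau_nilpotent M := exists n, is_zero (iter n (@tau k Q) M).
Definition torsion M := forall N, tau_nilpotent N -> dimhom M N = 0%N.

Lemma tau_nilpotent_zero M : is_zero M -> tau_nilpotent M.
Proof. by exists 0%N. Qed.

Lemma is_zero_tau M : is_zero M -> is_zero (tau M).
Proof.
move/is_zeroP=> M0; apply/is_zeroP=> x; apply: subvs_inj; apply/ffunP=> p; apply/ffunP=> a.
exact: etrans (M0 _) (esym (M0 _)).
Qed.

Lemma tau_nilpotent_tau M : tau_nilpotent (tau M) <-> tau_nilpotent M.
Proof.
split=> [[n zero_n]|[[|n] zero_n]]; first by exists n.+1; rewrite iterSr.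
  by exists 0%N; apply: is_zero_tau.
by exists n; rewrite -iterSr.
Qed.

Lemma iter_tau_mono n M N (f : 'Hom(M, N)) : is_mono f ->
  is_zero (iter n (@tau k Q) N) -> is_zero (iter n (@tau k Q) M).
Proof.
elim: n M N f => [|n IH] M N f mf; first exact: is_zero_mono mf.
by rewrite !iterSr; apply: IH (tau_map_mono mf).
Qed.

Lemma tau_nilpotent_mono M N (f : 'Hom(M, N)) : is_mono f -> tau_nilpotent N -> tau_nilpotent M.
Proof. by move=> mf [n zero_n]; exists n; apply: iter_tau_mono mf zero_n. Qed.

Lemma tau_nilpotent_submod M (X : {vspace M}) (sX : is_submod X) :
  tau_nilpotent M -> tau_nilpotent (submod sX).
Proof. exact: tau_nilpotent_mono (sub_incl_mono sX). Qed.

Lemma tau_nilpotent_isom M N : isom M N -> tau_nilpotent N -> tau_nilpotent M.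
Proof. by case/isom_epimono=> f mf _; apply: tau_nilpotent_mono mf. Qed.

Lemma tau_nilpotent_ses X Y Z (f : 'Hom(X, Y)) (g : 'Hom(Y, Z)) : is_ses f g ->
  tau_nilpotent X -> tau_nilpotent Z -> tau_nilpotent Y.
Proof.
suff left_exact_case n : forall X Y Z (f : 'Hom(X, Y)) (g : 'Hom(Y, Z)),
    is_mono f -> is_hom g -> limg f = lker g ->
    tau_nilpotent X -> is_zero (iter n (@tau k Q) Z) -> tau_nilpotent Y.
  by move=> [mf eg fg] nX [n zero_n]; apply: left_exact_case mf (epi_hom eg) fg nX zero_n.
elim: n => [|n IH] {}X {}Y {}Z {}f {}g mf hg fg nX.
  move/is_zeroP=> /= Z0; apply: tau_nilpotent_isom nX; apply/isom_sym/(isomI mf).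
  rewrite /is_epi (mono_hom mf) fg lker_full.
  by apply/eqP/lfunP=> u; rewrite (Z0 (g u)) zero_lfunE.
rewrite iterSr => zero_n; apply/tau_nilpotent_tau.
have sK := is_submod_ker (tau_map_hom hg).
apply: (IH (submod sK) (tau Y) (tau Z) (sub_incl sK) (tau_map g)) zero_n.
- exact: sub_incl_mono.
- exact: tau_map_hom.
- exact: limg_sub_incl.
have [|h hh hE] := mono_factor (tau_map_mono mf) (sub_incl_hom sK).
  by rewrite limg_sub_incl; apply: tau_map_left_exact.
apply: tau_nilpotent_mono ((tau_nilpotent_tau X).2 nX); apply/is_monoP; split=> [|u hu0].
  exact: hh.
by apply: (mono_eq0 (sub_incl_mono sK)); rewrite -hE hu0 linear0.
Qed.

Lemma torsion_epi M N (f : 'Hom(M, N)) : is_epi f -> torsion M -> torsion N.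
Proof.
by move=> ef tM L nL; apply/eqP; rewrite -leqn0 -(tM L nL); apply: dimhom_epi ef.
Qed.

Lemma torsion_ses X Y Z (f : 'Hom(X, Y)) (g : 'Hom(Y, Z)) : is_ses f g ->
  torsion X -> torsion Z -> torsion Y.
Proof.
move=> fg tX tZ L nL; apply/eqP; rewrite -leqn0.
by apply: leq_trans (dimhom_sesl L fg) _; rewrite tX // tZ.
Qed.

Lemma torsion_isom M N : isom M N -> torsion M -> torsion N.
Proof. by case/isom_epimono=> f _ ef; apply: torsion_epi ef. Qed.

Lemma dimhom_tau_torsion M N : tau_nilpotent M -> torsion N -> dimhom N (tau M) = 0%N.
Proof. by move=> nM; apply; apply/tau_nilpotent_tau. Qed.

(* M/K is an extension of M/X by a submodule of N. *)
Lemma tau_nilpotent_quo_ker M N (X : {vspace M}) (sX : is_submod X) (h : 'Hom(submod sX, N))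
    (sK : is_submod (sub_incl sX @: lker h)%VS) :
  is_hom h -> tau_nilpotent (quomod sX) -> tau_nilpotent N -> tau_nilpotent (quomod sK).
Proof.
set K := (_ @: _)%VS in sK * => hh nMX nN.
have KX : (K <= X)%VS by rewrite -[X in (_ <= X)%VS](limg_sub_incl sX) limgS ?subvf.
have [|q hq qE] := quo_factor sK (quo_proj_hom sX); first by rewrite lker_quo_proj.
have eq : is_epi q.
  apply/is_epiP; split=> // w; have [v <-] := epi_onto (quo_proj_epi sX) w.
  by exists (quo_proj K v); rewrite qE.
pose r : 'Hom(submod sX, quomod sK) := ((quo_proj K : 'Hom(M, quomod sK)) \o sub_incl sX)%VF.
have hr : is_hom r := is_hom_comp (sub_incl_hom sX) (quo_proj_hom sK).
have sI := is_submod_limg hr; have [t et tE] := img_factor sI hr.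
have rE u : r u = quo_proj K (vsval u) by rewrite comp_lfunE sub_inclE.
have limg_r : limg r = lker q.
  apply/vspaceP=> w; rewrite memv_ker; apply/memv_imgP/eqP => [[u _ ->]|].
    by rewrite rE qE; apply/eqP; rewrite quo_proj0 subvsP.
  have [v <-] := epi_onto (quo_proj_epi sK) w; rewrite qE => /eqP; rewrite quo_proj0 => vX.
  by exists (vsproj X v); rewrite ?memvf // rE vsprojK.
have lker_t : lker t = lker h.
  apply/vspaceP=> u; rewrite memv_ker -(inj_eq (@subvs_inj _ _ _)) tE linear0 rE quo_proj0.
  apply/memv_imgP/idP => [[v vK]|uK]; last by exists u; rewrite ?sub_inclE.
  by rewrite sub_inclE => /subvs_inj->.
have [v mv _] := epi_factor_mono et hh lker_t.
apply: tau_nilpotent_ses (tau_nilpotent_mono mv nN) nMX; split;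
  [exact: (sub_incl_mono sI)|exact: eq|].
by rewrite limg_sub_incl.
Qed.

Lemma exists_torsion_sub M : exists (X : {vspace M}) (sX : is_submod X),
  torsion (submod sX) /\ tau_nilpotent (quomod sX).
Proof.
have [|X [sX nX] minX] := exists_minimizer (fun X : {vspace M} => \dim X)
    (P := fun X : {vspace M} => exists sX : is_submod X, tau_nilpotent (quomod sX)).
  by exists fullv, (is_submodf M); apply/tau_nilpotent_zero/is_zero_quomod.
exists X, sX; split=> // N nN; apply/dimhom_eq0P => h hh.
have sK := is_submod_img (sub_incl_hom sX) (is_submod_ker hh).
have : (\dim X <= \dim (sub_incl sX @: lker h))%N.
  by apply: minX; exists sK; apply: tau_nilpotent_quo_ker.
rewrite (limg_dim_lker0 _ (mono_lker0 (sub_incl_mono sX))) => dimX.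
by apply/eqP; rewrite -lker_full eqEdim subvf dim_submod.
Qed.

Hypothesis acyclicQ : acyclic Q.

Lemma torsion_decomposition M :
  exists A B, [/\ torsion A, tau_nilpotent B & isom (dsum A B) M].
Proof.
have [X [sX [tX nX]]] := exists_torsion_sub M.
exists (submod sX), (quomod sX); split=> //.
exact: (ses_split_ext0 acyclicQ (dimhom_tau_torsion nX tX) (sub_quo_ses sX)).
Qed.

Lemma indecomposable_torsion M : indecomposable M -> ~ tau_nilpotent M -> torsion M.
Proof.
move=> [_ indec] not_nil; have [A [B [tA nB iM]]] := torsion_decomposition M.
case: (indec A B (isom_sym iM)) => [A0|B0].
  case: not_nil; apply: tau_nilpotent_isom (isom_sym iM) _.
  exact: tau_nilpotent_isom (isom_dsum0l B A0) nB.
by apply: torsion_isom iM _; apply: torsion_isom (isom_sym (isom_dsum0r A B0)) tA.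
Qed.

End TorsionPair.

(** * Projective modules and the defect *)

Section Projectives.
Variables (k : fieldType) (Q : quiver).
Hypothesis acyclicQ : acyclic Q.
Implicit Types E L M N X Y Z : kQmodule k Q.

Section ProjectiveAtVertex.
Variable i : vtx Q.

Definition path_from := {p : qpath Q | pstart p == i}.
Local Notation F := {ffun path_from -> k^o}.
Definition from_arrows (p : path_from) := parrows (val p).
Definition from_end (p : path_from) := pend (val p).

Lemma from_start (p : path_from) : pstart (val p) = i.
Proof. exact/eqP/(valP p). Qed.

Lemma from_path (p : path_from) : is_qpath i (from_arrows p).
Proof. by rewrite -(from_start p); exact: qpathP. Qed.

Lemma from_inj (p q : path_from) : from_arrows p = from_arrows q -> p = q.
Proof. by move=> same_arrows; apply: val_inj; apply: qpath_inj => //; rewrite !from_start. Qed.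

Lemma from_endE (p : path_from) : from_end p = qend i (from_arrows p).
Proof. by rewrite /from_end /pend from_start. Qed.

Lemma exists_path_from s : is_qpath i s -> exists p : path_from, from_arrows p = s.
Proof.
move=> path_s; have [p [ps pa]] := exists_qpath acyclicQ path_s.
have start_p : pstart p == i by rewrite ps.
by exists (exist _ p start_p).
Qed.

Definition projective_idem_fun j (f : F) : F := [ffun p => if from_end p == j then f p else 0].
Definition projective_arrow_fun a (f : F) : F :=
  [ffun p => \sum_(q : path_from | rcons (from_arrows q) a == from_arrows p) f q].

Lemma projective_idem_linear j : linear (projective_idem_fun j).
Proof.
move=> c f g; apply/ffunP=> p; rewrite !ffunE; case: eqP => _ //.
by rewrite scaler0 addr0.
Qed.

Lemma projective_arrow_linear a : linear (projective_arrow_fun a).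
Proof.
move=> c f g; apply/ffunP=> p; rewrite !ffunE scaler_sumr -big_split.
by apply: eq_bigr => q _; rewrite !ffunE.
Qed.

Definition projective_idem j : 'End(F) := linfun (projective_idem_fun j).
Definition projective_arrow a : 'End(F) := linfun (projective_arrow_fun a).

Lemma projective_idemE j f p : projective_idem j f p = if from_end p == j then f p else 0.
Proof. by rewrite linfunE ?ffunE //; exact: projective_idem_linear. Qed.

Lemma projective_arrowE a f p :
  projective_arrow a f p = \sum_(q : path_from | rcons (from_arrows q) a == from_arrows p) f q.
Proof. by rewrite linfunE ?ffunE //; exact: projective_arrow_linear. Qed.

Lemma projective_idemM j l :
  (projective_idem j \o projective_idem l)%VF = if j == l then projective_idem j else 0.
Proof.
apply/lfunP=> f; apply/ffunP=> p; rewrite comp_lfunE !projective_idemE.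
case: (eqVneq j l) => [->|jl]; first by rewrite projective_idemE; case: eqP.
rewrite zero_lfunE ffunE; case: (eqVneq (from_end p) j) => // ->.
by rewrite (negPf jl).
Qed.

Lemma projective_idem_sum : \sum_j projective_idem j = \1%VF.
Proof.
apply/lfunP=> f; rewrite sum_lfunE id_lfunE; apply/ffunP=> p.
rewrite sum_ffunE (bigD1 (from_end p)) //= big1 => [|j jp].
  by rewrite addr0 projective_idemE eqxx.
by rewrite projective_idemE eq_sym (negPf jp).
Qed.

Fact projective_arrow_ax a :
  projective_arrow a =
    (projective_idem (tgt a) \o projective_arrow a \o projective_idem (src a))%VF.
Proof.
apply/lfunP=> f; apply/ffunP=> p; rewrite !comp_lfunE projective_idemE !projective_arrowE.
have ends q : rcons (from_arrows q) a == from_arrows p -> from_end p = tgt a /\ from_end q = src a.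
  move=> /eqP qa; rewrite !from_endE -qa /qend map_rcons last_rcons; split=> //.
  by have := from_path p; rewrite -qa is_qpath_rcons => /andP[_ /eqP].
case: eqP => [_|not_end]; last by rewrite big1 // => q /ends[/not_end].
by apply: eq_bigr => q /ends[_ q_end]; rewrite projective_idemE q_end eqxx.
Qed.

Definition projective : kQmodule k Q :=
  KQModule projective_idemM projective_idem_sum projective_arrow_ax.

Fact from_trivial_subproof : exists p : path_from, from_arrows p == [::].
Proof. by have [p pa] := @exists_path_from [::] isT; exists p; rewrite pa. Qed.

Definition from_trivial := xchoose from_trivial_subproof.

Lemma from_trivial_arrows : from_arrows from_trivial = [::].
Proof. exact/eqP/(xchooseP from_trivial_subproof). Qed.

Definition path_basis (p : path_from) : projective := [ffun q => if q == p then 1 else 0].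

Lemma path_basis_sum (f : projective) : f = \sum_p f p *: path_basis p.
Proof.
apply/ffunP=> q; rewrite sum_ffunE (bigD1 q) //= big1 ?addr0 => [|p pq].
  by rewrite !ffunE eqxx [_ *: _]mulr1.
by rewrite !ffunE eq_sym (negPf pq) scaler0.
Qed.

Lemma path_basis_arrow p q a : from_arrows p = rcons (from_arrows q) a ->
  arrow projective a (path_basis q) = path_basis p.
Proof.
move=> pqa; apply/ffunP=> r; rewrite [LHS]projective_arrowE ffunE.
case: (eqVneq r p) => [->|rp].
  rewrite (big_pred1 q) ?ffunE ?eqxx // => s /=; rewrite pqa eqseq_rcons eqxx andbT.
  by apply/eqP/eqP => [/from_inj|->].
apply: big1 => s /eqP sar; rewrite ffunE; case: eqP => // sq.
by case/eqP: rp; apply: from_inj; rewrite pqa -sar sq.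
Qed.

Lemma path_basis_trivial : idem projective i (path_basis from_trivial) = path_basis from_trivial.
Proof.
apply/ffunP=> q; rewrite [LHS]projective_idemE !ffunE.
case: eqP => // not_end; case: eqP => // q_trivial.
by case: not_end; rewrite q_trivial from_endE from_trivial_arrows.
Qed.

Lemma path_basis_action p : path_basis p = path_action i (from_arrows p) (path_basis from_trivial).
Proof.
move: {2}(from_arrows p) (erefl (from_arrows p)) => s.
elim/last_ind: s p => [|s a IH] p pa.
  rewrite pa -[RHS]/(idem projective i (path_basis from_trivial)) path_basis_trivial.
  by congr path_basis; apply: from_inj; rewrite pa from_trivial_arrows.
have path_s : is_qpath i s by have := from_path p; rewrite pa is_qpath_rcons => /andP[].
have [q qs] := exists_path_from path_s;
  rewrite pa path_action_rcons -[X in path_action i X _]qs -IH //.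
by rewrite (@path_basis_arrow p) // pa qs.
Qed.

Section UniversalProperty.
Variables (M : kQmodule k Q) (m : M).

Definition projective_map_fun (f : projective) : M := \sum_p f p *: path_action i (from_arrows p) m.

Fact projective_map_linear : linear projective_map_fun.
Proof.
move=> c f g; rewrite /projective_map_fun scaler_sumr -big_split; apply: eq_bigr => p _.
by rewrite !ffunE scalerDl scalerA.
Qed.

Definition projective_map : 'Hom(projective, M) := linfun projective_map_fun.

Lemma projective_map_hom : is_hom projective_map.
Proof.
apply: is_hom_linfun => [|j f|a f]; first exact: projective_map_linear.
  rewrite /projective_map_fun linear_sum; apply: eq_bigr => p _ /=.
  rewrite projective_idemE linearZ /= -[in RHS]path_action_end idem_app -from_endE eq_sym.
  case: eqP => [->|_]; last by rewrite scale0r scaler0.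
  by rewrite from_endE path_action_end.
rewrite /projective_map_fun linear_sum /=.
under eq_bigr do rewrite projective_arrowE scaler_suml.
rewrite (exchange_big_dep predT) //=; apply: eq_bigr => q _.
rewrite linearZ /= -scaler_sumr; congr (_ *: _); rewrite -path_action_rcons.
case: (boolP (is_qpath i (rcons (from_arrows q) a))) => [path_qa|no_path].
  have [p pa] := exists_path_from path_qa; rewrite (big_pred1 p) ?pa // => r /=.
  by rewrite -pa; apply/eqP/eqP => [/from_inj|->].
rewrite big_pred0 => [|r]; last by apply: contraNF no_path => /eqP->; apply: from_path.
rewrite path_action_rcons -path_action_end arrow_idem.
by move: no_path; rewrite is_qpath_rcons from_path /= => /negPf->.
Qed.

Lemma projective_map_trivial : idem M i m = m -> projective_map (path_basis from_trivial) = m.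
Proof.
move=> im; rewrite linfunE; last exact: projective_map_linear.
rewrite /projective_map_fun (bigD1 from_trivial) //= big1 ?addr0 => [|p pt].
  by rewrite ffunE eqxx scale1r from_trivial_arrows.
by rewrite ffunE (negPf pt) scale0r.
Qed.

End UniversalProperty.

Lemma projective_hom_ext M (f g : 'Hom(projective, M)) : is_hom f -> is_hom g ->
  f (path_basis from_trivial) = g (path_basis from_trivial) -> f = g.
Proof.
move=> hf hg fg; apply/lfunP=> u; rewrite (path_basis_sum u) !linear_sum.
apply: eq_bigr => p _; rewrite !linearZ /= path_basis_action.
rewrite (hom_path_action (M := projective) _ _ _ hf).
by rewrite (hom_path_action (M := projective) _ _ _ hg) fg.
Qed.

Lemma dimhom_projective M : dimhom projective M = vertex_dim M i.
Proof.
apply: (dimv_linear_bij (f := fun g : 'Hom(projective, M) => g (path_basis from_trivial))).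
- by move=> c g h; rewrite add_lfunE scale_lfunE.
- move=> g; rewrite mem_homs => hg g0; apply: projective_hom_ext => //; first exact: is_hom0.
  by rewrite g0 zero_lfunE.
move=> m; split=> [/memv_imgP[u _ ->]|[g + <-]].
  exists (projective_map (idem M i u)); first by rewrite mem_homs projective_map_hom.
  by rewrite projective_map_trivial // idem_idem.
rewrite mem_homs => hg; rewrite -path_basis_trivial (hom_idemE hg).
by rewrite memv_img ?memvf.
Qed.

Lemma projective_lift E M (p : 'Hom(E, M)) (f : 'Hom(projective, M)) :
  is_epi p -> is_hom f -> exists2 s : 'Hom(projective, E), is_hom s & (p \o s)%VF = f.
Proof.
move=> ep hf; have [e pe] := epi_onto ep (f (path_basis from_trivial)).
have hs := projective_map_hom (idem E i e); exists (projective_map (idem E i e)) => //.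
apply: projective_hom_ext => //; first exact: is_hom_comp hs (epi_hom ep).
rewrite comp_lfunE projective_map_trivial ?idem_idem // (hom_idemE (epi_hom ep)) pe -(hom_idemE hf).
by rewrite path_basis_trivial.
Qed.

Lemma projective_ext0 N : dimhom N (tau projective) = 0%N.
Proof.
apply/eqP; rewrite -leqn0 leqNgt; apply/negP=> /(exists_nonsplit_ses acyclicQ).
case=> E [f [g [fg nonsplit]]]; have [mf eg imf] := fg.
have [s hs gs] := projective_lift eg (is_hom_id projective).
have hsg := is_hom_comp (epi_hom eg) hs.
have [|r hr rE] := mono_factor mf (is_homB (is_hom_id E) hsg).
  rewrite imf; apply/subvP=> _ /memv_imgP[u _ ->]; rewrite memv_ker add_lfunE opp_lfunE linearB /=.
  by rewrite comp_lfunE -[g (s _)]comp_lfunE gs !id_lfunE subrr.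
apply: (nonsplit r hr) => u; apply: (mono_inj mf); rewrite rE add_lfunE opp_lfunE comp_lfunE.
by rewrite id_lfunE (ses_comp0 _ fg) linear0 subr0.
Qed.

Lemma tau_nilpotent_projective : tau_nilpotent projective.
Proof. by exists 1%N; exact: dimhom_self0 (projective_ext0 (tau projective)). Qed.

End ProjectiveAtVertex.

Lemma euler_projective i M : euler (dimvec (projective i)) (dimvec M) = dimvec M i.
Proof. by rewrite -(euler_formula acyclicQ) dimhom_projective projective_ext0 subr0 dimvecE. Qed.

Lemma vertex_dim_tau M i : (vertex_dim (tau M) i)%:Z =
  (dimhom M (projective i))%:Z - euler (dimvec M) (dimvec (projective i)).
Proof.
by rewrite -(euler_formula acyclicQ) -(dimhom_projective i (tau M)) opprB addrC subrK.
Qed.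

End Projectives.

Section EulerForm.
Variable Q : quiver.
Implicit Types x y z : {ffun vtx Q -> int}.

Lemma euler_op x y : @euler (op_quiver Q) x y = @euler Q y x.
Proof. by rewrite /euler; congr (_ - _); apply: eq_bigr => i _; apply: mulrC. Qed.

Fact euler_zmod_morphism x : zmod_morphism (euler x).
Proof.
move=> y z; rewrite /euler; under eq_bigr do rewrite !ffunE mulrBr.
under [X in _ - X = _]eq_bigr do rewrite !ffunE mulrBr.
by rewrite !sumrB; ring.
Qed.
HB.instance Definition _ x :=
  GRing.isZmodMorphism.Build _ _ (euler x) (euler_zmod_morphism x).

End EulerForm.

Section EulerFormTheory.
Variable Q : quiver.
Implicit Types x y z : {ffun vtx Q -> int}.

Lemma euler0r x : euler x 0 = 0. Proof. exact: raddf0. Qed.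
Lemma eulerDr x y z : euler x (y + z) = euler x y + euler x z. Proof. exact: raddfD. Qed.
Lemma eulerBr x y z : euler x (y - z) = euler x y - euler x z. Proof. exact: raddfB. Qed.
Lemma eulerMzr x y t : euler x (y *~ t) = euler x y *~ t. Proof. exact: raddfMz. Qed.
Lemma euler_sumr (I : Type) (r : seq I) (P : pred I) (F : I -> {ffun vtx Q -> int}) x :
  euler x (\sum_(i <- r | P i) F i) = \sum_(i <- r | P i) euler x (F i).
Proof. exact: raddf_sum. Qed.

Lemma euler0l x : euler 0 x = 0. Proof. rewrite -euler_op; exact: raddf0. Qed.
Lemma eulerDl x y z : euler (x + y) z = euler x z + euler y z.
Proof. by have := raddfD (@euler (op_quiver Q) z) x y; rewrite /= !euler_op. Qed.
Lemma eulerBl x y z : euler (x - y) z = euler x z - euler y z.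
Proof. by have := raddfB (@euler (op_quiver Q) z) x y; rewrite /= !euler_op. Qed.
Lemma eulerMzl x y t : euler (x *~ t) y = euler x y *~ t.
Proof. by have := raddfMz (@euler (op_quiver Q) y) t x; rewrite /= !euler_op. Qed.
Lemma euler_suml (I : Type) (r : seq I) (P : pred I) (F : I -> {ffun vtx Q -> int}) x :
  euler (\sum_(i <- r | P i) F i) x = \sum_(i <- r | P i) euler (F i) x.
Proof. by elim/big_rec2: _ => [|i y1 y2 _ <-]; rewrite ?euler0l ?eulerDl. Qed.

Lemma ffunMzE (x : {ffun vtx Q -> int}) t i : (x *~ t) i = x i * t.
Proof. by case: t => n; rewrite ?NegzE ?mulrNz ?ffunE ffunMnE -mulr_natr natz ?mulrN. Qed.

Definition unit_vector (i : vtx Q) : {ffun vtx Q -> int} := [ffun j => (j == i)%:R].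

Lemma unit_vector_sum x : x = \sum_i unit_vector i *~ x i.
Proof.
apply/ffunP=> j; rewrite sum_ffunE (bigD1 j) //= big1 ?addr0 => [|i ij].
  by rewrite ffunMzE !ffunE eqxx mul1r.
by rewrite ffunMzE !ffunE eq_sym (negPf ij) mul0r.
Qed.

Lemma acyclic_op : acyclic Q -> acyclic (op_quiver Q).
Proof.
move=> acyclicQ i s path_s closed_s.
have reverse (j : vtx Q) (t : seq (arr Q)) : @is_qpath (op_quiver Q) j t ->
    @is_qpath Q (@qend (op_quiver Q) j t) (rev t) /\
    @qend Q (@qend (op_quiver Q) j t) (rev t) = j.
  elim: t j => [|a t IH] j //= /andP[/eqP aj path_t]; have [path_rev end_rev] := IH _ path_t.
  rewrite rev_cons is_qpath_rcons [@qend (op_quiver Q) j (a :: t)]/(@qend (op_quiver Q) (src a) t).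
  by rewrite path_rev end_rev eqxx; split=> //; rewrite /qend map_rcons last_rcons.
have [path_rev end_rev] := reverse i s path_s; rewrite closed_s in path_rev end_rev.
by have /(congr1 rev) := acyclicQ _ _ path_rev end_rev; rewrite revK.
Qed.

Lemma euler_left_nondeg z : acyclic Q -> (forall y, euler z y = 0) -> z = 0.
Proof.
move=> acyclicQ ker; apply/ffunP=> i0; rewrite [RHS]ffunE; apply: contrapT => z_i0.
have [i zi initial] :=
  @acyclic_exists_initial _ acyclicQ (fun i => z i <> 0) (ex_intro _ i0 z_i0).
apply: zi; have := ker (unit_vector i); rewrite /euler (bigD1 i) //= big1 => [|j ji].
  rewrite ffunE eqxx mulr1 addr0 big1 ?subr0 // => a _; rewrite ffunE.
  case: eqP => [ai|_]; last by rewrite mulr0.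
  by rewrite mulr1; apply: contrapT => /(initial a ai).
by rewrite ffunE (negPf ji) mulr0.
Qed.

End EulerFormTheory.

Lemma euler_right_nondeg (Q : quiver) (w : {ffun vtx Q -> int}) :
  acyclic Q -> (forall z, euler z w = 0) -> w = 0.
Proof.
move=> /acyclic_op acyclicQop ker; apply: (euler_left_nondeg acyclicQop) => z.
by rewrite euler_op.
Qed.

Definition null_root (Q : quiver) (d : {ffun vtx Q -> int}) :=
  [/\ forall i, 0 < d i,
      forall y, euler d y = - euler y d,
      forall x : {ffun vtx Q -> int}, 0 <= euler x x &
      forall x : {ffun vtx Q -> int}, euler x x = 0 -> exists t, x = d *~ t].

Lemma null_root_op (Q : quiver) (d : {ffun vtx Q -> int}) :
  null_root d -> @null_root (op_quiver Q) d.
Proof.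
case=> pos antisym semipos radical; split=> // [y|x|x]; rewrite !euler_op //.
  by rewrite antisym opprK.
exact: radical.
Qed.

Lemma null_root_isotropic (Q : quiver) (d : {ffun vtx Q -> int}) : null_root d -> euler d d = 0.
Proof. by case=> _ antisym _ _; have := antisym d; lia. Qed.

Section Defect.
Variables (k : fieldType) (Q : quiver).
Hypothesis acyclicQ : acyclic Q.
Implicit Types E L M N X Y Z : kQmodule k Q.
Local Notation projective := (projective k).

Section SimpleModule.
Variable i : vtx Q.

Definition simple_idem (j : vtx Q) : 'End(k^o) := if j == i then \1%VF else 0.

Fact simple_idemM j l :
  (simple_idem j \o simple_idem l)%VF = if j == l then simple_idem j else 0.
Proof.
rewrite /simple_idem; case: (eqVneq j l) => [<-|jl].
  by case: eqP => _; rewrite ?comp_lfun1l ?comp_lfun0l.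
case: (eqVneq j i) => [ji|_]; last by rewrite comp_lfun0l.
by rewrite -ji eq_sym (negPf jl) comp_lfun0r.
Qed.

Fact simple_idem_sum : \sum_j simple_idem j = \1%VF.
Proof.
rewrite (bigD1 i) //= big1 ?addr0 => [|j ji]; rewrite /simple_idem ?eqxx //.
by rewrite (negPf ji).
Qed.

Fact simple_arrow_ax (a : arr Q) :
  (0 : 'End(k^o)) = (simple_idem (tgt a) \o 0 \o simple_idem (src a))%VF.
Proof. by rewrite comp_lfun0r comp_lfun0l. Qed.

Definition simple : kQmodule k Q :=
  @KQModule k Q k^o simple_idem (fun=> 0) simple_idemM simple_idem_sum simple_arrow_ax.

Lemma dimvec_simple : dimvec simple = unit_vector i.
Proof.
apply/ffunP=> j; rewrite dimvecE ffunE /vertex_dim [idem _ _]/(simple_idem j) /simple_idem.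
case: eqP => _; last by rewrite lim0g dimv0.
by rewrite lim1g dimvf.
Qed.

End SimpleModule.

Lemma exists_module (x : {ffun vtx Q -> int}) : (forall i, 0 <= x i) ->
  exists M, dimvec M = x.
Proof.
have [n] := ubnP (absz (\sum_i x i)); elim: n x => // n IH x size_x x0.
case: (pselect (exists i, 0 < x i)) => [[i xi]|all_le0]; last first.
  exists zero_mod; apply/ffunP=> i; rewrite dimvecE /vertex_dim lim0g dimv0.
  apply/eqP; rewrite eq_le x0 leNgt; apply/negP=> xi.
  by apply: all_le0; exists i.
have [||M dimM] := IH (x - unit_vector i).
- move: size_x; rewrite (bigD1 i) //= => size_x.
  rewrite (bigD1 i) //= !ffunE eqxx (eq_bigr x) => [|j ji]; last first.
    by rewrite !ffunE (negPf ji) subr0.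
  have : 0 <= \sum_(j | j != i) x j by apply: sumr_ge0.
  by move: (x i) xi (\sum_(j | _) _) size_x; lia.
- move=> j; rewrite !ffunE; case: eqP => [->|_]; last by rewrite subr0.
  by rewrite subr_ge0.
exists (dsum (simple i) M); rewrite (dimvec_ses (dsum_ses _ _)) dimvec_simple dimM.
by rewrite addrC subrK.
Qed.

Lemma euler_projectivel (y : {ffun vtx Q -> int}) i : euler (dimvec (projective i)) y = y i.
Proof.
rewrite {1}(unit_vector_sum y) euler_sumr (bigD1 i) //= big1 => [|j ji];
  rewrite eulerMzr -dimvec_simple (euler_projective acyclicQ) dimvec_simple ffunE.
  by rewrite eqxx addr0 intz.
by rewrite eq_sym (negPf ji) mul0rz.
Qed.

Lemma projective_span (y : {ffun vtx Q -> int}) :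
  y = \sum_i dimvec (projective i) *~ euler y (unit_vector i).
Proof.
apply/eqP; rewrite -subr_eq0; apply/eqP/(euler_left_nondeg acyclicQ) => z.
rewrite eulerBl euler_suml {1}(unit_vector_sum z) euler_sumr -sumrB; apply: big1 => i _.
by rewrite eulerMzr eulerMzl euler_projectivel !mulrzz mulrC subrr.
Qed.

Lemma euler_tau M : (forall i, dimhom M (projective i) = 0%N) ->
  forall y, euler (dimvec M) y = - euler y (dimvec (tau M)).
Proof.
move=> no_maps y; rewrite (projective_span y) euler_sumr euler_suml -sumrN.
apply: eq_bigr => i _; rewrite eulerMzl eulerMzr euler_projectivel dimvecE (vertex_dim_tau
  acyclicQ).
by rewrite no_maps sub0r mulNrz opprK.
Qed.

Lemma dimhom_tau_tau M N : (forall i, dimhom M (projective i) = 0%N) ->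
  dimhom (tau M) (tau N) = dimhom M N.
Proof.
move=> no_maps; have := euler_formula acyclicQ M N; have := euler_formula acyclicQ N (tau M).
by rewrite (euler_tau no_maps); lia.
Qed.

Lemma dimhom_torsion_projective M i : torsion M -> dimhom M (projective i) = 0%N.
Proof. by apply; apply: tau_nilpotent_projective. Qed.

Lemma exists_simple_quotient M : ~ is_zero M -> exists i, (0 < dimhom M (simple i))%N.
Proof.
move=> nz; have : exists i, vertex_dim M i <> 0%N.
  apply: contrapT => none; apply: nz; rewrite /is_zero dim_sum_vertex_dim big1 // => i _.
  by apply: contrapT => Mi; apply: none; exists i.
case/(@acyclic_exists_initial _ acyclicQ (fun i => vertex_dim M i <> 0%N)) => i /eqP Mi initial.
have [w wI w0] : exists2 w, idem M i w = w & w != 0.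
  exists (vpick (limg (idem M i))); last by rewrite vpick0 -dimv_eq0.
  by apply/limg_idempotentP; [apply: idem_idem | apply: memv_pick].
have [l lw] := exists_functional w0; exists i; apply/dimhom_gt0P.
exists (l \o idem M i : 'Hom(M, simple i))%VF; last first.
  by apply: contraNneq lw => /lfunP/(_ w); rewrite comp_lfunE zero_lfunE wI => ->.
apply/is_homP; split=> [j u|a u]; rewrite !comp_lfunE.
  rewrite idem_app [idem (simple i) j]/(simple_idem i j) /simple_idem eq_sym.
  by case: eqP => _; rewrite ?id_lfunE ?zero_lfunE ?linear0.
rewrite [arrow (simple i) a]/(0 : 'End(k^o)) zero_lfunE idem_arrow.
case: eqP => [ia|_]; last by rewrite linear0.
have /contrapT/eqP := initial a (esym ia); rewrite dimv_eq0 => /eqP src0.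
rewrite -arrow_src; have : idem M (src a) u \in limg (idem M (src a)) by rewrite memv_img ?memvf.
by rewrite src0 memv0 => /eqP->; rewrite !linear0.
Qed.

Lemma split_projective M i : (0 < dimhom M (projective i))%N ->
  exists K I, [/\ ~ is_zero I, forall N, dimhom N (tau I) = 0%N & isom (dsum K I) M].
Proof.
case/dimhom_gt0P=> f hf f0; have sI := is_submod_limg hf; have sK := is_submod_ker hf.
have [g eg gE] := img_factor sI hf.
have ext0 N : dimhom N (tau (submod sI)) = 0%N.
  apply/eqP; rewrite -leqn0 -(projective_ext0 acyclicQ i N).
  exact: dimhom_mono (tau_map_mono (sub_incl_mono sI)).
exists (submod sK), (submod sI); split=> //.
  by rewrite is_zero_submod => /eqP; rewrite limg_eq0 (negPf f0).
apply: (ses_split_ext0 acyclicQ (f := sub_incl sK) (g := g) (ext0 _)); split=> //.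
  exact: sub_incl_mono.
rewrite limg_sub_incl; apply/vspaceP=> u.
by rewrite !memv_ker -gE -(inj_eq (@subvs_inj _ _ _)) linear0.
Qed.

Variable d : {ffun vtx Q -> int}.
Hypothesis null_d : null_root d.

Lemma defect_ses X Y Z (f : 'Hom(X, Y)) (g : 'Hom(Y, Z)) : is_ses f g ->
  defect d Y = defect d X + defect d Z.
Proof. by move=> fg; rewrite /defect (dimvec_ses fg) eulerDr. Qed.

Lemma defect_isom M N : isom M N -> defect d M = defect d N.
Proof. by move=> iMN; rewrite /defect (dimvec_isom iMN). Qed.

Lemma defect_zero M : is_zero M -> defect d M = 0.
Proof. by move/is_zero_dimvec=> M0; rewrite /defect M0 euler0r. Qed.

Lemma defect_ext0_lt0 M : ~ is_zero M -> (forall N, dimhom N (tau M) = 0%N) -> defect d M < 0.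
Proof.
case: null_d => pos antisym _ _ nz ext0.
rewrite /defect antisym oppr_lt0 (unit_vector_sum d) euler_sumr.
have multiplicity i : euler (dimvec M) (unit_vector i *~ d i) = d i * (dimhom M (simple i))%:Z.
  by rewrite eulerMzr -dimvec_simple -(euler_formula acyclicQ) ext0 subr0 mulrzz mulrC.
rewrite (eq_bigr _ (fun j _ => multiplicity j)).
have [i Mi] := exists_simple_quotient nz; rewrite (bigD1 i) //= ltr_pwDl ?mulr_gt0 //.
apply: sumr_ge0 => j _; exact: (mulr_ge0 (ltW (pos j)) (le0z_nat _)).
Qed.

Lemma tau_nilpotent_defect_lt0 M : tau_nilpotent M -> ~ is_zero M -> defect d M < 0.
Proof.
case=> n; elim: n M => [|n IHn] M; first by [].
have [m] := ubnP (\dim {:M}); elim: m M => // m IHm M dimM zero_n nz.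
case: (pselect (exists i, (0 < dimhom M (projective i))%N)) => [[i Mi]|no_map].
  have [K [I [nzI ext0 iM]]] := split_projective Mi.
  have defectI := defect_ext0_lt0 nzI ext0.
  rewrite -(defect_isom iM) (defect_ses (dsum_ses K I)).
  case: (pselect (is_zero K)) => [K0|nzK]; first by rewrite (defect_zero K0) add0r.
  suff defectK : defect d K < 0 by lia.
  have [g mg eg] := isom_epimono iM.
  apply: IHm (iter_tau_mono (mono_comp (dsum_inl_mono K I) mg) zero_n) nzK.
  have -> : \dim {:K} = (\dim {:M} - \dim {:I})%N.
    by rewrite -(epi_limg eg) (limg_dim_lker0 _ (mono_lker0 mg)) (dim_ses (dsum_ses K I)) addnK.
  have : (0 < \dim {:I})%N by rewrite lt0n; apply/eqP.
  have : (\dim {:I} <= \dim {:M})%N.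
    by rewrite -(limg_dim_lker0 _ (mono_lker0 (mono_comp (dsum_inr_mono K I) mg))) dimvS ?subvf.
  by move: dimM; lia.
have no_maps i : dimhom M (projective i) = 0%N.
  by apply/eqP; rewrite -leqn0 leqNgt; apply/negP=> Mi; apply: no_map; exists i.
case: null_d => _ antisym _ _.
have -> : defect d M = defect d (tau M) by rewrite /defect antisym (euler_tau no_maps) opprK.
apply: IHn; first by rewrite -iterSr.
move/is_zero_dimvec=> tauM0; apply: nz; apply/is_zero_dimvec/(euler_left_nondeg acyclicQ) => y.
by rewrite (euler_tau no_maps) tauM0 euler0r oppr0.
Qed.

Lemma tau_nilpotent_defect0 M : tau_nilpotent M -> defect d M = 0 -> is_zero M.
Proof.
by move=> nM defect0; apply: contrapT => /(tau_nilpotent_defect_lt0 nM); rewrite defect0.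
Qed.

Lemma tau_nilpotent_defect_le0 M : tau_nilpotent M -> defect d M <= 0.
Proof.
move=> nM; case: (pselect (is_zero M)) => [M0|nz]; first by rewrite defect_zero.
exact/ltW/tau_nilpotent_defect_lt0.
Qed.

End Defect.

(** * Duality *)

Section Dual.
Variables (k : fieldType) (Q : quiver).
Implicit Types L M N X Y Z : kQmodule k Q.

Lemma idem_dual M i (h : dual M) u :
  (idem (dual M) i h : 'Hom(M, k^o)) u = (h : 'Hom(M, k^o)) (idem M i u).
Proof. by rewrite [idem (dual M) i h]lfunE /= /dual_fun comp_lfunE. Qed.

Lemma arrow_dual M a (h : dual M) u :
  (arrow (dual M) a h : 'Hom(M, k^o)) u = (h : 'Hom(M, k^o)) (arrow M a u).
Proof. by rewrite [arrow (dual M) a h]lfunE /= /dual_fun comp_lfunE. Qed.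

Lemma vertex_dim_dual M i : vertex_dim (dual M) i = vertex_dim M i.
Proof.
rewrite /vertex_dim (@dim_hom_idempotents k M k^o (idem M i) \1%VF).
- by rewrite lim1g dimvf muln1.
- exact: idem_idem.
- by move=> u; rewrite !id_lfunE.
move=> h; split=> [/memv_imgP[g _ ->] u|hE].
  by rewrite id_lfunE [LHS]idem_dual [RHS]idem_dual idem_idem.
apply/memv_imgP; exists h; first exact: memvf.
by apply/lfunP=> u; rewrite [RHS]idem_dual hE id_lfunE.
Qed.

Lemma dimvec_dual M : dimvec (dual M) = dimvec M :> {ffun vtx Q -> int}.
Proof. by apply/ffunP=> i; rewrite [LHS]dimvecE dimvecE vertex_dim_dual. Qed.

Lemma is_zero_dual M : is_zero (dual M) <-> is_zero M.
Proof. by rewrite !is_zero_dimvec dimvec_dual. Qed.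

Lemma defect_dual (d : {ffun vtx Q -> int}) M : null_root d ->
  @defect k (op_quiver Q) d (dual M) = - defect d M.
Proof. by case=> _ antisym _ _; rewrite /defect dimvec_dual euler_op antisym opprK. Qed.

Definition dual_map M N (f : 'Hom(M, N)) : 'Hom(dual N, dual M) := precomp k^o f.

Lemma dual_mapE M N (f : 'Hom(M, N)) (h : dual N) u :
  (dual_map f h : 'Hom(M, k^o)) u = (h : 'Hom(N, k^o)) (f u).
Proof. by rewrite [dual_map f h]precompE comp_lfunE. Qed.

Lemma dual_map_inj M N : injective (@dual_map M N).
Proof.
move=> f g same_dual; apply/lfunP=> u; apply: functional_sep => h.
by rewrite -(dual_mapE f) -(dual_mapE g) same_dual.
Qed.

Lemma dual_map_linear M N : linear (@dual_map M N).
Proof.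
move=> c f g; apply/lfunP=> h; apply/lfunP=> u.
rewrite add_lfunE scale_lfunE [RHS]add_lfunE scale_lfunE !dual_mapE add_lfunE scale_lfunE.
by rewrite linearP.
Qed.

Lemma dual_map_surj M N (F : 'Hom(dual N, dual M)) : exists f : 'Hom(M, N), dual_map f = F.
Proof.
have /limg_fullP/(_ F)[f <-] : limg (linfun (@dual_map M N)) == fullv.
  rewrite eqEdim subvf limg_dim_in /= => [|f _]; first by rewrite !dimvf !dim_hom !muln1 mulnC.
  rewrite (linfunE (@dual_map_linear M N)) => f0; apply: dual_map_inj.
  by rewrite f0 -(linfunE (@dual_map_linear M N)) linear0.
by exists f; rewrite (linfunE (@dual_map_linear M N)).
Qed.

Lemma is_hom_dual M N (f : 'Hom(M, N)) : is_hom (dual_map f) = is_hom f.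
Proof.
apply/is_homP/is_homP => -[idemC arrowC]; split=> [i u|a u].
- apply: functional_sep => h; have /lfunP/(_ u) := idemC i h.
  by rewrite dual_mapE [LHS]idem_dual [RHS]idem_dual dual_mapE.
- apply: functional_sep => h; have /lfunP/(_ u) := arrowC a h.
  by rewrite dual_mapE [LHS]arrow_dual [RHS]arrow_dual dual_mapE.
- by apply/lfunP=> v; rewrite dual_mapE [LHS]idem_dual [RHS]idem_dual dual_mapE idemC.
by apply/lfunP=> v; rewrite dual_mapE [LHS]arrow_dual [RHS]arrow_dual dual_mapE arrowC.
Qed.

Lemma dimhom_dual M N : dimhom (dual N) (dual M) = dimhom M N.
Proof.
apply/esym/(dimv_linear_bij (@dual_map_linear M N)) => [f _ f0|F].
  by apply: dual_map_inj; rewrite f0 -(linfunE (@dual_map_linear M N)) linear0.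
rewrite mem_homs; split=> [hF|[f + <-]]; last by rewrite mem_homs is_hom_dual.
by have [f fF] := dual_map_surj F; exists f; rewrite // mem_homs -is_hom_dual fF.
Qed.

Lemma lker_dual_map M N (f : 'Hom(M, N)) : lker (dual_map f) = annihilator (limg f).
Proof.
apply/vspaceP=> h; rewrite memv_ker; apply/eqP/annihilatorP => [fh0 _ /memv_imgP[u _ ->]|h0].
  by rewrite -dual_mapE fh0 zero_lfunE.
by apply/lfunP=> u; rewrite dual_mapE h0 ?memv_img ?memvf // zero_lfunE.
Qed.

Lemma is_mono_dual M N (f : 'Hom(M, N)) : is_mono (dual_map f) = is_epi f.
Proof.
rewrite /is_mono is_hom_dual lker_dual_map -dimv_eq0 /is_epi eqEdim subvf /=.
by rewrite -(dim_annihilator (limg f)) -{2}[\dim (limg f)]add0n leq_add2r leqn0.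
Qed.

Lemma dim_dual M : \dim {:dual M} = \dim {:M}.
Proof. by rewrite !dimvf dim_hom muln1. Qed.

Lemma dim_limg_dual_map M N (f : 'Hom(M, N)) : \dim (limg (dual_map f)) = \dim (limg f).
Proof.
apply: (@addnI (\dim (annihilator (limg f)))); rewrite dim_annihilator -(dim_dual N).
by rewrite -(limg_ker_dim (dual_map f) fullv) capfv lker_dual_map.
Qed.

Lemma is_epi_dual M N (f : 'Hom(M, N)) : is_epi (dual_map f) = is_mono f.
Proof.
rewrite /is_epi is_hom_dual /is_mono eqEdim subvf /= -dimv_eq0 dim_limg_dual_map dim_dual.
by rewrite -(limg_ker_dim f fullv) capfv -{2}[\dim (limg f)]add0n leq_add2r leqn0.
Qed.

Lemma isom_dual_inv M N : isom (dual N) (dual M) -> isom M N.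
Proof.
case/isom_epimono=> F mF eF; have [f fF] := dual_map_surj F.
by apply: (isomI (f := f)); rewrite -(is_mono_dual, is_epi_dual) fF.
Qed.

Lemma isom_dual_dsum X Y : isom (dual (dsum X Y)) (dsum (dual X) (dual Y)).
Proof.
pose h := dsum_pair (dual_map (dsum_inl X Y)) (dual_map (dsum_inr X Y)).
have mh : is_mono h.
  apply/is_monoP; split=> [|f]; first by apply: dsum_pair_hom; rewrite is_hom_dual mono_hom
    ?dsum_inl_mono ?dsum_inr_mono.
  rewrite dsum_pairE => -[fl0 fr0]; apply/lfunP=> u; rewrite [LHS]dsum_copair_eta !comp_lfunE.
  by rewrite -!dual_mapE fl0 fr0 !zero_lfunE addr0.
exists h; apply: mono_dimvec_iso => //; rewrite (dimvec_ses (dsum_ses _ _)).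
rewrite [LHS](dimvec_dual (dsum X Y)) [dimvec (dual X)](dimvec_dual X).
by rewrite [dimvec (dual Y)](dimvec_dual Y) (dimvec_ses (dsum_ses _ _)).
Qed.

Lemma is_submod_annihilator M (X : {vspace M}) :
  is_submod X -> is_submod (annihilator X : {vspace dual M}).
Proof.
move=> sX; apply/is_submodP; split=> [i h|a h] /annihilatorP hX; apply/annihilatorP=> u uX.
  by rewrite [LHS]idem_dual hX // submod_idem.
by rewrite [LHS]arrow_dual hX // submod_arrow.
Qed.

Lemma is_submod_zero_locus M (Z : {vspace dual M}) : is_submod Z -> is_submod (zero_locus Z).
Proof.
move=> sZ; apply/is_submodP; split=> [i u|a u] /zero_locusP u0; apply/zero_locusP=> h hZ.
  by rewrite -[LHS](idem_dual i h) u0 // (@submod_idem _ (op_quiver Q) _ _ i _ sZ).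
by rewrite -[LHS](arrow_dual a h) u0 // (@submod_arrow _ (op_quiver Q) _ _ a _ sZ).
Qed.

End Dual.

(* The double dual of N is a module over kQ only up to eta for op_quiver,     *)
(* hence the explicit quiver.                                                 *)
Lemma isom_bidual (k : fieldType) (V A : finType) (s t : A -> V) (N : kQmodule k (Quiver s t)) :
  isom N (dual (dual N) : kQmodule k (Quiver s t)).
Proof.
pose M : kQmodule k (Quiver t s) := dual N; rewrite -/M.
pose ev (u : N) : dual M := linfun (fun h : 'Hom(N, k^o) => h u).
have evE u (h : 'Hom(N, k^o)) : (ev u : 'Hom('Hom(N, k^o), k^o)) h = h u.
  by rewrite linfunE // => c x y; rewrite add_lfunE scale_lfunE.
have ev_linear : linear ev.
  by move=> c u v; apply/lfunP=> h; rewrite evE add_lfunE scale_lfunE !evE linearP.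
have mono_ev : is_mono (linfun ev : 'Hom(N, dual M)).
  apply/is_monoP; split=> [|u]; last first.
    rewrite linfunE // => /lfunP ev0; apply: functional_sep => h.
    by have := ev0 h; rewrite evE zero_lfunE linear0.
  apply: is_hom_linfun => // [i u|a u]; apply/lfunP=> h.
    by rewrite evE [RHS]idem_dual [RHS]evE idem_dual.
  by rewrite evE [RHS]arrow_dual [RHS]evE arrow_dual.
apply: (isomI mono_ev); rewrite /is_epi (mono_hom mono_ev) eqEdim subvf.
by rewrite (limg_dim_lker0 _ (mono_lker0 mono_ev)) !dimvf !dim_hom !muln1 leqnn.
Qed.

Lemma exists_predual (k : fieldType) (Q : quiver) (N : kQmodule k (op_quiver Q)) :
  exists M : kQmodule k Q, isom (dual M) N.
Proof.
case: Q N => V A s t N; exists (dual N : kQmodule k (Quiver s t)).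
exact: isom_sym (isom_bidual (N : kQmodule k (Quiver t s))).
Qed.

Lemma indecomposable_dual (k : fieldType) (Q : quiver) (M : kQmodule k Q) :
  indecomposable M -> indecomposable (dual M).
Proof.
move=> [nz indec]; split=> [/is_zero_dual //|X Y iXY].
have [X' iX] := exists_predual X; have [Y' iY] := exists_predual Y.
have iM : isom M (dsum X' Y').
  apply: isom_dual_inv; apply: isom_trans (isom_dual_dsum X' Y') _.
  exact: isom_trans (isom_dsum iX iY) (isom_sym iXY).
by case: (indec _ _ iM) => /is_zero_dual z; [left; apply: is_zero_isom iX z|right;
  apply: is_zero_isom iY z].
Qed.

(** * Defect of torsion modules *)

Lemma bounded_sequence_repeats (I : finType) (f : nat -> {ffun I -> int}) (c : nat) :
  (forall n i, `|f n i| <= c%:Z) -> exists m n, [/\ (0 < n)%N & f (m + n)%N = f m].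
Proof.
move=> bounded; have small n i : (absz (f n i + c%:Z)%R < c.*2.+1)%N by have := bounded n i; lia.
pose class n : {ffun I -> 'I_c.*2.+1} := [ffun i => Ordinal (small n i)].
have class_inj m n : class m = class n -> f m = f n.
  move/ffunP=> same; apply/ffunP=> i; have /(congr1 val) := same i; rewrite !ffunE /=.
  by have := bounded m i; have := bounded n i; lia.
have /injectivePn[m [n mn /class_inj same]] :
    ~~ injectiveb (fun i : 'I_(#|{ffun I -> 'I_c.*2.+1}|.+1) => class i).
  by apply/negP=> /injectiveP/leq_card; rewrite card_ord ltnn.
have [lt_mn|lt_nm|/val_inj mn_eq] := ltngtP m n; last by rewrite mn_eq eqxx in mn.
- by exists m, (n - m)%N; rewrite subn_gt0 subnKC ?(ltnW lt_mn) // same.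
by exists n, (m - n)%N; rewrite subn_gt0 subnKC ?(ltnW lt_nm).
Qed.

Section SymmetricEulerForm.
Variable Q : quiver.
Hypothesis acyclicQ : acyclic Q.
Variable d : {ffun vtx Q -> int}.
Hypothesis null_d : null_root d.
Implicit Types x z : {ffun vtx Q -> int}.

Definition sym_euler x z : int := euler x z + euler z x.

Lemma euler_unit_vector (i : vtx Q) : euler (unit_vector i) (unit_vector i) = 1.
Proof.
rewrite /euler (bigD1 i) //= big1 => [|j ji]; last by rewrite !ffunE (negPf ji) mul0r.
rewrite !ffunE eqxx mulr1 addr0 big1 ?subr0 // => a _; rewrite !ffunE -natrM mulnb.
case: andP => // -[/eqP src_a /eqP tgt_a].
by have := acyclic_no_loop acyclicQ a; rewrite src_a tgt_a eqxx.
Qed.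

Lemma sym_euler_bound x i : `|sym_euler x (unit_vector i)| <= euler x x + 1.
Proof.
case: null_d => _ _ semipos _; rewrite /sym_euler -(euler_unit_vector i).
have := semipos (x + unit_vector i); have := semipos (x - unit_vector i).
by rewrite !(eulerBl, eulerDl, eulerBr, eulerDr); lia.
Qed.

Lemma sym_euler_radical z :
  (forall i, sym_euler z (unit_vector i) = 0) -> exists t, z = d *~ t.
Proof.
move=> rad; case: null_d => _ _ _; apply; have : euler z z + euler z z = 0; last by lia.
rewrite {2 3}(unit_vector_sum z) euler_suml euler_sumr -big_split big1 // => i _.
by rewrite eulerMzl eulerMzr /= -mulrzDl [X in X *~ _](rad i) mul0rz.
Qed.

(* The dimension vectors of the tau-orbit of a torsion module satisfy these   *)
(* hypotheses: y n.+1 is the image of y n under the Coxeter transformation.   *)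
Section CoxeterOrbit.
Variable y : nat -> {ffun vtx Q -> int}.
Hypothesis coxeter : forall n z, euler (y n) z = - euler z (y n.+1).
Hypothesis nonneg : forall n i, 0 <= y n i.

Lemma orbit_defect n : euler d (y n) = euler d (y 0).
Proof.
case: null_d => _ antisym _ _; elim: n => // n <-.
by rewrite [RHS]antisym coxeter opprK.
Qed.

Lemma orbit_tits n : euler (y n) (y n) = euler (y 0) (y 0).
Proof. by elim: n => // n <-; rewrite [RHS]coxeter [X in - X]coxeter opprK. Qed.

Lemma orbit_sym_euler n z : sym_euler (y n) z = euler z (y n - y n.+1).
Proof. by rewrite /sym_euler eulerBr coxeter addrC. Qed.

Lemma orbit_period : exists m n t, [/\ (0 < n)%N & y (m + n) = y m + d *~ t].
Proof.
pose c := absz (euler (y 0) (y 0) + 1).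
have bounded n i : `|[ffun i => sym_euler (y n) (unit_vector i)] i| <= c%:Z.
  by rewrite ffunE; have := sym_euler_bound (y n) i; rewrite orbit_tits /c; lia.
have [m [n [n_gt0 /ffunP same]]] := bounded_sequence_repeats bounded.
have [i|t tE] := sym_euler_radical (z := y (m + n)%N - y m).
  by have := same i; rewrite !ffunE /sym_euler eulerBl eulerBr; lia.
by exists m, n, t; rewrite -tE addrC subrK.
Qed.

Section Period.
Variables (m n : nat) (t : int).
Hypothesis period : y (m + n) = y m + d *~ t.

Lemma orbit_shift j : y (j + m + n) = y (j + m) + d *~ t.
Proof.
elim: j => // j IH; apply/eqP; rewrite -subr_eq0; apply/eqP/(euler_right_nondeg acyclicQ) => z.
have step l : euler z (y l.+1) = - euler (y l) z by rewrite coxeter opprK.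
case: null_d => _ antisym _ _; rewrite !addSn eulerBr eulerDr eulerMzr !step IH eulerDl eulerMzl.
by rewrite antisym !mulrzz; ring.
Qed.

Lemma orbit_iterated_period j : y (m + j * n) = y m + d *~ (t * j%:Z).
Proof.
elim: j => [|j IH]; first by rewrite mul0n addn0 mulr0 mulr0z addr0.
have -> : (m + j.+1 * n = j * n + m + n)%N by rewrite mulSn; lia.
by rewrite orbit_shift addnC IH -addrA -mulrzDr -[j.+1]addn1 PoszD mulrDr mulr1.
Qed.

Lemma orbit_period_ge0 (i : vtx Q) : 0 <= t.
Proof.
case: null_d => pos _ _ _; rewrite leNgt; apply/negP=> t_lt0.
have [j y_lt_j] : exists j : nat, y m i < j%:Z by exists (absz (y m i)).+1; lia.
have := nonneg (m + j * n) i; rewrite orbit_iterated_period ffunE ffunMzE.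
move: (pos i) y_lt_j; move: (d i) (y m i) => di yi di_gt0 y_lt_j.
have tj : t * j%:Z <= - j%:Z by nia.
have : di * (t * j%:Z) <= t * j%:Z by nia.
by move: (t * j%:Z) (di * _) tj => u v; lia.
Qed.

Definition period_sum := \sum_(m <= l < m + n) y l.

Lemma period_sum_sym_euler z : sym_euler period_sum z = - euler z d * t.
Proof.
rewrite /sym_euler euler_suml euler_sumr -big_split /=.
rewrite (eq_bigr _ (fun l _ => orbit_sym_euler l z)) -euler_sumr.
have -> : \sum_(m <= l < m + n) (y l - y l.+1) = - (d *~ t).
  have -> : d *~ t = y (m + n) - y m by rewrite period addrC addKr.
  rewrite -(telescope_sumr y) ?leq_addr // -sumrN.
  by apply: eq_bigr => l _; rewrite opprB.
by rewrite -mulrNz eulerMzr mulrzz mulrN mulNr.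
Qed.

Lemma period_sum_defect : euler d period_sum = euler d (y 0) * n%:Z.
Proof.
rewrite euler_sumr (eq_bigr (fun=> euler d (y 0))) => [|l _]; last exact: orbit_defect.
by rewrite sumr_const_nat addnC addnK -mulr_natr natz.
Qed.

End Period.

(* The sum Y over a period satisfies 2 <Y, Y> = t <d, Y> with t >= 0, so that *)
(* <Y, Y> = 0 if <d, Y> < 0; but then Y is a multiple of d.                   *)
Lemma orbit_defect_ge0 : 0 <= euler d (y 0).
Proof.
have [m [n [t [n_gt0 period]]]] := orbit_period; case: null_d => _ antisym semipos radical.
rewrite leNgt; apply/negP=> defect_lt0.
have t_ge0 : 0 <= t.
  have [i _|no_vertex] := pickP (predT : pred (vtx Q)); first exact: orbit_period_ge0 period i.
  have y0 : y 0 = 0 by apply/ffunP=> i; have := no_vertex i.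
  by rewrite y0 euler0r ltxx in defect_lt0.
have := period_sum_sym_euler period; move: (period_sum_defect m n).
move: (period_sum m n) => Y defectY /(_ Y); rewrite /sym_euler -antisym defectY => tits.
have defectY_lt0 : euler d (y 0) * n%:Z < 0 by rewrite nmulr_rlt0 // ltz_nat.
have tits0 : euler Y Y = 0.
  move: (semipos Y) tits defectY_lt0; move: (euler Y Y) (_ * n%:Z) => q u; nia.
have [s Ys] := radical _ tits0; rewrite -defectY Ys eulerMzr in defectY_lt0.
by rewrite null_root_isotropic // mul0rz ltxx in defectY_lt0.
Qed.

End CoxeterOrbit.

End SymmetricEulerForm.

(** * Regular modules *)

Section TauInverse.
Variables (k : fieldType) (Q : quiver).
Hypothesis acyclicQ : acyclic Q.
Let acyclicQop := acyclic_op acyclicQ.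
Variables X Y : kQmodule k Q.
Hypothesis tau_inverse : isom (dual X) (tau (dual Y)).

Lemma dimhom_tau_inverse M : dimhom Y (tau M) = dimhom X M.
Proof.
have := euler_formula acyclicQ M Y; have := euler_formula acyclicQop (dual Y) (dual M).
by rewrite !dimvec_dual euler_op dimhom_dual -(dimhom_isomr _ tau_inverse) dimhom_dual; lia.
Qed.

Lemma dimhom_tau_tau_inverse M :
  (forall i, dimhom (dual Y) (projective k (Q := op_quiver Q) i) = 0%N) ->
  dimhom M (tau X) = dimhom M Y.
Proof.
move=> no_maps; rewrite -(dimhom_dual M Y) -(dimhom_tau_tau acyclicQop (dual M) no_maps).
rewrite -(dimhom_isoml _ tau_inverse).
have := euler_formula acyclicQ X M; have := euler_formula acyclicQop (dual M) (dual X).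
by rewrite !dimvec_dual euler_op dimhom_dual; lia.
Qed.

End TauInverse.

Section TorsionModules.
Variables (k : fieldType) (Q : quiver).
Hypothesis acyclicQ : acyclic Q.
Variable d : {ffun vtx Q -> int}.
Hypothesis null_d : null_root d.
Implicit Types L M N X Y Z : kQmodule k Q.

Let acyclicQop := acyclic_op acyclicQ.
Let null_dop := null_root_op null_d.

Lemma dimhom_dual_projective B i :
  tau_nilpotent B -> dimhom (dual B) (projective k (Q := op_quiver Q) i) = 0%N.
Proof.
move=> nB; apply/eqP; rewrite -leqn0 leqNgt; apply/negP=> maps.
have [K [I [nzI ext0 iB]]] := split_projective acyclicQop maps.
have [J iJ] := exists_predual I.
have [u _ eu] := isom_epimono (isom_sym iB); have [v _ ev] := isom_epimono (isom_sym iJ).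
have [f fE] := dual_map_surj (v \o (dsum_snd K I \o u) : 'Hom(dual B, dual J))%VF.
have mf : is_mono f.
  by rewrite -is_epi_dual fE; apply: epi_comp ev; apply: epi_comp eu (dsum_snd_epi K I).
have := defect_ext0_lt0 acyclicQop null_dop nzI ext0.
rewrite -(defect_isom (Q := op_quiver Q) d iJ) (defect_dual _ null_d) oppr_lt0.
by rewrite ltNge (tau_nilpotent_defect_le0 acyclicQ null_d (tau_nilpotent_mono mf nB)).
Qed.

Lemma exists_tau_preimage B : tau_nilpotent B ->
  exists2 C, tau_nilpotent C & forall X, dimhom X (tau C) = dimhom X B.
Proof.
move=> nB; have [C iC] := exists_predual (tau (dual B)).
have hom_tauC X := dimhom_tau_tau_inverse acyclicQ iC X (fun i => dimhom_dual_projective i nB).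
exists C => //; apply/tau_nilpotent_tau.
have [A [B' [tA nB' iM]]] := torsion_decomposition acyclicQ (tau C).
suff A0 : is_zero A.
  by apply: tau_nilpotent_isom (isom_sym iM) _; apply: tau_nilpotent_isom (isom_dsum0l B' A0) nB'.
have [g mg _] := isom_epimono iM; apply: dimhom_self0; apply/eqP; rewrite -leqn0.
by rewrite -(tA B nB) -hom_tauC; apply: dimhom_mono (mono_comp (dsum_inl_mono A B') mg).
Qed.

Lemma torsion_tau M : torsion M -> torsion (tau M).
Proof.
move=> tM B nB; have [C nC hom_tauC] := exists_tau_preimage nB.
by rewrite -hom_tauC (dimhom_tau_tau acyclicQ) ?tM // => i; apply: dimhom_torsion_projective.
Qed.

Lemma euler_tau_torsion M :
  torsion M -> forall y, euler (dimvec M) y = - euler y (dimvec (tau M)).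
Proof. by move=> tM; apply: (euler_tau acyclicQ) => i; apply: dimhom_torsion_projective. Qed.

Lemma dimhom_tau_tau_torsion M N : torsion M -> dimhom (tau M) (tau N) = dimhom M N.
Proof. by move=> tM; apply: (dimhom_tau_tau acyclicQ) => i; apply: dimhom_torsion_projective. Qed.

Lemma torsion_defect_ge0 M : torsion M -> 0 <= defect d M.
Proof.
move=> tM; apply: (orbit_defect_ge0 acyclicQ null_d (y := fun n => dimvec (iter n (@tau k Q) M))).
  by move=> n z; apply: euler_tau_torsion; elim: n => // n; apply: torsion_tau.
by move=> n i; rewrite dimvecE.
Qed.

Definition cotorsion M := forall C : kQmodule k Q, tau_nilpotent (dual C) -> dimhom C M = 0%N.

Lemma torsion_dual M : torsion (dual M) <-> cotorsion M.
Proof.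
split=> [tM C nC|cM N nN]; first by rewrite -dimhom_dual tM.
have [C iC] := exists_predual N; rewrite -(dimhom_isomr _ iC) dimhom_dual cM //.
exact: tau_nilpotent_isom iC nN.
Qed.

Lemma cotorsion_mono M N (f : 'Hom(M, N)) : is_mono f -> cotorsion N -> cotorsion M.
Proof. by move=> mf cN C nC; apply/eqP; rewrite -leqn0 -(cN C nC) (dimhom_mono _ mf). Qed.

Lemma cotorsion_ses X Y Z (f : 'Hom(X, Y)) (g : 'Hom(Y, Z)) : is_ses f g ->
  cotorsion X -> cotorsion Z -> cotorsion Y.
Proof.
move=> fg cX cZ C nC; apply/eqP; rewrite -leqn0; apply: leq_trans (dimhom_sesr C fg) _.
by rewrite cX // cZ.
Qed.

End TorsionModules.

Lemma cotorsion_dual (k : fieldType) (Q : quiver) (M : kQmodule k Q) :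
  torsion M -> cotorsion (dual M).
Proof.
case: Q M => V A s t M tM C nC.
rewrite (dimhom_isoml _ (isom_bidual (C : kQmodule k (Quiver t s)))).
exact: (etrans (@dimhom_dual k (Quiver s t) M (dual C)) (tM _ nC)).
Qed.

Section RegularModules.
Variables (k : fieldType) (Q : quiver).
Implicit Types L M N R T X Y Z : kQmodule k Q.

Definition tau_regular M := torsion M /\ cotorsion M.

Lemma tau_regular_isom M N : isom M N -> tau_regular M -> tau_regular N.
Proof.
move=> iMN [tM cM]; split; first exact: torsion_isom iMN tM.
by have [f mf _] := isom_epimono (isom_sym iMN); apply: cotorsion_mono mf cM.
Qed.

Lemma tau_regular_ses X Y Z (f : 'Hom(X, Y)) (g : 'Hom(Y, Z)) : is_ses f g ->
  tau_regular X -> tau_regular Z -> tau_regular Y.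
Proof.
by move=> fg [tX cX] [tZ cZ]; split; [apply: torsion_ses fg _ _|apply: cotorsion_ses fg _ _].
Qed.

End RegularModules.

Lemma tau_regular_dual (k : fieldType) (Q : quiver) (M : kQmodule k Q) :
  tau_regular M -> tau_regular (dual M).
Proof. by case=> tM /torsion_dual cM; split; [|apply: cotorsion_dual]. Qed.

Section CotorsionDefect.
Variables (k : fieldType) (Q : quiver).
Implicit Types L M N R T X Y Z : kQmodule k Q.
Hypothesis acyclicQ : acyclic Q.
Variable d : {ffun vtx Q -> int}.
Hypothesis null_d : null_root d.

Let acyclicQop := acyclic_op acyclicQ.
Let null_dop := null_root_op null_d.

Lemma cotorsion_defect_le0 M : cotorsion M -> defect d M <= 0.
Proof.
by move/torsion_dual=> /(torsion_defect_ge0 acyclicQop null_dop); rewrite defect_dual // oppr_ge0.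
Qed.

Lemma tau_regular_defect M : tau_regular M -> defect d M = 0.
Proof.
case=> tM cM; apply/eqP; rewrite eq_le cotorsion_defect_le0 //.
exact: torsion_defect_ge0 tM.
Qed.

Lemma cotorsion_defect0_regular M : cotorsion M -> defect d M = 0 -> tau_regular M.
Proof.
move=> cM defectM; have [A [B [tA nB iM]]] := torsion_decomposition acyclicQ M.
have [g mg _] := isom_epimono iM.
have rA : tau_regular A by split=> //; apply: cotorsion_mono (mono_comp (dsum_inl_mono A B) mg) cM.
have defectB : defect d B = 0.
  by rewrite -defectM -(defect_isom d iM) (defect_ses d (dsum_ses A B)) (tau_regular_defect rA)
    add0r.
have B0 := tau_nilpotent_defect0 acyclicQ null_d nB defectB.
exact: tau_regular_isom iM (tau_regular_isom (isom_sym (isom_dsum0r A B0)) rA).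
Qed.

End CotorsionDefect.

Section RegularCategory.
Variables (k : fieldType) (Q : quiver).
Hypothesis acyclicQ : acyclic Q.
Variable d : {ffun vtx Q -> int}.
Hypothesis null_d : null_root d.
Implicit Types L M N R T X Y Z : kQmodule k Q.

Let acyclicQop := acyclic_op acyclicQ.
Let null_dop := null_root_op null_d.

Lemma torsion_defect0_regular M : torsion M -> defect d M = 0 -> tau_regular M.
Proof.
move=> tM defectM; split=> //; apply/torsion_dual.
have defect_dualM : @defect k (op_quiver Q) d (dual M) = 0 by rewrite defect_dual // defectM oppr0.
by case: (cotorsion_defect0_regular acyclicQop null_dop (cotorsion_dual tM) defect_dualM).
Qed.

Lemma tau_regular_tau M : tau_regular M -> tau_regular (tau M).
Proof.
move=> [tM cM]; split; first exact: torsion_tau null_d _ tM.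
move=> C nC; have [X iX] := exists_predual (tau (dual C)).
rewrite (dimhom_tau_inverse acyclicQ iX M); apply: cM; apply: tau_nilpotent_isom iX _.
exact/tau_nilpotent_tau.
Qed.

Lemma exists_tau_inverse Y : tau_regular Y -> exists X,
  [/\ tau_regular X, forall M, dimhom Y (tau M) = dimhom X M &
      forall y, euler y (dimvec Y) = - euler (dimvec X) y].
Proof.
move=> [tY /torsion_dual cY]; have [X iX] := exists_predual (tau (dual Y)).
exists X; split=> [|M|y]; last first.
- have := euler_tau_torsion acyclicQop cY y.
  by rewrite -(dimvec_isom iX) !dimvec_dual !euler_op.
- by rewrite (dimhom_tau_inverse acyclicQ iX).
split; last by apply/torsion_dual; apply: torsion_isom (isom_sym iX) _;
  apply: torsion_tau null_dop _ cY.
move=> B nB; have := euler_formula acyclicQop (dual Y) (dual B); have := euler_formula acyclicQ B Y.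
by rewrite -(dimhom_isomr _ iX) !dimvec_dual euler_op !dimhom_dual (dimhom_tau_torsion nB tY); lia.
Qed.

Definition sub_defect M (X : {vspace M}) : int :=
  euler d [ffun i => (\dim (idem M i @: X))%:Z].

Lemma sub_defectE M (X : {vspace M}) (sX : is_submod X) : sub_defect X = defect d (submod sX).
Proof.
congr (euler d _); apply/ffunP=> i; rewrite dimvecE ffunE /vertex_dim; congr Posz.
rewrite -(limg_dim_lker0 _ (mono_lker0 (sub_incl_mono sX))) -{1}(limg_sub_incl sX) -!limg_comp.
by congr (\dim _); apply: eq_in_limg => u _;
  rewrite [LHS]comp_lfunE [RHS]comp_lfunE (hom_idemE (sub_incl_hom sX)).
Qed.

Lemma sub_defect_ker_img M N (f : 'Hom(M, N)) (X : {vspace M}) : is_hom f -> is_submod X ->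
  sub_defect X = sub_defect (X :&: lker f)%VS + sub_defect (f @: X)%VS.
Proof.
move=> hf sX; rewrite /sub_defect -eulerDr; congr (euler d _); apply/ffunP=> i; rewrite !ffunE.
rewrite -PoszD -(limg_ker_dim f (idem M i @: X)); congr (Posz (_ + _)%N); congr (\dim _).
  apply/vspaceP=> w; rewrite memv_cap memv_ker; apply/andP/memv_imgP => [[]|[u]].
    case/memv_imgP=> u uX -> /eqP fu0; exists (idem M i u); last by rewrite idem_idem.
    by rewrite memv_cap memv_ker fu0 eqxx andbT submod_idem.
  rewrite memv_cap memv_ker => /andP[uX /eqP fu0] ->.
  by rewrite memv_img // (hom_idemE hf) fu0 linear0 eqxx.
by rewrite -!limg_comp; apply: eq_in_limg => u uX /=; rewrite !comp_lfunE (hom_idemE hf).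
Qed.

Lemma sub_defect_add_cap M (X Y : {vspace M}) : is_submod X -> is_submod Y ->
  sub_defect (X + Y)%VS + sub_defect (X :&: Y)%VS = sub_defect X + sub_defect Y.
Proof.
move=> sX sY; rewrite /sub_defect -!eulerDr; congr (euler d _); apply/ffunP=> i; rewrite !ffunE.
rewrite -!PoszD limgD.
have -> : (idem M i @: (X :&: Y) = idem M i @: X :&: idem M i @: Y)%VS.
  apply/vspaceP=> w; rewrite memv_cap; apply/memv_imgP/andP => [[u]|[]].
    by rewrite memv_cap => /andP[uX uY] ->; rewrite !memv_img.
  case/memv_imgP=> u uX -> /memv_imgP[v vY uv]; exists (idem M i u); last by rewrite idem_idem.
  by rewrite memv_cap submod_idem //= uv submod_idem.
by rewrite dimv_sum_cap.
Qed.

Lemma sub_defectf M : sub_defect (fullv : {vspace M}) = defect d M.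
Proof. by congr (euler d _); apply/ffunP=> i; rewrite !ffunE. Qed.

Definition regular_sub M (X : {vspace M}) : bool := is_submod X && (sub_defect X == 0).

Lemma regular_sub_submod M (X : {vspace M}) : regular_sub X -> is_submod X.
Proof. by case/andP. Qed.

Lemma regular_sub_defect M (X : {vspace M}) : regular_sub X -> sub_defect X = 0.
Proof. by case/andP=> _ /eqP. Qed.

Lemma regular_sub0 M : regular_sub (0%VS : {vspace M}).
Proof.
rewrite /regular_sub is_submod0 (sub_defectE (is_submod0 M)) defect_zero ?eqxx //.
exact/is_zero_submod.
Qed.

Section SubmodulesOfRegular.
Variable M : kQmodule k Q.
Hypothesis rM : tau_regular M.
Implicit Types U V : {vspace M}.

Lemma sub_defect_le0 U : is_submod U -> sub_defect U <= 0.
Proof.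
move=> sU; rewrite (sub_defectE sU); apply: (cotorsion_defect_le0 acyclicQ null_d).
exact: cotorsion_mono (sub_incl_mono sU) rM.2.
Qed.

Lemma regular_subf : regular_sub (fullv : {vspace M}).
Proof. by rewrite /regular_sub is_submodf sub_defectf tau_regular_defect. Qed.

Lemma tau_regular_submod U (sU : is_submod U) : regular_sub U -> tau_regular (submod sU).
Proof.
move/regular_sub_defect; rewrite (sub_defectE sU); apply: cotorsion_defect0_regular => //.
exact: cotorsion_mono (sub_incl_mono sU) rM.2.
Qed.

Lemma tau_regular_quomod U (sU : is_submod U) : regular_sub U -> tau_regular (quomod sU).
Proof.
move/regular_sub_defect; rewrite (sub_defectE sU) => defectU.
apply: torsion_defect0_regular; first exact: torsion_epi (quo_proj_epi sU) rM.1.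
have := defect_ses d (sub_quo_ses sU).
by rewrite defectU (tau_regular_defect acyclicQ null_d rM) add0r.
Qed.

Lemma regular_sub_cap U V : regular_sub U -> regular_sub V -> regular_sub (U :&: V)%VS.
Proof.
move=> /andP[sU /eqP dU] /andP[sV /eqP dV]; have := sub_defect_add_cap sU sV.
have := sub_defect_le0 (is_submod_add sU sV); have := sub_defect_le0 (is_submod_cap sU sV).
by rewrite /regular_sub dU dV is_submod_cap //=; lia.
Qed.

End SubmodulesOfRegular.

Lemma regular_sub_img_ker M N (f : 'Hom(M, N)) (X : {vspace M}) :
  tau_regular M -> tau_regular N -> is_hom f -> regular_sub X ->
  regular_sub (f @: X)%VS /\ regular_sub (X :&: lker f)%VS.
Proof.
move=> rM rN hf /andP[sX /eqP dX]; have := sub_defect_ker_img hf sX.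
have sI := is_submod_img hf sX; have sK := is_submod_cap sX (is_submod_ker hf).
have := sub_defect_le0 rN sI; have := sub_defect_le0 rM sK; rewrite /regular_sub sI sK dX /=.
by move=> *; split; lia.
Qed.

Lemma regular_sub_img M N (f : 'Hom(M, N)) (X : {vspace M}) :
  tau_regular M -> tau_regular N -> is_hom f -> regular_sub X -> regular_sub (f @: X)%VS.
Proof. by move=> rM rN hf rX; have [] := regular_sub_img_ker rM rN hf rX. Qed.

Lemma regular_sub_ker M N (f : 'Hom(M, N)) :
  tau_regular M -> tau_regular N -> is_hom f -> regular_sub (lker f).
Proof.
move=> rM rN hf; have [_] := regular_sub_img_ker rM rN hf (regular_subf rM).
by rewrite capfv.
Qed.

Lemma regular_sub_preim M N (f : 'Hom(M, N)) (Y : {vspace N}) :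
  tau_regular M -> tau_regular N -> is_hom f -> regular_sub Y -> regular_sub (f @^-1: Y)%VS.
Proof.
move=> rM rN hf rY; have sP := is_submod_preim hf (regular_sub_submod rY).
rewrite /regular_sub sP (sub_defect_ker_img hf sP) /=.
have -> : (f @^-1: Y :&: lker f = lker f)%VS.
  by apply/capv_idPr/subvP=> u; rewrite memv_ker -memv_preim => /eqP->; apply: mem0v.
have -> : (f @: (f @^-1: Y) = Y :&: limg f)%VS by rewrite -lpreim_cap_limg lpreimK // capvSr.
rewrite (regular_sub_defect (regular_sub_ker rM rN hf)) add0r.
apply/eqP/regular_sub_defect/regular_sub_cap => //; exact: regular_sub_img (regular_subf rM).
Qed.

Definition regular_simple T := [/\ tau_regular T, ~ is_zero T &
  forall X : {vspace T}, regular_sub X -> X = 0%VS \/ X = fullv].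

Lemma regular_simple_mono T N (f : 'Hom(T, N)) :
  regular_simple T -> tau_regular N -> is_hom f -> f != 0 -> is_mono f.
Proof.
move=> [rT _ simpleT] rN hf f0; rewrite /is_mono hf.
by case: (simpleT _ (regular_sub_ker rT rN hf)) => /eqP //; rewrite lker_full (negPf f0).
Qed.

Lemma regular_simple_epi T N (f : 'Hom(N, T)) :
  regular_simple T -> tau_regular N -> is_hom f -> f != 0 -> is_epi f.
Proof.
move=> [rT _ simpleT] rN hf f0; rewrite /is_epi hf.
by case: (simpleT _ (regular_sub_img rN rT hf (regular_subf rN))) => /eqP //;
  rewrite limg_eq0 (negPf f0).
Qed.

Lemma regular_simple_isom T T' :
  regular_simple T -> regular_simple T' -> (0 < dimhom T T')%N -> isom T T'.
Proof.
move=> sT sT' /dimhom_gt0P[f hf f0]; have [rT _ _] := sT; have [rT' _ _] := sT'.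
exact: isomI (regular_simple_mono sT rT' hf f0) (regular_simple_epi sT' rT hf f0).
Qed.

Lemma regular_simple_tau T : regular_simple T -> regular_simple (tau T).
Proof.
move=> sT; have [rT nz _] := sT; have rtT := tau_regular_tau rT.
have euler_tauT := euler_tau_torsion acyclicQ rT.1; split=> // [tauT0|Y rY].
  apply: nz; apply/is_zero_dimvec/(euler_left_nondeg acyclicQ) => y.
  by rewrite euler_tauT ((is_zero_dimvec (tau T)).1 tauT0) euler0r oppr0.
have sY := regular_sub_submod rY; case: (eqVneq Y 0%VS) => [->|Y0]; [by left|right].
have [X [rX homX eulerX]] := exists_tau_inverse (tau_regular_submod rtT sY rY).
have /dimhom_gt0P[f hf f0] : (0 < dimhom X T)%N.
  rewrite -homX; apply/dimhom_gt0P; exists (sub_incl sY); first exact: sub_incl_hom.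
  by apply: contraNneq Y0 => incl0; rewrite -(limg_sub_incl sY) incl0 lim0g.
have sK := is_submod_ker hf; have ses_f := ker_ses sK (regular_simple_epi sT rX hf f0).
have rK := tau_regular_submod rX sK (regular_sub_ker rX rT hf).
have dimvecY : dimvec (tau (submod sK)) + dimvec (tau T) = dimvec (submod sY).
  apply/eqP; rewrite -subr_eq0; apply/eqP/(euler_right_nondeg acyclicQ) => z.
  have := euler_tau_torsion acyclicQ rK.1 z; have := euler_tauT z; have := eulerX z.
  by rewrite (dimvec_ses ses_f) eulerDl eulerBr eulerDr; lia.
apply/eqP; rewrite eqEdim subvf -(dim_submod sY) !dim_sum_vertex_dim; apply: leq_sum => i _.
by move/ffunP/(_ i): dimvecY; rewrite [X in X = _]ffunE !dimvecE; lia.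
Qed.

End RegularCategory.

Section RegularSubDual.
Variables (k : fieldType) (Q : quiver).
Hypothesis acyclicQ : acyclic Q.
Variable d : {ffun vtx Q -> int}.
Hypothesis null_d : null_root d.
Variable M : kQmodule k Q.
Implicit Types (X : {vspace M}) (Z : {vspace dual M}).
Local Notation dual_sub_defect := (@sub_defect k (op_quiver Q) d (dual M)).
Local Notation dual_regular_sub := (@regular_sub k (op_quiver Q) d (dual M)).

Lemma limg_dual_quo_proj X (sX : is_submod X) :
  limg (dual_map (quo_proj X : 'Hom(M, quomod sX))) = annihilator X.
Proof.
apply/eqP; rewrite eqEdim; apply/andP; split.
  apply/subvP=> _ /memv_imgP[h _ ->]; apply/annihilatorP=> u uX.
  by rewrite dual_mapE; have /eqP-> : quo_proj X u == 0; rewrite ?quo_proj0 ?linear0.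
rewrite dim_limg_dual_map -(leq_add2r (\dim X)) dim_annihilator.
by rewrite -(limg_ker_dim (quo_proj X) fullv) capfv lker_quo_proj addnC.
Qed.

Lemma sub_defect_annihilator X :
  is_submod X -> dual_sub_defect (annihilator X) = sub_defect d X - defect d M.
Proof.
move=> sX; have mono_dual : is_mono (dual_map (quo_proj X : 'Hom(M, quomod sX))).
  by rewrite is_mono_dual quo_proj_epi.
have sI := is_submod_limg (mono_hom mono_dual); rewrite -(limg_dual_quo_proj sX).
rewrite (sub_defectE (Q := op_quiver Q) d sI).
rewrite -(defect_isom (Q := op_quiver Q) d (mono_isom_img sI mono_dual)) defect_dual //.
by rewrite (defect_ses d (sub_quo_ses sX)) (sub_defectE d sX); lia.
Qed.

Lemma regular_sub_annihilator X :
  tau_regular M -> regular_sub d X -> dual_regular_sub (annihilator X).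
Proof.
move=> rM /andP[sX /eqP dX]; rewrite /regular_sub is_submod_annihilator //.
by rewrite sub_defect_annihilator // dX (tau_regular_defect acyclicQ null_d rM) subr0 eqxx.
Qed.

Lemma regular_sub_zero_locus Z :
  tau_regular M -> dual_regular_sub Z -> regular_sub d (zero_locus Z).
Proof.
move=> rM /andP[sZ /eqP dZ]; have sL := is_submod_zero_locus sZ.
have := sub_defect_annihilator sL; rewrite zero_locusK dZ (tau_regular_defect acyclicQ null_d rM).
by rewrite subr0 /regular_sub sL => <-.
Qed.

End RegularSubDual.

(** * Uniserial modules *)

Section Uniserial.
Variables (k : fieldType) (Q : quiver).
Variable d : {ffun vtx Q -> int}.
Implicit Types L M N R T X Y Z : kQmodule k Q.
Local Notation regular_sub := (regular_sub d).
Local Notation regular_simple := (regular_simple d).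

Definition uniserial M :=
  forall X Y : {vspace M}, regular_sub X -> regular_sub Y -> (X <= Y)%VS || (Y <= X)%VS.

Definition uniserial_below M (A : {vspace M}) := forall X Y : {vspace M},
  regular_sub X -> regular_sub Y -> (X <= A)%VS -> (Y <= A)%VS -> (X <= Y)%VS || (Y <= X)%VS.

Definition uniserial_above M (B : {vspace M}) := forall X Y : {vspace M},
  regular_sub X -> regular_sub Y -> (B <= X)%VS -> (B <= Y)%VS -> (X <= Y)%VS || (Y <= X)%VS.

Definition minimal_regular_sub M (S : {vspace M}) := [/\ regular_sub S, S != 0%VS &
  forall Z : {vspace M}, regular_sub Z -> (Z <= S)%VS -> Z = 0%VS \/ Z = S].

Definition maximal_regular_sub M (S : {vspace M}) := [/\ regular_sub S, S != fullv &
  forall Z : {vspace M}, regular_sub Z -> (S <= Z)%VS -> Z = S \/ Z = fullv].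

Definition least_regular_sub M (S : {vspace M}) := [/\ regular_sub S, S != 0%VS &
  forall Z : {vspace M}, regular_sub Z -> Z != 0%VS -> (S <= Z)%VS].

Definition greatest_regular_sub M (S : {vspace M}) := [/\ regular_sub S, S != fullv &
  forall Z : {vspace M}, regular_sub Z -> Z != fullv -> (Z <= S)%VS].

Lemma least_minimal M (S : {vspace M}) : least_regular_sub S -> minimal_regular_sub S.
Proof.
move=> [rS S0 least]; split=> // Z rZ ZS; have [->|Z0] := eqVneq Z 0%VS; [by left|right].
by apply/eqP; rewrite eqEsubv ZS least.
Qed.

Lemma uniserial_below_minimal M (S : {vspace M}) : minimal_regular_sub S -> uniserial_below S.
Proof.
by move=> [_ _ minS] X Y rX _ XS YS; case: (minS X rX XS) => ->; rewrite ?sub0v // YS orbT.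
Qed.

Lemma uniserial_above_maximal M (S : {vspace M}) : maximal_regular_sub S -> uniserial_above S.
Proof.
by move=> [_ _ maxS] X Y rX _ SX SY; case: (maxS X rX SX) => ->; rewrite ?SY // subvf orbT.
Qed.

Lemma exists_minimal_regular_sub M (X : {vspace M}) : regular_sub X -> X != 0%VS ->
  exists2 S, minimal_regular_sub S & (S <= X)%VS.
Proof.
move=> rX X0; have [S [rS S0 SX] minS] := exists_minimizer (fun S : {vspace M} => \dim S)
  (P := fun S => [/\ regular_sub S, S != 0%VS & (S <= X)%VS])
  (ex_intro _ X (And3 rX X0 (subvv X))).
exists S => //; split=> // Z rZ ZS; have [->|Z0] := eqVneq Z 0%VS; [by left|right].
by apply/eqP; rewrite eqEdim ZS minS //; split=> //; apply: subv_trans ZS SX.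
Qed.

Lemma exists_maximal_regular_sub M (X : {vspace M}) : regular_sub X -> X != fullv ->
  exists2 S, maximal_regular_sub S & (X <= S)%VS.
Proof.
move=> rX X1; have [S [rS S1 XS] maxS] := exists_maximizer (f := fun S : {vspace M} => \dim S)
  (P := fun S => [/\ regular_sub S, S != fullv & (X <= S)%VS])
  (ex_intro _ X (And3 rX X1 (subvv X))) (fun S _ => dimvS (subvf S)).
exists S => //; split=> // Z rZ SZ; have [->|Z1] := eqVneq Z fullv; [by right|left].
by apply/esym/eqP; rewrite eqEdim SZ maxS //; split=> //; apply: subv_trans XS SZ.
Qed.

Hypothesis acyclicQ : acyclic Q.
Hypothesis null_d : null_root d.

Lemma minimal_regular_simple M (S : {vspace M}) (sS : is_submod S) :
  tau_regular M -> minimal_regular_sub S -> regular_simple (submod sS).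
Proof.
move=> rM [rS S0 minS]; have rSm := tau_regular_submod acyclicQ null_d rM sS rS.
split=> // [/is_zero_submod/eqP|X rX]; first by rewrite (negPf S0).
have ker0 : lker (sub_incl sS) == 0%VS by rewrite (mono_lker0 (sub_incl_mono sS)).
have XS : (sub_incl sS @: X <= S)%VS by rewrite -[X in (_ <= X)%VS](limg_sub_incl sS) limgS ?subvf.
have rI := regular_sub_img acyclicQ null_d rSm rM (sub_incl_hom sS) rX.
case: (minS _ rI XS) => imgX; [left|right]; apply/eqP; rewrite -(eq_limg_ker0 _ _ ker0) imgX.
  by rewrite limg0.
by rewrite limg_sub_incl.
Qed.

Lemma maximal_regular_simple M (S : {vspace M}) (sS : is_submod S) :
  tau_regular M -> maximal_regular_sub S -> regular_simple (quomod sS).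
Proof.
move=> rM [rS S1 maxS]; have rQ := tau_regular_quomod acyclicQ null_d rM sS rS.
split=> // [/is_zero_quomod/eqP|X rX]; first by rewrite (negPf S1).
have XE : X = (quo_proj S @: (quo_proj S @^-1: X))%VS by rewrite lpreimK // limg_quo_proj subvf.
have rP := regular_sub_preim acyclicQ null_d rM rQ (quo_proj_hom sS) rX.
have SP : (S <= quo_proj S @^-1: X)%VS by rewrite -[X in (X <= _)%VS]lker_quo_proj -lpreim0 lpreimS
  ?sub0v.
case: (maxS _ rP SP) => preimX; [left|right]; rewrite XE preimX ?limg_quo_proj //.
by apply/eqP; rewrite -lkerE lker_quo_proj.
Qed.

Lemma uniserial_quomod M (B : {vspace M}) (sB : is_submod B) :
  tau_regular M -> regular_sub B -> uniserial (quomod sB) -> uniserial_above B.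
Proof.
move=> rM rB chain X Y rX rY BX BY; have rQ := tau_regular_quomod acyclicQ null_d rM sB rB.
have rimg U := regular_sub_img acyclicQ null_d rM rQ (quo_proj_hom sB) (X := U).
by have := chain _ _ (rimg X rX) (rimg Y rY); rewrite !limg_quo_projS.
Qed.

Lemma uniserial_above_least M (S : {vspace M}) :
  least_regular_sub S -> uniserial_above S -> uniserial M.
Proof.
move=> [_ _ least] chain X Y rX rY; have [->|X0] := eqVneq X 0%VS; first by rewrite sub0v.
by have [->|Y0] := eqVneq Y 0%VS; [rewrite sub0v orbT | apply: chain => //; apply: least].
Qed.

Lemma dimhom_quo_le N X Y Z (f : 'Hom(X, Y)) (g : 'Hom(Y, Z)) : is_ses f g ->
  (dimhom N Z + dimhom N X <= dimhom N Y + dimhom X (tau N))%N.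
Proof.
move=> fg; have := euler_formula acyclicQ N X; have := euler_formula acyclicQ N Y.
have := euler_formula acyclicQ N Z; rewrite (dimvec_ses fg) eulerDr; have [_ eg _] := fg.
by have := dimhom_epi (tau N) eg; lia.
Qed.

Section SimpleSocle.
Variables (R : kQmodule k Q) (S : {vspace R}) (sS : is_submod S).
Hypotheses (rR : tau_regular R) (least : least_regular_sub S).

Lemma simple_maps_to_socle T (f : 'Hom(T, R)) :
  regular_simple T -> is_hom f -> (limg f <= S)%VS.
Proof.
move=> simT hf; have [rT _ onlyT] := simT; have [rS S0 leS] := least.
have [->|f0] := eqVneq f 0; first by rewrite lim0g sub0v.
have rI := regular_sub_img acyclicQ null_d rT rR hf (regular_subf acyclicQ null_d rT).
have SI : (S <= limg f)%VS by apply: leS; rewrite ?limg_eq0.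
case: (onlyT _ (regular_sub_preim acyclicQ null_d rT rR hf rS)) => preimS.
  by case/eqP: S0; rewrite -(lpreimK SI) preimS limg0.
by rewrite -preimS lpreimK.
Qed.

Lemma dimhom_quo_socle T :
  regular_simple T -> (dimhom T (quomod sS) <= dimhom (submod sS) (tau T))%N.
Proof.
move=> simT; have ses := sub_quo_ses sS; have := dimhom_quo_le T ses.
rewrite (dimhom_postcomp T ses); have -> : (postcomp T (quo_proj S) @: homs T R = 0)%VS.
  apply/eqP; rewrite -subv0; apply/subvP=> _ /memv_imgP[f + ->].
  rewrite mem_homs memv0 => /(simple_maps_to_socle simT)/subvP fS.
  apply/eqP/lfunP=> u; rewrite postcompE comp_lfunE zero_lfunE; apply/eqP.
  by rewrite quo_proj0 fS // memv_img ?memvf.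
by rewrite dimv0 addn0 addnC leq_add2l.
Qed.

(* Two distinct minimal submodules A and B of R / S would both be isomorphic  *)
(* to tau^-1 S, so that dim Hom(A, R / S) >= 2 dim End A.                     *)
Lemma minimal_quo_socle_unique (A B : {vspace quomod sS}) :
  minimal_regular_sub A -> minimal_regular_sub B -> A = B.
Proof.
move=> minA minB; have [rS _ _] := least; apply: contrapT => AB.
have rQ := tau_regular_quomod acyclicQ null_d rR sS rS.
have [rA A0 leA] := minA; have [rB B0 leB] := minB.
have [sA sB] := (regular_sub_submod rA, regular_sub_submod rB).
have AB0 : (A :&: B = 0)%VS.
  have rAB := regular_sub_cap acyclicQ null_d rQ rA rB.
  case: (leA _ rAB (capvSl _ _)) => // capA; case: (leB _ rAB (capvSr _ _)) => // capB.
  by case: AB; rewrite -capA.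
have simS := minimal_regular_simple sS rR (least_minimal least).
have iso_tau (Z : {vspace quomod sS}) (sZ : is_submod Z) :
    Z != 0%VS -> regular_simple (submod sZ) -> isom (submod sS) (tau (submod sZ)).
  move=> Z0 simZ; have sim_tauZ := regular_simple_tau acyclicQ null_d simZ.
  apply: (regular_simple_isom acyclicQ null_d simS sim_tauZ).
    apply: leq_trans (dimhom_quo_socle simZ); apply/dimhom_gt0P; exists (sub_incl sZ).
    exact: sub_incl_hom.
  by rewrite -limg_eq0 limg_sub_incl.
have simA := minimal_regular_simple sA rQ minA; have simB := minimal_regular_simple sB rQ minB.
have [[tA _] nzA _] := simA; have iA := iso_tau A sA A0 simA; have iB := iso_tau B sB B0 simB.
have iAB : isom (submod sA) (submod sB).
  apply: (regular_simple_isom acyclicQ null_d simA simB).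
  rewrite -(dimhom_tau_tau_torsion acyclicQ _ tA) -(dimhom_isoml _ iA) -(dimhom_isomr _ iB).
  by apply: dimhom_self_gt0; case: simS.
have := dimhom_mono (submod sA) (internal_sum_mono sA sB AB0).
rewrite dimhom_dsumr -(dimhom_isomr _ iAB).
have := dimhom_quo_socle simA; rewrite (dimhom_isoml _ iA) dimhom_tau_tau_torsion //.
by have := dimhom_self_gt0 nzA; lia.
Qed.

End SimpleSocle.

Lemma uniserial_of_least_sub R (S : {vspace R}) :
  tau_regular R -> least_regular_sub S -> uniserial R.
Proof.
have [n] := ubnP (\dim {:R}); elim: n R S => // n IH R S dimR rR least.
have [rS S0 _] := least; have sS := regular_sub_submod rS.
have rQ := tau_regular_quomod acyclicQ null_d rR sS rS.
apply: (uniserial_above_least least); apply: (@uniserial_quomod _ _ sS) => //.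
have [Q0|Q0] := eqVneq (fullv : {vspace quomod sS}) 0%VS.
  by move=> X Y _ _; have := subvf X; rewrite Q0 subv0 => /eqP->; rewrite sub0v.
have [A minA _] := exists_minimal_regular_sub (regular_subf acyclicQ null_d rQ) Q0.
apply: (IH (quomod sS) A) => //.
  by have := dimvS (subvf S); move: S0 dimR; rewrite (dim_quomod sS) -dimv_eq0; lia.
have [rA A0 _] := minA; split=> // Z rZ Z0; have [B minB BZ] := exists_minimal_regular_sub rZ Z0.
by rewrite (minimal_quo_socle_unique rR least minA minB).
Qed.

End Uniserial.

Section UniserialDual.
Variables (k : fieldType) (Q : quiver).
Hypothesis acyclicQ : acyclic Q.
Variable d : {ffun vtx Q -> int}.
Hypothesis null_d : null_root d.
Variable M : kQmodule k Q.
Hypothesis rM : tau_regular M.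
Implicit Types (A S : {vspace M}) (Z : {vspace dual M}).

Let rs_annihilator A := @regular_sub_annihilator _ _ acyclicQ d null_d M A rM.
Let rs_zero_locus Z := @regular_sub_zero_locus _ _ acyclicQ d null_d M Z rM.

Lemma uniserial_dual : uniserial (Q := op_quiver Q) d (dual M) -> uniserial d M.
Proof.
move=> chain X Y /rs_annihilator rX /rs_annihilator rY.
by have := chain _ _ rX rY; rewrite !annihilatorS orbC.
Qed.

Lemma uniserial_below_annihilator A :
  uniserial_above d A -> uniserial_below (Q := op_quiver Q) d (M := dual M) (annihilator A).
Proof.
move=> chain X Y rX rY; rewrite -(zero_locusK X) -(zero_locusK Y) !annihilatorS => AX AY.
by rewrite orbC chain // rs_zero_locus.
Qed.

Lemma uniserial_below_zero_locus Z :
  uniserial_above (Q := op_quiver Q) d (M := dual M) Z -> uniserial_below d (zero_locus Z).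
Proof.
move=> chain X Y rX rY XZ YZ; have := chain _ _ (rs_annihilator rX) (rs_annihilator rY).
by rewrite -{1 2}(zero_locusK Z) !annihilatorS orbC; apply.
Qed.

Lemma uniserial_of_greatest_sub S : greatest_regular_sub d S -> uniserial d M.
Proof.
move=> [rS S1 greatest]; apply: uniserial_dual.
suff least : least_regular_sub (Q := op_quiver Q) d (M := dual M) (annihilator S).
  exact: (uniserial_of_least_sub (acyclic_op acyclicQ) (null_root_op null_d) (tau_regular_dual rM)
    least).
split; first exact: rs_annihilator.
  by apply: contraNneq S1 => annS; rewrite -(annihilatorK S) annS -annihilatorf annihilatorK.
move=> Z rZ Z0; rewrite -(zero_locusK Z) annihilatorS greatest ?rs_zero_locus //.
by apply: contraNneq Z0 => locusZ; rewrite -(zero_locusK Z) locusZ annihilatorf.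
Qed.

End UniserialDual.

Section IndecomposableRegular.
Variables (k : fieldType) (Q : quiver).
Hypothesis acyclicQ : acyclic Q.
Variable d : {ffun vtx Q -> int}.
Hypothesis null_d : null_root d.
Variable R : kQmodule k Q.
Hypotheses (rR : tau_regular R) (indecR : indecomposable R).
Implicit Types A B : {vspace R}.

Lemma uniserial_above_complement A B :
  regular_sub d A -> A != 0%VS -> uniserial_below d A -> regular_sub d B -> (B :&: A = 0)%VS ->
  (forall Z, regular_sub d Z -> (Z :&: A = 0)%VS -> (\dim Z <= \dim B)%N) -> uniserial_above d B.
Proof.
move=> rA A0 chain rB BA0 maxB; have sB := regular_sub_submod rB.
have rQ := tau_regular_quomod acyclicQ null_d rR sB rB.
have [S [rS S0 minS] SA] := exists_minimal_regular_sub rA A0.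
have leS Z : regular_sub d Z -> (Z <= A)%VS -> Z != 0%VS -> (S <= Z)%VS.
  move=> rZ ZA Z0; case/orP: (chain _ _ rS rZ SA ZA) => // ZS.
  by case: (minS _ rZ ZS) => ZE; [rewrite ZE eqxx in Z0 | rewrite ZE].
apply: (uniserial_quomod acyclicQ null_d (sB := sB) rR rB).
suff least : least_regular_sub d (M := quomod sB) (quo_proj B @: S)%VS.
  exact: (uniserial_of_least_sub acyclicQ null_d rQ least).
have rI := regular_sub_img acyclicQ null_d rR rQ (quo_proj_hom sB) rS.
split=> [||Z rZ Z0]; first exact: rI.
  rewrite -lkerE lker_quo_proj; apply: contraNN S0 => SB.
  by rewrite -subv0 -BA0 subv_cap SB SA.
have ZE : (quo_proj B @: (quo_proj B @^-1: Z) = Z)%VS by rewrite lpreimK // limg_quo_proj subvf.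
have rP := regular_sub_preim acyclicQ null_d rR rQ (quo_proj_hom sB) rZ.
rewrite -ZE limgS // (subv_trans _ (capvSl _ A)) // leS ?capvSr //.
  exact: (regular_sub_cap acyclicQ null_d rR rP rA).
apply: contraNneq Z0 => /(maxB _ rP) dimP; rewrite -ZE -lkerE lker_quo_proj.
have BP : (B <= quo_proj B @^-1: Z)%VS.
  by rewrite -[X in (X <= _)%VS]lker_quo_proj -lpreim0 lpreimS ?sub0v.
by have /eqP<- : B == (quo_proj B @^-1: Z)%VS; rewrite // eqEdim BP.
Qed.

Lemma uniserial_sub_full A :
  regular_sub d A -> A != 0%VS -> uniserial_below d A ->
  (forall B, regular_sub d B -> B != fullv -> uniserial_above d B ->
    (\dim {:R} - \dim B <= \dim A)%N) ->
  A = fullv.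
Proof.
move=> rA A0 chain bound.
have [B [rB BA0] maxB] := exists_maximizer (f := fun B => \dim B)
  (P := fun B => regular_sub d B /\ (B :&: A = 0)%VS)
  (ex_intro _ 0%VS (conj (regular_sub0 d R) (cap0v A))) (fun B _ => dimvS (subvf B)).
have aboveB : uniserial_above d B.
  by apply: (uniserial_above_complement rA A0 chain rB BA0) => Z rZ ZA0; apply: maxB.
have B1 : B != fullv by apply: contraNneq A0 => B1; rewrite -BA0 B1 capfv.
have BA : (B + A = fullv)%VS.
  apply/eqP; rewrite eqEdim subvf; have := dimv_sum_cap B A; rewrite BA0 dimv0.
  by have := bound B rB B1 aboveB; lia.
have [sA sB] := (regular_sub_submod rA, regular_sub_submod rB).
case: (indecomposable_no_complement indecR sB sA BA0 BA) => [B0|A_eq0];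
  first by rewrite -BA B0 add0v.
by rewrite A_eq0 eqxx in A0.
Qed.

End IndecomposableRegular.

Lemma indecomposable_uniserial (k : fieldType) (Q : quiver) (d : {ffun vtx Q -> int})
    (R : kQmodule k Q) :
  acyclic Q -> null_root d -> tau_regular R -> indecomposable R -> uniserial d R.
Proof.
move=> acyclicQ null_d rR indecR; have [nzR _] := indecR.
have R0 : (fullv : {vspace R}) != 0%VS by apply/eqP=> R0; apply: nzR; rewrite /is_zero R0 dimv0.
have [S minS _] := exists_minimal_regular_sub (regular_subf acyclicQ null_d rR) R0.
have := exists_maximal_regular_sub (regular_sub0 d R); rewrite eq_sym => /(_ R0)[S' maxS _].
have [[rS S0 _] [rS' S'1 _]] := (minS, maxS).
have belowS := uniserial_below_minimal minS; have aboveS' := uniserial_above_maximal maxS.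
have [A [rA A0 belowA] maxA] := exists_maximizer (f := fun A : {vspace R} => \dim A)
  (P := fun A => [/\ regular_sub d A, A != 0%VS & uniserial_below d A])
  (ex_intro _ S (And3 rS S0 belowS)) (fun A _ => dimvS (subvf A)).
have [B [rB B1 aboveB] maxB] := exists_maximizer (f := fun B : {vspace R} => (\dim {:R} - \dim B)%N)
  (P := fun B => [/\ regular_sub d B, B != fullv & uniserial_above d B])
  (ex_intro _ S' (And3 rS' S'1 aboveS')) (fun B _ => leq_subr (\dim B) (\dim {:R})).
have [codimB_le|codimB_gt] := leqP (\dim {:R} - \dim B) (\dim A).
  have A1 : A = fullv.
    apply: (uniserial_sub_full acyclicQ null_d rR indecR rA A0 belowA) => Z rZ Z1 aboveZ.
    exact: leq_trans (maxB Z (And3 rZ Z1 aboveZ)) codimB_le.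
  by move=> X Y rX rY; apply: belowA; rewrite ?A1 ?subvf.
have annB1 : annihilator B = fullv.
  apply: (uniserial_sub_full (acyclic_op acyclicQ) (null_root_op null_d) (tau_regular_dual rR)
    (indecomposable_dual indecR) (regular_sub_annihilator acyclicQ null_d rR rB)).
  - by apply: contraNneq B1 => annB; rewrite -(annihilatorK B) annB -annihilatorf annihilatorK.
  - exact: (uniserial_below_annihilator acyclicQ null_d rR aboveB).
  move=> Z rZ Z1 aboveZ.
  have -> : \dim (annihilator B) = (\dim {:R} - \dim B)%N by rewrite -(dim_annihilator B) addnK.
  have -> : (\dim {:dual R} - \dim Z = \dim (zero_locus Z))%N.
    by rewrite dim_dual -(dim_zero_locus Z) addnK.
  apply: leq_trans (ltnW codimB_gt); apply: maxA; split.
  - exact: (regular_sub_zero_locus acyclicQ null_d rR rZ).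
  - by apply: contraNneq Z1 => locusZ; rewrite -(zero_locusK Z) locusZ annihilator0.
  exact: (uniserial_below_zero_locus acyclicQ null_d rR aboveZ).
have B0 : B = 0%VS by rewrite -(annihilatorK B) annB1 -annihilator0 annihilatorK.
by move=> X Y rX rY; apply: aboveB; rewrite ?B0 ?sub0v.
Qed.

(** * Preprojective modules of defect -1 *)

Section DivisionSubalgebra.
Variables (k : fieldType) (U : vectType k).
Implicit Types (D : {vspace 'End(U)}) (X Y : {vspace U}).

Definition division_subalgebra D :=
  [/\ \1%VF \in D, forall f g, f \in D -> g \in D -> (f \o g)%VF \in D &
      forall f, f \in D -> f != 0 -> lker f == 0%VS].

Definition stable_under D X := forall f u, f \in D -> u \in X -> f u \in X.

Definition eval_at u : 'Hom('End(U), U) := linfun (fun f : 'End(U) => f u).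

Lemma eval_atE u f : eval_at u f = f u.
Proof. by rewrite linfunE // => c g h; rewrite add_lfunE scale_lfunE. Qed.

Variable D : {vspace 'End(U)}.
Hypothesis divD : division_subalgebra D.

Lemma dim_division_orbit u : u != 0 -> \dim (eval_at u @: D) = \dim D.
Proof.
case: divD => _ _ injD u0; apply: limg_dim_in => f fD; rewrite eval_atE => fu0.
by apply: contraNeq u0 => f0; apply/eqP; have /lker_eq0P := injD f fD f0; apply.
Qed.

Lemma stable_division_orbit u : stable_under D (eval_at u @: D).
Proof.
case: divD => _ mulD _ f _ fD /memv_imgP[g gD ->]; apply/memv_imgP.
by exists (f \o g)%VF; rewrite ?mulD // !eval_atE comp_lfunE.
Qed.

Lemma division_orbit_disjoint Y u :
  stable_under D Y -> u \notin Y -> (Y :&: (eval_at u @: D) = 0)%VS.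
Proof.
case: divD => _ _ injD stableY uY; apply/eqP; rewrite -subv0; apply/subvP=> w.
rewrite memv_cap memv0 => /andP[+ /memv_imgP[f fD wE]]; rewrite wE eval_atE => fuY.
apply: contraNT uY => fu0; have f0 : f != 0 by apply: contraNneq fu0 => ->; rewrite zero_lfunE.
have inj_f := injD f fD f0; have /lker0P fI := inj_f; have fY : (f @: Y)%VS = Y.
  apply/eqP; rewrite eqEdim limg_dim_lker0 // leqnn andbT.
  by apply/subvP=> _ /memv_imgP[y yY ->]; apply: stableY.
by move: fuY; rewrite -{1}fY => /memv_imgP[y yY /fI->].
Qed.

Lemma division_subalgebra_dvd X : stable_under D X -> (\dim D %| \dim X)%N.
Proof.
case: divD => oneD _ _ stableX.
have [||Y [YX stableY dvdY] maxY] := @exists_maximizer _ (fun Y : {vspace U} => \dim Y)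
  (fun Y => [/\ (Y <= X)%VS, stable_under D Y & (\dim D %| \dim Y)%N]) (\dim X).
- exists 0%VS; rewrite dimv0 dvdn0 sub0v; split=> // f u _.
  by rewrite memv0 => /eqP->; rewrite linear0 mem0v.
- by move=> Y [YX _ _]; apply: dimvS.
suff /eqP<- : Y == X by [].
rewrite eqEsubv YX /=; apply/subvP=> u uX; apply: contraT => uY.
have u0 : u != 0 by apply: contraNneq uY => ->; apply: mem0v.
have capY := division_orbit_disjoint stableY uY; have stable_u := @stable_division_orbit u.
have : (\dim (Y + eval_at u @: D) <= \dim Y)%N.
  apply: maxY; split=> [|f w fD|].
  - rewrite subv_add YX; apply/subvP=> _ /memv_imgP[f fD ->].
    by rewrite eval_atE stableX.
  - by case/memv_addP=> y yY [v vu ->]; rewrite linearD memv_add ?stableY //; apply: stable_u.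
  by rewrite dimv_disjoint_sum // dim_division_orbit // dvdn_addl.
rewrite dimv_disjoint_sum // -[X in (_ <= X)%N]addn0 leq_add2l leqn0 dimv_eq0 => /eqP orbit0.
have : u \in (eval_at u @: D)%VS by apply/memv_imgP; exists \1%VF; rewrite ?eval_atE ?id_lfunE.
by rewrite orbit0 memv0 (negPf u0).
Qed.

End DivisionSubalgebra.

Section DefectOne.
Variables (k : fieldType) (Q : quiver).
Hypothesis acyclicQ : acyclic Q.
Variable d : {ffun vtx Q -> int}.
Hypothesis null_d : null_root d.
Implicit Types A B E L M N P X Y Z : kQmodule k Q.
Local Notation defect := (defect d).

Lemma dvdz_euler (n : nat) (x y : {ffun vtx Q -> int}) :
  (forall i, (n%:Z %| y i)%Z) -> (n%:Z %| euler x y)%Z.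
Proof. by move=> dvd; apply: rpredB; apply: rpred_sum => i _; apply: dvdz_mull. Qed.

Lemma dvdz_sub_defect M (D : {vspace 'End(M)}) (X : {vspace M}) :
  division_subalgebra D -> (forall f, f \in D -> is_hom f) -> stable_under D X ->
  ((\dim D)%:Z %| sub_defect d X)%Z.
Proof.
move=> divD homD stableX; apply: dvdz_euler => i; rewrite ffunE.
apply: (division_subalgebra_dvd divD) => f _ fD /memv_imgP[u uX ->].
by rewrite (hom_idemE (homD f fD)) memv_img ?stableX.
Qed.

Lemma division_subalgebra_homs M :
  (forall f : 'End(M), is_hom f -> f != 0 -> is_mono f) -> division_subalgebra (homs M M).
Proof.
move=> mono_M; split=> [|f g|f]; rewrite !mem_homs; first exact: is_hom_id.
  by move=> hf hg; apply: is_hom_comp hg hf.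
by move=> hf f0; apply/mono_lker0/mono_M.
Qed.

Lemma nonsplit_ses_dimhom_lt X Y Z (f : 'Hom(X, Y)) (g : 'Hom(Y, Z)) : is_ses f g ->
  (forall r : 'Hom(Y, X), is_hom r -> ~ cancel f r) ->
  (dimhom Y Y < dimhom (dsum Z X) (dsum Z X))%N.
Proof.
move=> fg nonsplit; have [mf _ _] := fg; rewrite dimhom_dsumr !dimhom_dsuml.
have := dimhom_sesr Y fg; have := dimhom_sesl Z fg; rewrite (dimhom_precomp X fg).
suff : (\dim (precomp X f @: homs Y X) < dimhom X X)%N by lia.
have sub : (precomp X f @: homs Y X <= homs X X)%VS.
  apply/subvP=> _ /memv_imgP[r + ->]; rewrite precompE !mem_homs => hr.
  exact: is_hom_comp (mono_hom mf) hr.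
rewrite ltn_neqAle dimvS // andbT; apply/negP=> full.
have : \1%VF \in (precomp X f @: homs Y X)%VS.
  by have /eqP-> : (precomp X f @: homs Y X == homs X X)%VS;
    rewrite ?eqEdim ?sub ?(eqP full) ?mem_homs ?is_hom_id /=.
case/memv_imgP=> r; rewrite mem_homs precompE => hr /lfunP rf1; apply: (nonsplit r hr) => u.
by have := rf1 u; rewrite comp_lfunE id_lfunE.
Qed.

Lemma dimhom_tau_nilpotent_torsion M N : tau_nilpotent M -> torsion N ->
  (dimhom M N)%:Z = euler (dimvec M) (dimvec N).
Proof. by move=> nM tN; rewrite -(euler_formula acyclicQ) (dimhom_tau_torsion nM tN) subr0. Qed.

(* Taken from a module of dimension vector x with dim End minimal.            *)
Lemma exists_ext_orthogonal_decomposition (x : {ffun vtx Q -> int}) : (forall i, 0 <= x i) ->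
  exists A B, [/\ torsion A, tau_nilpotent B, dimvec A + dimvec B = x & dimhom B (tau A) = 0%N].
Proof.
move=> x_ge0; have [M dimM minM] := exists_minimizer (fun M => dimhom M M)
  (P := fun M : kQmodule k Q => dimvec M = x) (exists_module k x_ge0).
have [A [B [tA nB iM]]] := torsion_decomposition acyclicQ M.
have dimAB : dimvec A + dimvec B = x by rewrite -dimM -(dimvec_isom iM) (dimvec_ses (dsum_ses A B)).
exists A, B; split=> //; apply/eqP; rewrite -leqn0 leqNgt; apply/negP.
case/(exists_nonsplit_ses acyclicQ)=> E [f [g [fg nonsplit]]].
have /minM : dimvec E = x by rewrite (dimvec_ses fg) addrC.
rewrite -(dimhom_isoml _ iM) -(dimhom_isomr _ iM) leqNgt.
have := nonsplit_ses_dimhom_lt fg nonsplit.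
by rewrite !dimhom_dsumr !dimhom_dsuml => ->.
Qed.

Lemma exists_tau_nilpotent (x : {ffun vtx Q -> int}) :
  (forall i, 0 <= x i) -> euler x x = 1 -> euler d x = -1 ->
  exists2 L : kQmodule k Q, tau_nilpotent L & dimvec L = x.
Proof.
move=> x_ge0 tits1 defect_m1; have [_ antisym semipos radical] := null_d.
have [A [B [tA nB dimAB ext0]]] := exists_ext_orthogonal_decomposition x_ge0.
have eulerAB : euler (dimvec A) (dimvec B) = 0.
  by rewrite -(euler_formula acyclicQ) ext0 (tA B nB) subrr.
move: tits1 defect_m1; rewrite -dimAB eulerDl !eulerDr eulerAB.
rewrite -(dimhom_tau_nilpotent_torsion nB tA) => tits1 defect_m1.
have defectA : 0 <= euler d (dimvec A) := torsion_defect_ge0 acyclicQ null_d tA.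
have titsB : euler (dimvec B) (dimvec B) <> 0.
  move/radical=> [t dimB]; move: defect_m1; rewrite dimB eulerMzr null_root_isotropic // mul0rz.
  by rewrite addr0; lia.
have [titsA homBA] : euler (dimvec A) (dimvec A) = 0 /\ dimhom B A = 0%N.
  by have := semipos (dimvec A); have := semipos (dimvec B); lia.
have [t dimA] := radical _ titsA; have t0 : t = 0.
  have := dimhom_tau_nilpotent_torsion nB tA; rewrite homBA dimA eulerMzr mulrzz.
  move=> /esym/eqP; rewrite mulf_eq0 => /orP[/eqP eulerBd|/eqP//].
  by move: defect_m1; rewrite antisym [euler d _]antisym eulerBd dimA eulerMzl null_root_isotropic
    // mul0rz.
by exists B; rewrite // dimA t0 mulr0z add0r.
Qed.

Lemma defect_m1_mono M N (f : 'Hom(M, N)) :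
  tau_nilpotent M -> tau_nilpotent N -> defect M = -1 -> is_hom f -> f != 0 -> is_mono f.
Proof.
move=> nM nN defectM hf f0; have sK := is_submod_ker hf; have sI := is_submod_limg hf.
have := sub_defect_ker_img d hf (is_submodf M).
rewrite sub_defectf capfv (sub_defectE d sK) (sub_defectE d sI) defectM.
have nzI : ~ is_zero (submod sI) by move/is_zero_submod/eqP; rewrite limg_eq0 (negPf f0).
have := tau_nilpotent_defect_lt0 acyclicQ null_d (tau_nilpotent_submod sI nN) nzI.
have nK := tau_nilpotent_submod sK nM; have := tau_nilpotent_defect_le0 acyclicQ null_d nK => *.
rewrite /is_mono hf; apply/eqP/(is_zero_submod sK)/(tau_nilpotent_defect0 acyclicQ null_d nK).
by lia.
Qed.

Lemma defect_m1_nonzero P : defect P = -1 -> ~ is_zero P.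
Proof. by move=> defectP /(defect_zero d); rewrite defectP. Qed.

Lemma tau_nilpotent_mono_tau M (f : 'Hom(M, tau M)) : tau_nilpotent M -> is_mono f -> is_zero M.
Proof.
case=> n; elim: n M f => // n IH M f zero_n mf.
by apply: (is_zero_mono mf); apply: (IH _ (tau_map f)) (tau_map_mono mf); rewrite -iterSr.
Qed.

Lemma defect_m1_ext0 A B (f : 'Hom(A, B)) : tau_nilpotent A -> tau_nilpotent B ->
  defect A = -1 -> defect B = -1 -> is_mono f -> dimhom B (tau A) = 0%N.
Proof.
move=> nA nB defectA defectB mf; apply/dimhom_eq0P => g hg; apply: contrapT => /eqP g0.
have mg := defect_m1_mono nB ((tau_nilpotent_tau A).2 nA) defectB hg g0.
exact: defect_m1_nonzero defectA (tau_nilpotent_mono_tau nA (mono_comp mf mg)).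
Qed.

Section Preprojective.
Variable P : kQmodule k Q.
Hypotheses (nP : tau_nilpotent P) (defectP : defect P = -1).

Lemma dimhom_self_defect_m1 : dimhom P P = 1%N.
Proof.
have divP : division_subalgebra (homs P P).
  by apply: division_subalgebra_homs => f; apply: defect_m1_mono.
have stableP : stable_under (homs P P) fullv by move=> f u _ _; rewrite memvf.
have homP f : f \in homs P P -> is_hom f by rewrite mem_homs.
have := dvdz_sub_defect divP homP stableP; rewrite sub_defectf defectP dvdzE dvdn1.
exact: eqP.
Qed.

Lemma euler_self_defect_m1 : euler (dimvec P) (dimvec P) = 1.
Proof.
by rewrite -(euler_formula acyclicQ) dimhom_self_defect_m1 (defect_m1_ext0 nP nP _ _ (is_mono_id
  P)).
Qed.

Lemma exists_pencil_target :
  exists L, [/\ tau_nilpotent L, dimvec L = dimvec P + d & (2 <= dimhom P L)%N].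
Proof.
have [pos antisym _ _] := null_d; have defectPE : euler d (dimvec P) = -1 := defectP.
have eulerPd : euler (dimvec P) d = 1 by have := antisym (dimvec P); rewrite defectPE; lia.
have [||| L nL dimL] := @exists_tau_nilpotent (dimvec P + d).
- by move=> i; rewrite ffunE dimvecE addr_ge0 // ltW.
- rewrite eulerDl !eulerDr euler_self_defect_m1 eulerPd defectPE.
  by rewrite null_root_isotropic.
- by rewrite eulerDr null_root_isotropic // defectPE.
exists L; split=> //; have := euler_formula acyclicQ P L.
by rewrite dimL eulerDr euler_self_defect_m1 eulerPd; lia.
Qed.

End Preprojective.

End DefectOne.

(** * Powers of a module *)

Section PowerMap.
Variables (k : fieldType) (e : nat).
Implicit Types (U V : vectType k) (n : 'M[k]_e).

Definition power_map U V (f : 'Hom(U, V)) : 'Hom({ffun 'I_e -> U}, {ffun 'I_e -> V}) :=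
  linfun (fun x : {ffun 'I_e -> U} => [ffun j => f (x j)]).

Lemma power_mapE U V (f : 'Hom(U, V)) x j : power_map f x j = f (x j).
Proof. by rewrite linfunE ?ffunE // => c y z; apply/ffunP=> i; rewrite !ffunE linearP. Qed.

Definition matrix_action U n : 'End({ffun 'I_e -> U}) :=
  linfun (fun x : {ffun 'I_e -> U} => [ffun j => \sum_i n i j *: x i]).

Lemma matrix_actionE U n (x : {ffun 'I_e -> U}) j :
  matrix_action U n x j = \sum_i n i j *: x i.
Proof.
rewrite linfunE ?ffunE // => c y z; apply/ffunP=> i.
rewrite !ffunE scaler_sumr -big_split /=; apply: eq_bigr => l _.
by rewrite !ffunE scalerDr !scalerA mulrC.
Qed.

Lemma matrix_action_linear U : linear (@matrix_action U).
Proof.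
move=> c n n'; apply/lfunP=> x; apply/ffunP=> j; rewrite add_lfunE scale_lfunE !ffunE.
rewrite !matrix_actionE scaler_sumr -big_split /=; apply: eq_bigr => l _.
by rewrite !mxE scalerDl scalerA.
Qed.

Lemma matrix_action_comp U n n' :
  (matrix_action U n \o matrix_action U n')%VF = matrix_action U (n' *m n).
Proof.
apply/lfunP=> x; apply/ffunP=> j; rewrite comp_lfunE !matrix_actionE.
under eq_bigr do rewrite matrix_actionE scaler_sumr.
rewrite exchange_big /=; apply: eq_bigr => i _; rewrite mxE scaler_suml.
by apply: eq_bigr => l _; rewrite scalerA mulrC.
Qed.

Lemma matrix_action1 U : matrix_action U 1%:M = \1%VF.
Proof.
apply/lfunP=> x; apply/ffunP=> j; rewrite matrix_actionE id_lfunE (bigD1 j) //= big1 ?addr0.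
  by rewrite mxE eqxx scale1r.
by move=> i ij; rewrite mxE (negPf ij) scale0r.
Qed.

Lemma matrix_action0 U : matrix_action U 0 = 0.
Proof. by rewrite -(linfunE (@matrix_action_linear U)) linear0. Qed.

Lemma power_map_matrix_action U V (f : 'Hom(U, V)) n x :
  power_map f (matrix_action U n x) = matrix_action V n (power_map f x).
Proof.
apply/ffunP=> j; rewrite power_mapE !matrix_actionE linear_sum /=; apply: eq_bigr => i _.
by rewrite linearZ /= power_mapE.
Qed.

Definition power_inj U (i : 'I_e) : 'Hom(U, {ffun 'I_e -> U}) :=
  linfun (fun u : U => [ffun j => (j == i)%:R *: u] : {ffun 'I_e -> U}).

Lemma power_injE U i (u : U) j : power_inj U i u j = (j == i)%:R *: u.
Proof.
rewrite linfunE ?ffunE // => c y z; apply/ffunP=> l.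
by rewrite !ffunE scalerDr !scalerA mulrC.
Qed.

Lemma power_inj_sum U (x : {ffun 'I_e -> U}) : x = \sum_i power_inj U i (x i).
Proof.
apply/ffunP=> j; rewrite sum_ffunE (bigD1 j) //= big1 ?addr0.
  by rewrite power_injE eqxx scale1r.
by move=> i ij; rewrite power_injE eq_sym (negPf ij) scale0r.
Qed.

Lemma power_map_inj U V (f : 'Hom(U, V)) i u : power_map f (power_inj U i u) = power_inj V i (f u).
Proof. by apply/ffunP=> j; rewrite power_mapE !power_injE linearZ. Qed.

Lemma matrix_action_inj U n i (u : U) j : matrix_action U n (power_inj U i u) j = n i j *: u.
Proof.
rewrite matrix_actionE (bigD1 i) //= big1 ?addr0; first by rewrite power_injE eqxx scale1r.
by move=> l li; rewrite power_injE (negPf li) scale0r scaler0.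
Qed.

End PowerMap.

Section PowerModule.
Variables (k : fieldType) (Q : quiver).
Implicit Types L M N : kQmodule k Q.

Section Power.
Variables (e : nat) (M : kQmodule k Q).

Fact power_idemM i j : (power_map e (idem M i) \o power_map e (idem M j))%VF =
  if i == j then power_map e (idem M i) else 0.
Proof.
apply/lfunP=> x; apply/ffunP=> l; rewrite comp_lfunE !power_mapE idem_app.
by case: eqP => _; rewrite ?power_mapE // zero_lfunE ffunE.
Qed.

Fact power_idem_sum : \sum_i power_map e (idem M i) = \1%VF.
Proof.
apply/lfunP=> x; apply/ffunP=> l; rewrite sum_lfunE id_lfunE sum_ffunE.
by under eq_bigr do rewrite power_mapE; rewrite idem_sum_app.
Qed.

Fact power_arrow_ax a : power_map e (arrow M a) =
  (power_map e (idem M (tgt a)) \o power_map e (arrow M a) \o power_map e (idem M (src a)))%VF.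
Proof. by apply/lfunP=> x; apply/ffunP=> l; rewrite !comp_lfunE !power_mapE arrow_app. Qed.

Definition power : kQmodule k Q := KQModule power_idemM power_idem_sum power_arrow_ax.

Lemma idem_power i (x : power) j : (idem power i x : {ffun _}) j = idem M i (x j).
Proof. exact: power_mapE. Qed.

Lemma arrow_power a (x : power) j : (arrow power a x : {ffun _}) j = arrow M a (x j).
Proof. exact: power_mapE. Qed.

Lemma dimvec_power : dimvec power = dimvec M *~ e%:Z.
Proof.
apply/ffunP=> i; rewrite ffunMzE !dimvecE mulrC -PoszM; congr Posz.
rewrite /vertex_dim (@dim_ffun_family _ _ _ (fun=> limg (idem M i))).
  by rewrite sum_nat_const card_ord.
move=> x; split=> [/memv_imgP[y _ ->] j|x_i]; first by rewrite idem_power memv_img ?memvf.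
apply/memv_imgP; exists x; rewrite ?memvf //; apply/ffunP=> j; rewrite idem_power.
by apply/esym/limg_idempotentP; [apply: idem_idem | apply: x_i].
Qed.

Lemma matrix_action_hom n : is_hom (matrix_action M n : 'Hom(power, power)).
Proof.
by apply/is_homP; split=> l x; apply/ffunP=> j; rewrite ?idem_power ?arrow_power !matrix_actionE
  linear_sum; apply: eq_bigr => i _; rewrite ?idem_power ?arrow_power linearZ.
Qed.

Lemma power_inj_hom i : is_hom (power_inj M i : 'Hom(M, power)).
Proof.
by apply/is_homP; split=> l x; apply/ffunP=> j;
  rewrite ?idem_power ?arrow_power !power_injE linearZ.
Qed.

End Power.

Lemma power_map_hom e M N (f : 'Hom(M, N)) :
  is_hom f -> is_hom (power_map e f : 'Hom(power e M, power e N)).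
Proof.
move=> hf; apply/is_homP; split=> l x; apply/ffunP=> j.
  by rewrite idem_power !power_mapE (hom_idemE hf).
by rewrite arrow_power !power_mapE (hom_arrowE hf).
Qed.

Definition power_tail e M : 'Hom(power e.+1 M, power e M) :=
  linfun (fun x : power e.+1 M => [ffun j => (x : {ffun _}) (lift ord0 j)] : power e M).

Lemma power_tailE e M x j : (power_tail e M x : {ffun _}) j = (x : {ffun _}) (lift ord0 j).
Proof. by rewrite linfunE ?ffunE // => c y z; apply/ffunP=> i; rewrite !ffunE. Qed.

Lemma power_ses e M : is_ses (power_inj M ord0 : 'Hom(M, power e.+1 M)) (power_tail e M).
Proof.
have lift0 (j : 'I_e) : (lift ord0 j == ord0) = false by rewrite eq_sym (negPf (neq_lift _ _)).
split.
- apply/is_monoP; split=> [|u /ffunP/(_ ord0)]; first exact: power_inj_hom.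
  by rewrite power_injE eqxx scale1r ffunE.
- apply/is_epiP; split=> [|y].
    by apply/is_homP; split=> l x; apply/ffunP=> j;
      rewrite ?idem_power ?arrow_power !power_tailE ?idem_power ?arrow_power.
  exists [ffun j => if unlift ord0 j is Some l then (y : {ffun _}) l else 0].
  by apply/ffunP=> j; rewrite power_tailE ffunE liftK.
apply/vspaceP=> x; rewrite memv_ker; apply/memv_imgP/eqP => [[u _ ->]|tail0].
  by apply/ffunP=> j; rewrite power_tailE power_injE ffunE lift0 scale0r.
exists ((x : {ffun _}) ord0); rewrite ?memvf //; apply/ffunP=> j; rewrite power_injE.
case: (unliftP ord0 j) => [l ->|->]; last by rewrite eqxx scale1r.
by rewrite lift0 scale0r -power_tailE tail0 ffunE.
Qed.

Lemma tau_nilpotent_power e M : tau_nilpotent M -> tau_nilpotent (power e M).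
Proof.
move=> nM; elim: e => [|e IH]; last exact: tau_nilpotent_ses (power_ses e M) nM IH.
by apply/tau_nilpotent_zero/is_zeroP => x; apply/ffunP=> -[].
Qed.

End PowerModule.

Section Commutant.
Variables (k : fieldType) (e : nat) (m : 'M[k]_e).

Definition irreducible_mx := forall X : {vspace 'rV[k]_e},
  (forall u, u \in X -> u *m m \in X) -> X != 0%VS -> X = fullv.

Definition commutant : {vspace 'M[k]_e} := vspace_of (fun n => n *m m = m *m n).

Lemma commutantP n : reflect (n *m m = m *m n) (n \in commutant).
Proof.
apply: vspace_ofP; split=> [|c n1 n2 comm1 comm2]; first by rewrite mul0mx mulmx0.
by rewrite mulmxDl mulmxDr -scalemxAl -scalemxAr comm1 comm2.
Qed.

Lemma commutant1 : 1%:M \in commutant.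
Proof. by apply/commutantP; rewrite mul1mx mulmx1. Qed.

Lemma commutantM n n' : n \in commutant -> n' \in commutant -> n *m n' \in commutant.
Proof.
by move=> /commutantP nm /commutantP nm'; apply/commutantP; rewrite -mulmxA nm' !mulmxA nm.
Qed.

Hypothesis irreducible_m : irreducible_mx.

Lemma commutant_unit n : n \in commutant -> n != 0 -> n \in unitmx.
Proof.
move/commutantP=> nm n0; rewrite -row_free_unit -kermx_eq0; apply: contraNT n0 => ker0.
pose X : {vspace 'rV[k]_e} := lker (linfun (mulmxr n)).
have XP u : (u \in X) = (u *m n == 0) by rewrite memv_ker lfunE.
have X1 : X = fullv.
  apply: irreducible_m => [u|].
    by rewrite !XP -mulmxA -nm mulmxA => /eqP->; rewrite mul0mx.
  apply: contraNneq ker0 => X0; apply/eqP/row_matrixP=> i; rewrite row0.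
  by apply/eqP; rewrite -memv0 -X0 XP -row_mul mulmx_ker row0.
by apply/eqP/row_matrixP=> i; rewrite row0 rowE; apply/eqP; rewrite -XP X1 memvf.
Qed.

Hypothesis e_gt0 : (0 < e)%N.

Lemma dim_commutant : (e <= \dim commutant)%N.
Proof.
pose i := Ordinal e_gt0; pose v : 'rV[k]_e := delta_mx 0 i.
have v0 : v != 0 by apply/eqP=> /matrixP/(_ 0 i)/eqP; rewrite !mxE !eqxx oner_eq0.
pose orbit : 'Hom('M[k]_e, 'rV[k]_e) := linfun (mulmx v).
have orbit1 : (orbit @: commutant)%VS = fullv.
  apply: irreducible_m => [_ /memv_imgP[n nC ->]|].
    have nm_comm : n *m m \in commutant by rewrite commutantM //; apply/commutantP.
    by apply/memv_imgP; exists (n *m m) => //; rewrite !lfunE /= mulmxA.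
  apply: contraNneq v0 => orbit0; rewrite -memv0 -orbit0; apply/memv_imgP.
  by exists 1%:M; rewrite ?commutant1 // lfunE /= mulmx1.
have dim_orbit : \dim (orbit @: commutant) = e by rewrite orbit1 dimvf /dim /= mul1n.
by rewrite -[leqLHS]dim_orbit -(limg_ker_dim orbit commutant) leq_addl.
Qed.

Variable U : vectType k.

Definition commutant_action : {vspace 'End({ffun 'I_e -> U})} :=
  (linfun (@matrix_action k e U) @: commutant)%VS.

Lemma commutant_actionP f :
  f \in commutant_action <-> exists2 n, n \in commutant & f = matrix_action U n.
Proof.
split=> [/memv_imgP[n nC ->]|[n nC ->]].
  by exists n; rewrite // (linfunE (@matrix_action_linear k e U)).
by apply/memv_imgP; exists n; rewrite // (linfunE (@matrix_action_linear k e U)).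
Qed.

Lemma commutant_action_division : division_subalgebra commutant_action.
Proof.
split=> [|f g /commutant_actionP[n nC ->] /commutant_actionP[n' nC' ->]|].
- by apply/commutant_actionP; exists 1%:M; [apply: commutant1 | rewrite matrix_action1].
- by apply/commutant_actionP; exists (n' *m n); [apply: commutantM | rewrite matrix_action_comp].
move=> f /commutant_actionP[n nC ->] f0; apply/lker_eq0P => x nx0.
have unit_n : n \in unitmx.
  by apply: commutant_unit nC _; apply: contraNneq f0 => ->; rewrite matrix_action0.
have : (matrix_action U (invmx n) \o matrix_action U n)%VF x = 0 by rewrite comp_lfunE nx0 linear0.
by rewrite matrix_action_comp mulmxV // matrix_action1 id_lfunE.
Qed.

Lemma dim_commutant_action (u : U) : u != 0 -> (e <= \dim commutant_action)%N.
Proof.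
move=> u0; apply: leq_trans dim_commutant _.
apply: (dimv_linear_inj (@matrix_action_linear k e U)) => [n _ n0|n nC]; last first.
  by apply/commutant_actionP; exists n.
apply/matrixP=> i j; have := matrix_action_inj n i u j; rewrite n0 zero_lfunE ffunE => /esym/eqP.
by rewrite scaler_eq0 (negPf u0) orbF mxE => /eqP.
Qed.

End Commutant.

(** * Covers of the regular simple modules *)

Section Pencil.
Variables (k : fieldType) (Q : quiver).
Hypothesis acyclicQ : acyclic Q.
Variable d : {ffun vtx Q -> int}.
Hypothesis null_d : null_root d.
Local Notation regular_sub := (regular_sub d).
Local Notation regular_simple := (regular_simple d).
Implicit Types C M N R S T X Y Z : kQmodule k Q.

Lemma dimhom_tau_nilpotent_ses P X Y Z (f : 'Hom(X, Y)) (g : 'Hom(Y, Z)) :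
  tau_nilpotent P -> is_ses f g -> torsion X -> torsion Z ->
  dimhom P Y = (dimhom P X + dimhom P Z)%N.
Proof.
move=> nP fg tX tZ; have tY := torsion_ses fg tX tZ; apply/eqP; rewrite -eqz_nat PoszD.
by rewrite !(dimhom_tau_nilpotent_torsion acyclicQ nP) // (dimvec_ses fg) eulerDr.
Qed.

Lemma dimhom_greatest_ker C T (pi : 'Hom(C, T)) :
  tau_regular C -> regular_simple T -> is_epi pi -> greatest_regular_sub d (lker pi) ->
  (dimhom C T <= dimhom T T)%N.
Proof.
move=> rC simT epi_pi [_ _ greatest]; have [rT _ _] := simT.
apply: (@leq_trans (\dim (precomp T pi @: homs T T))); last first.
  by rewrite -[leqRHS](limg_ker_dim (precomp T pi)) leq_addl.
apply/dimvS/subvP=> f; rewrite mem_homs => hf; have [->|f0] := eqVneq f 0; first exact: mem0v.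
have epi_f := regular_simple_epi acyclicQ null_d simT rC hf f0.
have same_ker : lker f = lker pi.
  apply/eqP; rewrite eqEdim greatest ?lker_full ?(regular_sub_ker acyclicQ null_d) //=.
  have := limg_ker_dim f fullv; rewrite -(limg_ker_dim pi fullv) !capfv.
  by rewrite (epi_limg epi_f) (epi_limg epi_pi) => /addIn->.
have [|g hg gE] := epi_factor epi_pi hf; first by rewrite same_ker.
by apply/memv_imgP; exists g; rewrite ?mem_homs // precompE; apply/lfunP=> u; rewrite comp_lfunE gE.
Qed.

Variables P L : kQmodule k Q.
Hypotheses (nP : tau_nilpotent P) (defectP : defect d P = -1).
Hypotheses (nL : tau_nilpotent L) (dimL : dimvec L = dimvec P + d).

Lemma dimhom_pencil_target T : tau_regular T -> dimhom L T = dimhom P T.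
Proof.
move=> rT; apply/eqP; rewrite -eqz_nat; have [tT _] := rT.
rewrite !(dimhom_tau_nilpotent_torsion acyclicQ _ tT) // dimL eulerDl.
by rewrite -[euler d _]/(defect d T) (tau_regular_defect acyclicQ null_d rT) addr0.
Qed.

Definition pencil (a b : 'Hom(P, L)) := [/\ is_hom a, is_hom b & free [:: a; b]].

Lemma pencilC a b : pencil a b -> pencil b a.
Proof. by case=> ha hb; rewrite -(perm_free (permEl (perm_catC [:: b] [:: a]))). Qed.

Definition pencil_invariant T (a b : 'Hom(P, L)) (W : {vspace 'Hom(L, T)}) :=
  [/\ W != 0%VS, (W <= homs L T)%VS &
      forall w, w \in W -> exists2 w', w' \in W & (w \o b)%VF = (w' \o a)%VF].

Lemma exists_pencil_invariant T a b : tau_regular T -> (0 < dimhom P T)%N -> pencil a b ->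
  exists a' b' W, pencil a' b' /\ pencil_invariant (T := T) a' b' W.
Proof.
move=> rT seen ab; have [ha hb _] := ab.
have [inj_a|] := eqVneq (homs L T :&: lker (precomp T a))%VS 0%VS; last first.
  rewrite -vpick0; have := memv_pick (homs L T :&: lker (precomp T a))%VS.
  move: (vpick _) => w; rewrite memv_cap memv_ker precompE => /andP[homw /eqP wa0] w0.
  exists b, a, <[w]>%VS; split; [exact: pencilC | split=> [|//|_ /vlineP[c ->]]].
    by rewrite -memv0 in w0; apply: contraNneq w0 => <-; apply: memv_line.
  by exists 0; rewrite ?mem0v // comp_lfun0l -comp_lfunZl wa0 scaler0.
have onto_a : (precomp T a @: homs L T)%VS = homs P T.
  apply/eqP; rewrite eqEdim limg_dim_eq // -/(dimhom L T) dimhom_pencil_target // leqnn andbT.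
  by apply/subvP=> _ /memv_imgP[w + ->]; rewrite precompE !mem_homs; apply: is_hom_comp.
exists a, b, (homs L T); split=> //; split=> // [|w].
  by rewrite -dimv_eq0 -lt0n -/(dimhom L T) dimhom_pencil_target.
rewrite mem_homs => /(is_hom_comp hb); rewrite -mem_homs -onto_a => /memv_imgP[w' homw' ->].
by exists w'; rewrite ?precompE.
Qed.

Definition pencil_datum T (a b : 'Hom(P, L)) e (m : 'M[k]_e) (c : 'Hom('rV[k]_e, 'Hom(L, T))) :=
  [/\ lker c == 0%VS, forall u, is_hom (c u) & forall u, (c u \o b)%VF = (c (u *m m) \o a)%VF].

Lemma pencil_invariant_coordinates T a b W : pencil_invariant (T := T) a b W ->
  exists (m : 'M[k]_(\dim W)) c, pencil_datum (T := T) a b m c.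
Proof.
move=> [_ homW invW]; pose x i := (vbasis W)`_i.
have xW (i : 'I_(\dim W)) : x i \in W by rewrite vbasis_mem ?mem_nth ?size_tuple.
have /choice[w wP] : forall i : 'I_(\dim W), exists w : 'Hom(L, T),
    w \in W /\ (x i \o b)%VF = (w \o a)%VF.
  by move=> i; have [w wW wE] := invW _ (xW i); exists w.
pose combine (u : 'rV[k]_(\dim W)) : 'Hom(L, T) := \sum_i u 0 i *: x i.
have combine_linear : linear combine.
  move=> t u v; rewrite /combine scaler_sumr -big_split; apply: eq_bigr => i _ /=.
  by rewrite !mxE scalerDl scalerA.
exists (\matrix_(i, j) coord (vbasis W) j (w i)), (linfun combine).
split=> [|u|u]; rewrite ?(linfunE combine_linear).
- apply/lker_eq0P => u; rewrite (linfunE combine_linear) => cu0; apply/rowP=> i; rewrite [RHS]mxE.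
  by have /freeP := basis_free (vbasisP W) => /(_ (fun i => u 0 i) cu0).
- by rewrite -mem_homs (subvP homW) //; apply: memv_suml => i _; rewrite memvZ.
have -> : combine (u *m \matrix_(i, j) coord (vbasis W) j (w i)) = \sum_i u 0 i *: w i.
  rewrite /combine; under eq_bigr do rewrite mxE scaler_suml.
  rewrite exchange_big /=; apply: eq_bigr => i _; have [wiW _] := wP i.
  rewrite [in RHS](coord_vbasis wiW) scaler_sumr; apply: eq_bigr => j _.
  by rewrite mxE scalerA.
apply/lfunP=> y; rewrite !comp_lfunE !sum_lfunE; apply: eq_bigr => i _; have [_ wiE] := wP i.
by rewrite !scale_lfunE -!comp_lfunE wiE.
Qed.

Lemma pencil_datum_invariant T a b e (m : 'M[k]_e) (c : 'Hom('rV[k]_e, 'Hom(L, T)))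
    (X : {vspace 'rV[k]_e}) : pencil_datum a b m c -> X != 0%VS ->
  (forall u, u \in X -> u *m m \in X) -> pencil_invariant a b (c @: X).
Proof.
move=> [inj_c homc intertwine] X0 stableX; split=> [||_ /memv_imgP[u uX ->]].
- by rewrite -dimv_eq0 limg_dim_lker0 // dimv_eq0.
- by apply/subvP=> _ /memv_imgP[u _ ->]; rewrite mem_homs.
by exists (c (u *m m)); rewrite ?memv_img ?stableX.
Qed.

Lemma exists_pencil_datum T a b : tau_regular T -> (0 < dimhom P T)%N -> pencil a b ->
  exists a' b' e (m : 'M[k]_e) (c : 'Hom('rV[k]_e, 'Hom(L, T))),
    [/\ (0 < e)%N, irreducible_mx m, pencil a' b' & pencil_datum a' b' m c].
Proof.
move=> rT seen ab; have [a0 [b0 [W0 invW0]]] := exists_pencil_invariant rT seen ab.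
have [[[a' b'] W] [/= ab' invW] minW] :=
  exists_minimizer (fun x : 'Hom(P, L) * 'Hom(P, L) * {vspace 'Hom(L, T)} => \dim x.2)
  (P := fun x => pencil x.1.1 x.1.2 /\ pencil_invariant x.1.1 x.1.2 x.2)
  (ex_intro _ (a0, b0, W0) invW0).
have [m [c datum]] := pencil_invariant_coordinates invW; have [W0' _ _] := invW.
have [inj_c _ _] := datum; exists a', b', (\dim W), m, c; split=> //.
  by rewrite lt0n dimv_eq0.
move=> X stableX X0; apply/eqP; rewrite eqEdim subvf /= dimvf /dim /= mul1n.
rewrite -(limg_dim_lker0 X inj_c).
exact: (minW (a', b', (c @: X)%VS) (conj ab' (pencil_datum_invariant datum X0 stableX))).
Qed.

Section Cokernel.
Variables (e : nat) (m : 'M[k]_e) (a b : 'Hom(P, L)).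
Hypotheses (e_gt0 : (0 < e)%N) (irreducible_m : irreducible_mx m) (ab : pencil a b).

Local Notation powerP := (power e P).
Local Notation powerL := (power e L).

Let homa : is_hom a. Proof. by case: ab. Qed.
Let homb : is_hom b. Proof. by case: ab. Qed.

Definition pencil_map : 'Hom(powerP, powerL) :=
  (matrix_action L m \o power_map e a - power_map e b)%VF.

Lemma pencil_mapE x : pencil_map x = matrix_action L m (power_map e a x) - power_map e b x.
Proof. by rewrite add_lfunE opp_lfunE comp_lfunE. Qed.

Lemma pencil_map_hom : is_hom pencil_map.
Proof.
apply: is_homB (power_map_hom e homb).
exact: is_hom_comp (power_map_hom e homa) (matrix_action_hom L m).
Qed.

Lemma pencil_map_commutant n x : n \in commutant m ->
  pencil_map (matrix_action P n x) = matrix_action L n (pencil_map x).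
Proof.
move/commutantP=> nm; rewrite !pencil_mapE linearB /= !power_map_matrix_action; congr (_ - _).
by rewrite -[LHS]comp_lfunE -[RHS]comp_lfunE !matrix_action_comp nm.
Qed.

Lemma pencil_map_neq0 : pencil_map != 0.
Proof.
have [_ _] := pencilC ab; rewrite free_cons span_seq1 => /andP[/negP ba _].
apply/negP=> /eqP map0; apply: ba; apply/vlineP; pose i := Ordinal e_gt0; exists (m i i).
apply/lfunP=> u; have /ffunP/(_ i) : pencil_map (power_inj P i u) = 0 by rewrite map0 zero_lfunE.
rewrite pencil_mapE !power_map_inj !ffunE matrix_action_inj power_injE eqxx scale1r scale_lfunE.
by move/eqP; rewrite subr_eq0 => /eqP.
Qed.

Lemma defect_power M : defect d M = -1 -> defect d (power e M) = - e%:Z.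
Proof. by rewrite /defect dimvec_power eulerMzr => ->; rewrite mulrzz mulN1r. Qed.

(* A submodule stable under the commutant of m has defect divisible by its    *)
(* dimension, which is at least e.                                            *)
Lemma stable_sub_defect M (X : {vspace power e M}) :
  ~ is_zero M -> tau_nilpotent M -> is_submod X -> stable_under (commutant_action m M) X ->
  X = 0%VS \/ sub_defect d X <= - e%:Z.
Proof.
move=> nzM nM sX stableX; have nX := tau_nilpotent_submod sX (tau_nilpotent_power e nM).
have [X0|nzX] := pselect (is_zero (submod sX)); [by left; apply/(is_zero_submod sX) | right].
have [u u0] : exists u : M, u != 0.
  by apply: contrapT => all0; apply: nzM; apply/is_zeroP => u; apply: contrapT => /eqP u0;
    apply: all0; exists u.
have homD f : f \in commutant_action m M -> is_hom (f : 'End(power e M)).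
  by move/commutant_actionP=> [n _ ->]; apply: matrix_action_hom.
have /dvdzP[t tE] := @dvdz_sub_defect _ _ d _ _ X (commutant_action_division irreducible_m M) homD
  stableX.
have := dim_commutant_action irreducible_m e_gt0 u0.
have := tau_nilpotent_defect_lt0 acyclicQ null_d nX nzX; rewrite -(sub_defectE d sX) tE.
move: (\dim _) => D; rewrite ltNge => /negP tD eD; have t_lt0 : t <= -1.
  by rewrite leNgt; apply/negP=> t_ge0; apply: tD; rewrite mulr_ge0 //; lia.
nia.
Qed.

Lemma pencil_map_mono : is_mono pencil_map.
Proof.
have sK := is_submod_ker pencil_map_hom; have sI := is_submod_limg pencil_map_hom.
have stableK : stable_under (commutant_action m P) (lker pencil_map).
  move=> _ x /commutant_actionP[n nC ->]; rewrite !memv_ker pencil_map_commutant // => /eqP->.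
  by rewrite linear0.
rewrite /is_mono pencil_map_hom; apply/eqP.
case: (stable_sub_defect (defect_m1_nonzero defectP) nP sK stableK) => // defectK.
have := sub_defect_ker_img d pencil_map_hom (is_submodf powerP).
rewrite sub_defectf capfv (defect_power defectP) (sub_defectE d sI) => defectI.
have nI := tau_nilpotent_submod sI (tau_nilpotent_power e nL).
have /(is_zero_submod sI)/eqP : is_zero (submod sI).
  by apply: (tau_nilpotent_defect0 acyclicQ null_d nI);
    have := tau_nilpotent_defect_le0 acyclicQ null_d nI; lia.
by rewrite limg_eq0 (negPf pencil_map_neq0).
Qed.

Definition pencil_cokernel := quomod (is_submod_limg pencil_map_hom).
Local Notation coker := pencil_cokernel.
Definition cokernel_proj : 'Hom(powerL, coker) := quo_proj (limg pencil_map).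

Lemma cokernel_ses : is_ses pencil_map cokernel_proj.
Proof. by split; [apply: pencil_map_mono | apply: quo_proj_epi | rewrite lker_quo_proj]. Qed.

Let epi_proj : is_epi cokernel_proj. Proof. by case: cokernel_ses. Qed.

Lemma dimvec_cokernel : dimvec coker = d *~ e%:Z.
Proof.
have := dimvec_ses cokernel_ses; rewrite !dimvec_power dimL mulrzDl => /esym.
exact: addrI.
Qed.

Lemma cokernel_action n : n \in commutant m ->
  exists2 f : 'End(coker), is_hom f &
    forall x, f (cokernel_proj x) = cokernel_proj (matrix_action L n x).
Proof.
move=> nC; have hom_n := is_hom_comp (matrix_action_hom L n) (epi_hom epi_proj).
have [|f hf fE] := epi_factor epi_proj hom_n; last by exists f => // x; rewrite fE comp_lfunE.
have [_ _ <-] := cokernel_ses; apply/subvP=> _ /memv_imgP[x _ ->]; rewrite memv_ker comp_lfunE.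
by rewrite -pencil_map_commutant // (ses_comp0 _ cokernel_ses).
Qed.

Lemma cokernel_torsion_stable (X : {vspace coker}) (sX : is_submod X) :
  torsion (submod sX) -> tau_nilpotent (quomod sX) ->
  stable_under (commutant_action m L) (lker (quo_proj X \o cokernel_proj)%VF).
Proof.
move=> tX nX _ u /commutant_actionP[n nC ->]; rewrite !memv_ker !comp_lfunE !quo_proj0 => uX.
have [f hf fE] := cokernel_action nC; rewrite -fE -quo_proj0.
have /dimhom_eq0P tX0 := tX _ nX.
have /tX0/lfunP/(_ (vsproj X (cokernel_proj u))) :
    is_hom (quo_proj X \o (f \o sub_incl sX) : 'Hom(submod sX, quomod sX))%VF.
  exact: is_hom_comp (is_hom_comp (sub_incl_hom sX) hf) (quo_proj_hom sX).
by rewrite !comp_lfunE sub_inclE vsprojK // zero_lfunE => ->.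
Qed.

Lemma pencil_cokernel_regular : tau_regular coker.
Proof.
have [X [sX [tX nX]]] := exists_torsion_sub coker.
have defect_coker : defect d coker = 0.
  by rewrite /defect dimvec_cokernel eulerMzr null_root_isotropic // mul0rz.
suff X1 : X = fullv.
  apply: (torsion_defect0_regular acyclicQ null_d) => //; apply: torsion_isom tX.
  apply: isomI (sub_incl_mono sX) _; rewrite /is_epi sub_incl_hom limg_sub_incl.
  exact/eqP.
have epi_q := epi_comp epi_proj (quo_proj_epi sX); have sK := is_submod_ker (epi_hom epi_q).
have := sub_defect_ker_img d (epi_hom epi_q) (is_submodf powerL).
have defectL : defect d L = -1 by rewrite /defect dimL eulerDr null_root_isotropic // addr0.
rewrite sub_defectf capfv (epi_limg epi_q) sub_defectf (defect_power defectL) => defectK.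
have stableK := cokernel_torsion_stable tX nX.
apply/is_zero_quomod/(tau_nilpotent_defect0 acyclicQ null_d nX).
have := tau_nilpotent_defect_le0 acyclicQ null_d nX.
case: (stable_sub_defect (defect_m1_nonzero defectL) nL sK stableK) => [K0|]; last first.
  by move: defectK; lia.
case/negP: pencil_map_neq0; apply/eqP/lfunP=> u; rewrite zero_lfunE; apply/eqP.
rewrite -memv0 -K0 memv_ker comp_lfunE (ses_comp0 _ cokernel_ses) linear0; exact: eqxx.
Qed.

Lemma dimhom_cokernel : dimhom P coker = e.
Proof.
apply/eqP; rewrite -eqz_nat (dimhom_tau_nilpotent_torsion acyclicQ nP pencil_cokernel_regular.1).
have [_ antisym _ _] := null_d; rewrite dimvec_cokernel eulerMzr mulrzz.
by have := antisym (dimvec P); rewrite -/(defect d P) defectP => /oppr_inj<-; rewrite mul1r.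
Qed.

Lemma cokernel_quotient_seen S (f : 'Hom(coker, S)) :
  regular_simple S -> is_hom f -> f != 0 -> (0 < dimhom P S)%N.
Proof.
move=> [rS _ _] hf f0; rewrite -(dimhom_pencil_target rS); apply/dimhom_gt0P.
have hfp := is_hom_comp (epi_hom epi_proj) hf.
have [i fi0] : exists i, (f \o cokernel_proj \o power_inj L i)%VF != 0.
  apply: contrapT => all0; case/eqP: f0; apply/lfunP=> y; rewrite zero_lfunE.
  have [x <-] := epi_onto epi_proj y; rewrite (power_inj_sum x) !linear_sum big1 //= => i _.
  have /lfunP/(_ (x i)) : (f \o cokernel_proj \o power_inj L i)%VF = 0.
    by apply: contrapT => /eqP fi0; apply: all0; exists i.
  by rewrite !comp_lfunE zero_lfunE.
by exists (f \o cokernel_proj \o power_inj L i)%VF;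
  rewrite // (is_hom_comp (power_inj_hom L i) hfp).
Qed.

Section Top.
Variables (T : kQmodule k Q) (c : 'Hom('rV[k]_e, 'Hom(L, T))).
Hypotheses (simT : regular_simple T) (datum : pencil_datum a b m c).

Let rT : tau_regular T. Proof. by case: simT. Qed.
Let homc u : is_hom (c u). Proof. by case: datum. Qed.

Definition pencil_eval : 'Hom(powerL, T) :=
  linfun (fun x : powerL => \sum_j c (delta_mx 0 j) ((x : {ffun _}) j)).

Lemma pencil_evalE x : pencil_eval x = \sum_j c (delta_mx 0 j) ((x : {ffun _}) j).
Proof.
rewrite linfunE // => t y z; rewrite scaler_sumr -big_split; apply: eq_bigr => j _ /=.
by rewrite !ffunE linearP.
Qed.

Lemma pencil_eval_hom : is_hom pencil_eval.
Proof.
apply/is_homP; split=> [i x|r x]; rewrite !pencil_evalE linear_sum; apply: eq_bigr => j _.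
  by rewrite idem_power (hom_idemE (homc _)).
by rewrite arrow_power (hom_arrowE (homc _)).
Qed.

Lemma pencil_eval_row (u : 'rV[k]_e) (x : powerL) (y : L) :
  (forall j, (x : {ffun _}) j = u 0 j *: y) -> pencil_eval x = c u y.
Proof.
move=> xE; rewrite pencil_evalE [in RHS](row_sum_delta u) linear_sum sum_lfunE.
by apply: eq_bigr => j _; rewrite xE !linearZ scale_lfunE.
Qed.

Lemma pencil_eval_inj i y : pencil_eval (power_inj L i y) = c (delta_mx 0 i) y.
Proof. by apply: pencil_eval_row => j; rewrite power_injE mxE eqxx. Qed.

Lemma pencil_eval_map x : pencil_eval (pencil_map x) = 0.
Proof.
have [_ _ intertwine] := datum; rewrite (power_inj_sum x) !linear_sum big1 //= => i _.
rewrite pencil_mapE linearB /= !power_map_inj pencil_eval_inj.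
rewrite (@pencil_eval_row (delta_mx 0 i *m m) _ (a (x i))) => [|j]; last first.
  by rewrite matrix_action_inj -rowE mxE.
by rewrite -[c _ (a _)]comp_lfunE -intertwine comp_lfunE subrr.
Qed.

Lemma exists_cokernel_top : exists2 pi : 'Hom(coker, T),
  is_epi pi & forall x, pi (cokernel_proj x) = pencil_eval x.
Proof.
have [|pi hpi piE] := epi_factor epi_proj pencil_eval_hom.
  have [_ _ <-] := cokernel_ses; apply/subvP=> _ /memv_imgP[x _ ->].
  by rewrite memv_ker pencil_eval_map.
exists pi => //; apply: (regular_simple_epi acyclicQ null_d simT pencil_cokernel_regular hpi).
have [/lker_eq0P inj_c _ _] := datum; pose i := Ordinal e_gt0.
apply/negP=> /eqP pi0; have /inj_c/matrixP/(_ 0 i)/eqP : c (delta_mx 0 i) = 0.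
  by apply/lfunP=> y; rewrite -pencil_eval_inj -piE pi0 !zero_lfunE.
by rewrite !mxE !eqxx oner_eq0.
Qed.

Variable pi : 'Hom(coker, T).
Hypotheses (epi_pi : is_epi pi) (piE : forall x, pi (cokernel_proj x) = pencil_eval x).

Let rC := pencil_cokernel_regular.
Let sK := is_submod_ker (epi_hom epi_pi).
Let rsK := regular_sub_ker acyclicQ null_d rC rT (epi_hom epi_pi).
Let rK := tau_regular_submod acyclicQ null_d rC sK rsK.

Lemma dimhom_cokernel_top : dimhom P T = e /\ dimhom P (submod sK) = 0%N.
Proof.
have := dimhom_tau_nilpotent_ses nP (ker_ses sK epi_pi) rK.1 rT.1; rewrite dimhom_cokernel.
suff : (e <= dimhom P T)%N by lia.
rewrite -(dimhom_pencil_target rT); have [/lker_eq0P inj_c _ _] := datum.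
have -> : e = \dim {:'rV[k]_e} by rewrite dimvf /dim /= mul1n.
apply: (dimv_linear_inj (f := c)) => [t u v|u _|u _]; first by rewrite linearP.
  exact: inj_c.
by rewrite mem_homs.
Qed.

Lemma cokernel_top_reflects0 (f : 'Hom(P, coker)) : is_hom f -> (pi \o f)%VF = 0 -> f = 0.
Proof.
move=> hf pf0; have [|g hg gE] := mono_factor (sub_incl_mono sK) hf.
  rewrite limg_sub_incl; apply/subvP=> _ /memv_imgP[u _ ->]; rewrite memv_ker.
  by rewrite -comp_lfunE pf0 zero_lfunE.
have [_ /dimhom_eq0P/(_ g hg) g0] := dimhom_cokernel_top.
by apply/lfunP=> u; rewrite -gE g0 zero_lfunE linear0 zero_lfunE.
Qed.

Lemma cokernel_top_greatest : greatest_regular_sub d (lker pi).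
Proof.
have [_ nzT onlyT] := simT; split=> // [|Z rZ Z1].
  by rewrite lker_full (epi_neq0 epi_pi).
have [J maxJ ZJ] := exists_maximal_regular_sub rZ Z1; apply: subv_trans ZJ _.
have [rsJ _ _] := maxJ; have sJ := regular_sub_submod rsJ.
have simS := maximal_regular_simple acyclicQ null_d sJ rC maxJ; have [rS nzS _] := simS.
have rJ := tau_regular_submod acyclicQ null_d rC sJ rsJ.
case: (onlyT _ (regular_sub_img acyclicQ null_d rC rT (epi_hom epi_pi) rsJ)) => imgJ.
  by rewrite lkerE imgJ.
have hr := is_hom_comp (sub_incl_hom sJ) (epi_hom epi_pi); have sK' := is_submod_ker hr.
have epi_r : is_epi (pi \o sub_incl sJ)%VF by rewrite /is_epi hr limg_comp limg_sub_incl imgJ eqxx.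
have rK' := tau_regular_submod acyclicQ null_d rJ sK' (regular_sub_ker acyclicQ null_d rJ rT hr).
have seen : (0 < dimhom P (quomod sJ))%N.
  apply: (cokernel_quotient_seen simS (quo_proj_hom sJ)).
  exact: epi_neq0 (quo_proj_epi sJ) nzS.
have := dimhom_tau_nilpotent_ses nP (sub_quo_ses sJ) rJ.1 rS.1; rewrite dimhom_cokernel.
have := dimhom_tau_nilpotent_ses nP (ker_ses sK' epi_r) rK'.1 rT.1.
by have [-> _] := dimhom_cokernel_top; lia.
Qed.

Lemma dimhom_top_le_end : (dimhom P T <= dimhom T T)%N.
Proof.
have [-> _] := dimhom_cokernel_top; apply: leq_trans (dim_commutant irreducible_m e_gt0) _.
apply: leq_trans (dimhom_greatest_ker rC simT epi_pi cokernel_top_greatest).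
have /andP[_ onto] := epi_proj; rewrite -[leqRHS](limg_dim_lker0 _ (precomp_inj T onto)).
apply: (dimv_linear_inj (f := fun n => (pencil_eval \o matrix_action L n)%VF)).
- by move=> t n n'; rewrite matrix_action_linear comp_lfunDr comp_lfunZr.
- move=> n nC n0; apply: contrapT => /eqP n_neq0; have [_ nzT _] := simT; apply: nzT.
  apply/is_zeroP=> t; have [y <-] := epi_onto epi_pi t; have [x <-] := epi_onto epi_proj y.
  rewrite piE.
  have unit_n := commutant_unit irreducible_m nC n_neq0.
  move/lfunP/(_ (matrix_action L (invmx n) x)): n0; rewrite zero_lfunE comp_lfunE.
  by rewrite -[matrix_action L n _]comp_lfunE matrix_action_comp mulVmx // matrix_action1 id_lfunE.
move=> n nC; have [f hf fE] := cokernel_action nC; apply/memv_imgP; exists (pi \o f)%VF.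
  by rewrite mem_homs (is_hom_comp hf (epi_hom epi_pi)).
by rewrite precompE; apply/lfunP=> x; rewrite !comp_lfunE fE piE.
Qed.

End Top.

End Cokernel.

End Pencil.

Section Cover.
Variables (k : fieldType) (Q : quiver).
Hypothesis acyclicQ : acyclic Q.
Variable d : {ffun vtx Q -> int}.
Hypothesis null_d : null_root d.
Variable P : kQmodule k Q.
Hypotheses (nP : tau_nilpotent P) (defectP : defect d P = -1).
Implicit Types C L M T : kQmodule k Q.

Definition regular_cover C T (pi : 'Hom(C, T)) :=
  [/\ tau_regular C, forall M, tau_regular M -> euler (dimvec C) (dimvec M) = 0, is_epi pi,
      greatest_regular_sub d (lker pi) &
      forall f : 'Hom(P, C), is_hom f -> (pi \o f)%VF = 0 -> f = 0].

Lemma exists_pencil L : (2 <= dimhom P L)%N -> exists a b : 'Hom(P, L), pencil a b.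
Proof.
rewrite /dimhom -(size_tuple (vbasis (homs P L))).
have : {subset (vbasis (homs P L) : seq 'Hom(P, L)) <= homs P L} by move=> f; apply: vbasis_mem.
have := basis_free (vbasisP (homs P L)).
case: (tval _) => [|a [|b s]] // free_ab basis_hom _; exists a, b; split.
- by rewrite -mem_homs basis_hom ?mem_head.
- by rewrite -mem_homs basis_hom // inE mem_head orbT.
exact: (@catl_free _ _ s [:: a; b]).
Qed.

Lemma exists_regular_cover T : regular_simple d T -> (0 < dimhom P T)%N ->
  (exists C (pi : 'Hom(C, T)), regular_cover pi) /\ (dimhom P T <= dimhom T T)%N.
Proof.
move=> simT seen; have [rT _ _] := simT.
have [L [nL dimL hom2]] := exists_pencil_target acyclicQ null_d nP defectP.
have [a0 [b0 ab0]] := exists_pencil hom2.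
have [a [b [e [m [c [e_gt0 irr_m ab datum]]]]]] :=
  exists_pencil_datum acyclicQ null_d nP nL dimL rT seen ab0.
have [pi epi_pi piE] := exists_cokernel_top acyclicQ null_d nP defectP nL dimL e_gt0 irr_m ab simT
  datum.
split; last exact: (dimhom_top_le_end acyclicQ null_d nP defectP nL dimL e_gt0 irr_m simT datum
  epi_pi piE).
exists (pencil_cokernel m ab), pi; split=> // [|M rM||f].
- exact: (pencil_cokernel_regular acyclicQ null_d nP defectP nL dimL e_gt0 irr_m ab).
- rewrite (dimvec_cokernel acyclicQ null_d nP defectP nL dimL e_gt0 irr_m ab) eulerMzl.
  by rewrite -[euler d _]/(defect d M) (tau_regular_defect acyclicQ null_d rM) mul0rz.
- exact: (cokernel_top_greatest acyclicQ null_d nP defectP nL dimL e_gt0 irr_m simT datum epi_pi).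
exact: (cokernel_top_reflects0 acyclicQ null_d nP defectP nL dimL e_gt0 irr_m simT datum epi_pi).
Qed.

End Cover.

(** * Transitivity of the automorphism group *)

Section UniserialTop.
Variables (k : fieldType) (Q : quiver).
Hypothesis acyclicQ : acyclic Q.
Variable d : {ffun vtx Q -> int}.
Hypothesis null_d : null_root d.
Implicit Types M N T Z : kQmodule k Q.

Lemma uniserial_epi M Z (g : 'Hom(M, Z)) :
  tau_regular M -> tau_regular Z -> is_epi g -> uniserial d M -> uniserial d Z.
Proof.
move=> rM rZ eg chain A B rA rB; have hg := epi_hom eg.
have gK (D : {vspace Z}) : (g @: (g @^-1: D) = D)%VS by rewrite lpreimK // (epi_limg eg) subvf.
have := chain _ _ (regular_sub_preim acyclicQ null_d rM rZ hg rA)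
  (regular_sub_preim acyclicQ null_d rM rZ hg rB).
by case/orP=> /(limgS g); rewrite !gK => ->; rewrite ?orbT.
Qed.

Lemma uniserial_greatest_ker M T (q : 'Hom(M, T)) :
  tau_regular M -> regular_simple d T -> uniserial d M -> is_hom q -> q != 0 ->
  greatest_regular_sub d (lker q).
Proof.
move=> rM simT chain hq q0; have [rT _ onlyT] := simT.
have rK := regular_sub_ker acyclicQ null_d rM rT hq; split; rewrite ?lker_full // => Z rZ Z1.
case/orP: (chain _ _ rZ rK) => // KZ.
case: (onlyT _ (regular_sub_img acyclicQ null_d rM rT hq rZ)) => imgZ; first by rewrite lkerE imgZ.
case/eqP: Z1; apply/vspaceP=> u; rewrite memvf.
have : q u \in (q @: Z)%VS by rewrite imgZ memvf.
case/memv_imgP=> v vZ quv; rewrite -(subrK v u) memvD //; apply: (subvP KZ).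
by rewrite memv_ker linearB /= quv subrr.
Qed.

Lemma uniserial_joint_mono M N (p q : 'Hom(M, N)) :
  tau_regular M -> tau_regular N -> uniserial d M -> is_epi p -> is_hom q ->
  (lker p :&: lker q = 0)%VS -> is_mono p.
Proof.
move=> rM rN chain ep hq joint; have hp := epi_hom ep; rewrite /is_mono hp.
have [rp rq] := (regular_sub_ker acyclicQ null_d rM rN hp,
  regular_sub_ker acyclicQ null_d rM rN hq).
case/orP: (chain _ _ rp rq) => [/capv_idPl pq|/capv_idPr qp]; first by rewrite -pq joint eqxx.
rewrite -dimv_eq0; have := limg_ker_dim p fullv; have := limg_ker_dim q fullv.
rewrite !capfv -qp joint dimv0 (epi_limg ep).
by have := dimvS (subvf (limg q)); lia.
Qed.

End UniserialTop.

Section OnlySees.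
Variables (k : fieldType) (Q : quiver).
Hypothesis acyclicQ : acyclic Q.
Variable d : {ffun vtx Q -> int}.
Hypothesis null_d : null_root d.
Variable P : kQmodule k Q.
Hypothesis nP : tau_nilpotent P.
Implicit Types C M N R S T X Y Z : kQmodule k Q.

Lemma tau_nilpotent_lift M N (g : 'Hom(M, N)) (f : 'Hom(P, N)) :
  tau_regular M -> tau_regular N -> is_epi g -> is_hom f ->
  exists2 s : 'Hom(P, M), is_hom s & forall u, g (s u) = f u.
Proof.
move=> rM rN eg; have sK := is_submod_ker (epi_hom eg).
have rK := tau_regular_submod acyclicQ null_d rM sK
  (regular_sub_ker acyclicQ null_d rM rN (epi_hom eg)).
exact: (lift_ext0 acyclicQ (dimhom_tau_torsion nP rK.1) (ker_ses sK eg)).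
Qed.

(* Among the regular simple subquotients of M, only T receives nonzero maps   *)
(* from P.                                                                    *)
Definition only_sees T M := forall Y S (i : 'Hom(Y, M)) (p : 'Hom(Y, S)),
  is_mono i -> is_epi p -> tau_regular Y -> regular_simple d S -> (0 < dimhom P S)%N -> isom S T.

Lemma only_sees_mono T M Z (f : 'Hom(Z, M)) : is_mono f -> only_sees T M -> only_sees T Z.
Proof. by move=> mf onlyM Y S i p mi ep; apply: onlyM (mono_comp mi mf) ep. Qed.

Lemma only_sees_epi T M Z (g : 'Hom(M, Z)) :
  tau_regular M -> tau_regular Z -> is_epi g -> only_sees T M -> only_sees T Z.
Proof.
move=> rM rZ eg onlyM Y S i p mi ep rY simS seen; have hg := epi_hom eg.
have rI := regular_sub_img acyclicQ null_d rY rZ (mono_hom mi) (regular_subf acyclicQ null_d rY).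
have rW := regular_sub_preim acyclicQ null_d rM rZ hg rI; have sW := regular_sub_submod rW.
have [|h hh hE] := mono_factor mi (is_hom_comp (sub_incl_hom sW) hg).
  by apply/subvP=> _ /memv_imgP[u _ ->]; rewrite comp_lfunE sub_inclE memv_preim subvsP.
apply: (onlyM _ _ (sub_incl sW) (p \o h)%VF) => //; first exact: sub_incl_mono.
  apply: epi_comp ep; apply/is_epiP; split=> // y; have [x gx] := epi_onto eg (i y).
  have xW : x \in (g @^-1: limg i)%VS by rewrite -memv_preim gx memv_img ?memvf.
  by exists (vsproj _ x); apply: (mono_inj mi); rewrite hE comp_lfunE sub_inclE vsprojK.
exact: (tau_regular_submod acyclicQ null_d rM sW rW).
Qed.

Lemma only_sees_ses T X M Z (f : 'Hom(X, M)) (g : 'Hom(M, Z)) :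
  tau_regular Z -> is_ses f g -> only_sees T X -> only_sees T Z -> only_sees T M.
Proof.
move=> rZ [mf eg fg] onlyX onlyZ Y S i p mi ep rY simS seen; have [rS _ onlyS] := simS.
have hgi := is_hom_comp (mono_hom mi) (epi_hom eg).
have rK := regular_sub_ker acyclicQ null_d rY rZ hgi; have sK := regular_sub_submod rK.
case: (onlyS _ (regular_sub_img acyclicQ null_d rY rS (epi_hom ep) rK)) => imgK; last first.
  have hiK := is_hom_comp (sub_incl_hom sK) (mono_hom mi).
  have [|h hh hE] := mono_factor mf hiK.
    rewrite fg; apply/subvP=> _ /memv_imgP[u _ ->]; rewrite memv_ker comp_lfunE sub_inclE.
    by rewrite -comp_lfunE -memv_ker subvsP.
  apply: (onlyX _ _ h (p \o sub_incl sK)%VF) => //.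
  - have : is_mono (f \o h)%VF; last exact: mono_of_comp.
    suff -> : (f \o h = i \o sub_incl sK)%VF by apply: mono_comp (sub_incl_mono sK) mi.
    by apply/lfunP=> u; rewrite comp_lfunE hE.
  - by rewrite /is_epi (is_hom_comp (sub_incl_hom sK) (epi_hom ep)) limg_comp limg_sub_incl imgK
    eqxx.
  exact: (tau_regular_submod acyclicQ null_d rY sK rK).
have rI := regular_sub_img acyclicQ null_d rY rZ hgi (regular_subf acyclicQ null_d rY).
have sI := regular_sub_submod rI; have [h eh hE] := img_factor sI hgi.
have [|p' hp' pE] := epi_factor eh (epi_hom ep).
  apply/subvP=> u; rewrite memv_ker => /eqP hu0; rewrite memv_ker -memv0 -imgK memv_img //.
  by rewrite memv_ker -hE hu0 linear0.
apply: (onlyZ _ _ (sub_incl sI) p') => //; first exact: sub_incl_mono.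
  by apply/is_epiP; split=> // s; have [y <-] := epi_onto ep s; exists (h y).
exact: (tau_regular_submod acyclicQ null_d rZ sI rI).
Qed.

Lemma only_sees_cover T C (pi : 'Hom(C, T)) :
  regular_simple d T -> regular_cover d P pi -> only_sees T C.
Proof.
move=> simT [rC _ epi_pi [_ _ greatest] reflects0] Y S i p mi ep rY simS seen.
have [rS nzS _] := simS; have [_ nzT _] := simT.
have rI := regular_sub_img acyclicQ null_d rY rC (mono_hom mi) (regular_subf acyclicQ null_d rY).
have [/eqP i_onto|/(greatest _ rI) img_ker] := eqVneq (limg i) fullv.
  have iso_i : is_iso i by rewrite is_isoE mi /is_epi (mono_hom mi).
  have [j [+ _ _]] := iso_inv iso_i; rewrite is_isoE => /andP[_ ej].
  have epj := epi_comp ej ep; have [|g hg gE] := epi_factor epj (epi_hom epi_pi).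
    apply: greatest; first exact: (regular_sub_ker acyclicQ null_d rC rS (epi_hom epj)).
    by rewrite lker_full epi_neq0.
  apply: (regular_simple_isom acyclicQ null_d simS simT); apply/dimhom_gt0P; exists g => //.
  apply: (contraNneq _ (epi_neq0 epi_pi nzT)) => g0.
  by apply/eqP/lfunP=> x; rewrite -gE g0 !zero_lfunE.
case/dimhom_gt0P: seen => f hf /eqP[]; have [s hs sE] := tau_nilpotent_lift rY rS ep hf.
have is0 : (i \o s)%VF = 0.
  apply: reflects0; first exact: is_hom_comp hs (mono_hom mi).
  apply/lfunP=> u; rewrite !comp_lfunE zero_lfunE; apply/eqP.
  by rewrite -memv_ker (subvP img_ker) // memv_img ?memvf.
apply/lfunP=> u; rewrite -sE zero_lfunE.
have -> : s u = 0 by apply: (mono_eq0 mi); rewrite -comp_lfunE is0 zero_lfunE.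
exact: linear0.
Qed.

Section CoveredTop.
Variables (C T : kQmodule k Q) (pi : 'Hom(C, T)).
Hypotheses (simT : regular_simple d T) (cover : regular_cover d P pi).

Let rC : tau_regular C. Proof. by case: cover. Qed.
Let rT : tau_regular T. Proof. by case: simT. Qed.
Let onlyC := only_sees_cover simT cover.

Section Step.
Variables (R : kQmodule k Q) (q : 'Hom(R, T)).
Hypotheses (rR : tau_regular R) (chain : uniserial d R) (hq : is_hom q) (q0 : q != 0).

Let sK := is_submod_ker hq.
Let rK : tau_regular (submod sK).
Proof.
exact: (tau_regular_submod acyclicQ null_d rR sK (regular_sub_ker acyclicQ null_d rR rT hq)).
Qed.

(* Then Ext^1(C, ker q) = 0 too, so that pi lifts to a map from C onto R.     *)
Lemma only_sees_of_no_maps : dimhom C (submod sK) = 0%N -> only_sees T R.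
Proof.
move=> no_maps; have [_ eulerC epi_pi _ _] := cover.
have eq := regular_simple_epi acyclicQ null_d simT rR hq q0.
have ext0 : dimhom (submod sK) (tau C) = 0%N.
  by have := euler_formula acyclicQ C (submod sK); rewrite no_maps (eulerC _ rK); lia.
have [s hs sE] := lift_ext0 acyclicQ ext0 (ker_ses sK eq) (epi_hom epi_pi).
apply: (only_sees_epi rC rR _ onlyC (g := s)); rewrite /is_epi hs /=; apply: contraT => s1.
have [_ _ greatest] := uniserial_greatest_ker acyclicQ null_d rR simT chain hq q0.
have rI := regular_sub_img acyclicQ null_d rC rR hs (regular_subf acyclicQ null_d rC).
have [_ nzT _] := simT; case/negP: (epi_neq0 epi_pi nzT); apply/eqP/lfunP=> x.
rewrite -sE zero_lfunE; apply/eqP; rewrite -memv_ker.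
by rewrite (subvP (greatest _ rI s1)) // memv_img ?memvf.
Qed.

Lemma exists_only_sees_sub : (0 < dimhom C (submod sK))%N ->
  exists X : {vspace R}, exists sX : is_submod X,
    [/\ regular_sub d X, X != 0%VS, (X <= lker q)%VS & only_sees T (submod sX)].
Proof.
case/dimhom_gt0P=> f hf f0; have hf1 := is_hom_comp hf (sub_incl_hom sK).
have rX := regular_sub_img acyclicQ null_d rC rR hf1 (regular_subf acyclicQ null_d rC).
have sX := regular_sub_submod rX; have [h eh _] := img_factor sX hf1.
exists (limg (sub_incl sK \o f)%VF), sX; split=> //.
- rewrite limg_comp -dimv_eq0 (limg_dim_lker0 _ (mono_lker0 (sub_incl_mono sK))).
  by rewrite dimv_eq0 limg_eq0.
- by rewrite limg_comp -[X in (_ <= X)%VS](limg_sub_incl sK) limgS ?subvf.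
apply: only_sees_epi rC _ eh onlyC; exact: (tau_regular_submod acyclicQ null_d rR sX rX).
Qed.

End Step.

Lemma uniserial_only_sees R (q : 'Hom(R, T)) :
  tau_regular R -> uniserial d R -> is_hom q -> q != 0 -> only_sees T R.
Proof.
have [n] := ubnP (\dim {:R}); elim: n R q => // n IH R q dimR rR chain hq q0.
have [no_maps|] := posnP (dimhom C (submod (is_submod_ker hq)));
  first exact: only_sees_of_no_maps no_maps.
case/(exists_only_sees_sub rR)=> X [sX [rX X0 Xq onlyX]].
have rQ := tau_regular_quomod acyclicQ null_d rR sX rX.
have [q' hq' qE] := quo_factor sX hq Xq.
apply: (only_sees_ses rQ (sub_quo_ses sX) onlyX); apply: (IH (quomod sX) q') => //.
- rewrite (dim_quomod sX); have := dimvS (subvf X); move: X0 dimR; rewrite -dimv_eq0; lia.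
- exact: (uniserial_epi acyclicQ null_d rR rQ (quo_proj_epi sX) chain).
by apply: contraNneq q0 => q'0; apply/eqP/lfunP=> u; rewrite -qE q'0 !zero_lfunE.
Qed.

End CoveredTop.

End OnlySees.

Section Transitivity.
Variables (k : fieldType) (Q : quiver).
Hypothesis acyclicQ : acyclic Q.
Variable d : {ffun vtx Q -> int}.
Hypothesis null_d : null_root d.
Variable P : kQmodule k Q.
Hypotheses (nP : tau_nilpotent P) (defectP : defect d P = -1).
Implicit Types M N R T : kQmodule k Q.

Definition regularly_generates R (g : 'Hom(P, R)) :=
  forall Z : {vspace R}, regular_sub d Z -> (limg g <= Z)%VS -> Z = fullv.

Lemma exists_generated_sub M (g : 'Hom(P, M)) : tau_regular M -> is_hom g ->
  exists (I : {vspace M}) (sI : is_submod I) (gI : 'Hom(P, submod sI)),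
    [/\ regular_sub d I, is_hom gI, regularly_generates gI & forall u, vsval (gI u) = g u].
Proof.
move=> rM hg; have [I [rI gI] minI] := exists_minimizer (fun I : {vspace M} => \dim I)
  (P := fun I => regular_sub d I /\ (limg g <= I)%VS)
  (ex_intro _ fullv (conj (regular_subf acyclicQ null_d rM) (subvf _))).
have sI := regular_sub_submod rI; have [h hh hE] := sub_factor sI hg gI.
exists I, sI, h; split=> // Z rZ hZ; have rSub := tau_regular_submod acyclicQ null_d rM sI rI.
have rZ' := regular_sub_img acyclicQ null_d rSub rM (sub_incl_hom sI) rZ.
apply/eqP; rewrite eqEdim subvf (dim_submod sI).
rewrite -(limg_dim_lker0 Z (mono_lker0 (sub_incl_mono sI))) minI //; split=> //.
apply/subvP=> _ /memv_imgP[u _ ->]; rewrite -hE -(sub_inclE (sX := sI)) memv_img //.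
by rewrite (subvP hZ) // memv_img ?memvf.
Qed.

Lemma generated_hom_eq0 R N (g : 'Hom(P, R)) (f : 'Hom(R, N)) :
  tau_regular R -> tau_regular N -> regularly_generates g -> is_hom f -> (f \o g)%VF = 0 -> f = 0.
Proof.
move=> rR rN gen hf fg0; apply/eqP; rewrite -lker_full.
apply/eqP/gen; first exact: (regular_sub_ker acyclicQ null_d rR rN hf).
by apply/subvP=> _ /memv_imgP[u _ ->]; rewrite memv_ker -comp_lfunE fg0 zero_lfunE.
Qed.

Lemma regular_simple_transitive T (h h' : 'Hom(P, T)) :
  regular_simple d T -> (dimhom P T <= dimhom T T)%N -> is_hom h -> is_hom h' -> h != 0 ->
  exists2 alpha : 'End(T), is_hom alpha & (alpha \o h)%VF = h'.
Proof.
move=> simT le_end hh hh' h0; have [rT _ _] := simT.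
have onto : (precomp T h @: homs T T)%VS == homs P T.
  rewrite eqEdim; apply/andP; split.
    by apply/subvP=> _ /memv_imgP[f + ->]; rewrite precompE !mem_homs; apply: is_hom_comp.
  rewrite limg_dim_in // => f; rewrite mem_homs precompE => hf fh0.
  apply: contraNeq h0 => f0; have mf := regular_simple_mono acyclicQ null_d simT rT hf f0.
  by apply/eqP/lfunP=> u; rewrite zero_lfunE; apply: (mono_eq0 mf);
    rewrite -comp_lfunE fh0 zero_lfunE.
have : h' \in homs P T by rewrite mem_homs.
by rewrite -(eqP onto) => /memv_imgP[f + ->]; rewrite precompE mem_homs => hf; exists f.
Qed.

Section Generated.
Variables (T M : kQmodule k Q) (g : 'Hom(P, M)).
Hypotheses (simT : regular_simple d T) (le_end : (dimhom P T <= dimhom T T)%N).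
Hypotheses (rM : tau_regular M) (hg : is_hom g) (gen : regularly_generates g).
Hypothesis onlyM : only_sees d P T M.

Lemma generated_top (J : {vspace M}) : maximal_regular_sub d J ->
  exists2 p : 'Hom(M, T), is_hom p & lker p = J /\ (p \o g)%VF != 0.
Proof.
move=> maxJ; have [rJ _ _] := maxJ; have sJ := regular_sub_submod rJ.
have simS := maximal_regular_simple acyclicQ null_d sJ rM maxJ; have [rS nzS _] := simS.
have ep := quo_proj_epi sJ; have hp := epi_hom ep.
have pg0 : (quo_proj J \o g)%VF != 0 :> 'Hom(P, quomod sJ).
  by apply: contraNneq (epi_neq0 ep nzS) => /(generated_hom_eq0 rM rS gen hp)->.
have seenS : (0 < dimhom P (quomod sJ))%N.
  by apply/dimhom_gt0P; exists (quo_proj J \o g)%VF; first exact: is_hom_comp hg hp.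
have [f mf _] := isom_epimono (onlyM (is_mono_id M) ep rM simS seenS).
exists (f \o quo_proj J)%VF; first exact: is_hom_comp hp (mono_hom mf).
split.
  apply/vspaceP=> u; rewrite memv_ker comp_lfunE -quo_proj0.
  by apply/eqP/eqP => [/(mono_eq0 mf)//|->]; apply: linear0.
apply: contraNneq pg0 => fpg0; apply/eqP/lfunP=> u; rewrite zero_lfunE.
by apply: (mono_eq0 mf); rewrite comp_lfunE -[f _]comp_lfunE -comp_lfunE fpg0 zero_lfunE.
Qed.

(* All maps to T are End(T)-proportional, so there is a single maximal        *)
(* regular submodule.                                                         *)
Lemma generated_uniserial : uniserial d M.
Proof.
have [M0|M0] := eqVneq (0%VS : {vspace M}) fullv.
  by move=> A B _ _; have := subvf A; rewrite -M0 subv0 => /eqP->; rewrite sub0v.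
have [J maxJ _] := exists_maximal_regular_sub (regular_sub0 d M) M0.
have [rJ J1 leJ] := maxJ; have [p hp [pJ pg0]] := generated_top maxJ; have [rT _ _] := simT.
suff greatest : greatest_regular_sub d J
  by exact: (uniserial_of_greatest_sub acyclicQ null_d rM greatest).
split=> // Z rZ Z1; have [J' maxJ' ZJ'] := exists_maximal_regular_sub rZ Z1.
apply: subv_trans ZJ' _; have [rJ' J'1 _] := maxJ'.
have [p' hp' [p'J' _]] := generated_top maxJ'.
have [alpha halpha alphaE] := regular_simple_transitive simT le_end (is_hom_comp hg hp)
  (is_hom_comp hg hp') pg0.
have p'E : p' = (alpha \o p)%VF.
  apply/eqP; rewrite -subr_eq0; apply/eqP.
  apply: (generated_hom_eq0 rM rT gen); first exact: is_homB hp' (is_hom_comp hp halpha).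
  by rewrite comp_lfunDl comp_lfunNl -comp_lfunA alphaE subrr.
have JJ' : (J <= J')%VS.
  by rewrite -pJ -p'J' p'E; apply/subvP=> u; rewrite !memv_ker comp_lfunE => /eqP->;
    rewrite linear0.
by case: (leJ _ rJ' JJ') => [->//|J'_full]; rewrite J'_full eqxx in J'1.
Qed.

End Generated.

(* M is the submodule of R (+) R generated by the image of (g, g').           *)
Lemma exists_uniserial_graph R (g g' : 'Hom(P, R)) :
  tau_regular R -> uniserial d R -> ~ is_zero R -> is_hom g -> is_hom g' -> regularly_generates g ->
  exists (M : kQmodule k Q) (h : 'Hom(P, M)) (p p' : 'Hom(M, R)),
    [/\ tau_regular M, uniserial d M, is_hom p /\ is_hom p', (lker p :&: lker p' = 0)%VS &
      (p \o h)%VF = g /\ (p' \o h)%VF = g'].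
Proof.
move=> rR chain nzR hg hg' gen.
have R0 : (0%VS : {vspace R}) != fullv by apply/eqP=> R0; apply: nzR; rewrite /is_zero -R0 dimv0.
have [J maxJ _] := exists_maximal_regular_sub (regular_sub0 d R) R0.
have [rJ _ _] := maxJ; have sJ := regular_sub_submod rJ.
have simT := maximal_regular_simple acyclicQ null_d sJ rR maxJ; have [rT nzT _] := simT.
have eq := quo_proj_epi sJ; have q0 := epi_neq0 eq nzT.
have seen : (0 < dimhom P (quomod sJ))%N.
  apply/dimhom_gt0P; exists (quo_proj J \o g)%VF; first exact: is_hom_comp hg (epi_hom eq).
  by apply: contraNneq q0 => /(generated_hom_eq0 rR rT gen (epi_hom eq))->.
have [[C [pi cover]] le_end] := exists_regular_cover acyclicQ null_d nP defectP simT seen.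
have onlyR := uniserial_only_sees acyclicQ null_d nP simT cover rR chain (epi_hom eq) q0.
have rRR := tau_regular_ses (dsum_ses R R) rR rR.
have onlyRR := only_sees_ses acyclicQ null_d rR (dsum_ses R R) onlyR onlyR.
have [I [sI [h [rI hh genI hE]]]] := exists_generated_sub rRR (dsum_pair_hom hg hg').
have rSub := tau_regular_submod acyclicQ null_d rRR sI rI.
have onlyI := only_sees_mono (sub_incl_mono sI) onlyRR.
exists (submod sI), h, (dsum_fst R R \o sub_incl sI)%VF, (dsum_snd R R \o sub_incl sI)%VF;
  split=> //.
- exact: generated_uniserial simT le_end rSub hh genI onlyI.
- by split; apply: is_hom_comp (sub_incl_hom sI) _; rewrite ?dsum_fst_hom ?dsum_snd_hom.
- apply/eqP; rewrite -subv0; apply/subvP=> u; rewrite memv_cap !memv_ker memv0 !comp_lfunE.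
  rewrite dsum_fstE dsum_sndE sub_inclE -(inj_eq (@subvs_inj _ _ _)) linear0.
  by case: (vsval u) => x y /= /andP[/eqP-> /eqP->].
split; apply/lfunP=> u; rewrite !comp_lfunE sub_inclE hE dsum_pairE.
  by rewrite dsum_fstE.
by rewrite dsum_sndE.
Qed.

Lemma uniserial_transitive R (g g' : 'Hom(P, R)) :
  tau_regular R -> uniserial d R -> is_hom g -> is_hom g' -> regularly_generates g ->
  exists2 alpha : 'End(R), is_hom alpha & (alpha \o g)%VF = g'.
Proof.
move=> rR chain hg hg' gen; have [/is_zeroP R0|nzR] := pselect (is_zero R).
  by exists 0; [exact: is_hom0 | apply/lfunP=> u; rewrite [LHS]R0 [RHS]R0].
have [M [h [p [p' [rM chainM [hp hp'] joint [phE p'hE]]]]]] :=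
  exists_uniserial_graph rR chain nzR hg hg' gen.
have ep : is_epi p.
  rewrite /is_epi hp; apply/eqP/gen; last by rewrite -phE limg_comp limgS ?subvf.
  exact: (regular_sub_img acyclicQ null_d rM rR hp (regular_subf acyclicQ null_d rM)).
have mp := uniserial_joint_mono acyclicQ null_d rM rR chainM ep hp' joint.
have iso_p : is_iso p by rewrite is_isoE mp ep.
have [j [+ pK _]] := iso_inv iso_p; rewrite is_isoE => /andP[mj _].
exists (p' \o j)%VF; first exact: is_hom_comp (mono_hom mj) hp'.
by apply/lfunP=> u; rewrite -phE -p'hE !comp_lfunE pK.
Qed.

End Transitivity.

(** * Extended Dynkin quivers *)

Section HarmonicWeight.
Variables (Q : quiver) (w : vtx Q -> nat).
Hypothesis w_gt0 : forall i, (0 < w i)%N.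
Hypothesis harmonic : forall i,
  (\sum_(a : arr Q) ((src a == i) * w (tgt a) + (tgt a == i) * w (src a)))%N = (w i).*2.
Hypothesis connected : forall p : pred (vtx Q),
  (forall a : arr Q, p (src a) = p (tgt a)) -> forall i j, p i -> p j.

Lemma harmonic_sum (F : comPzRingType) (z : vtx Q -> F) :
  \sum_(a : arr Q) ((w (tgt a))%:R * z (src a) + (w (src a))%:R * z (tgt a)) =
  \sum_i 2 * (w i)%:R * z i.
Proof.
have select (i : vtx Q) (y : F) : \sum_j (i == j)%:R * (y * z j) = y * z i.
  rewrite (bigD1 i) //= big1 ?addr0 ?eqxx ?mul1r // => j ji.
  by rewrite eq_sym (negPf ji) mul0r.
under [RHS]eq_bigr do rewrite -natrM mul2n -harmonic natr_sum mulr_suml.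
rewrite exchange_big /=; apply: eq_bigr => a _; rewrite -!select -big_split /=.
by apply: eq_bigr => j _; rewrite natrD !natrM mulrDl !mulrA.
Qed.

Definition weight_vector : {ffun vtx Q -> int} := [ffun i => (w i)%:Z].

Lemma euler_weight_vector y : euler weight_vector y = - euler y weight_vector.
Proof.
apply/eqP; rewrite -subr_eq0 opprK /euler addrACA -opprD subr_eq0 -!big_split /=; apply/eqP.
have wE i : weight_vector i = (w i)%:R by rewrite ffunE natz.
transitivity (\sum_i 2 * (w i)%:R * y i); first by apply: eq_bigr => i _; rewrite wE; ring.
by rewrite -harmonic_sum; apply: eq_bigr => a _; rewrite !wE; ring.
Qed.

Let w_neq0 i : (w i)%:R != 0 :> rat. Proof. by rewrite pnatr_eq0 -lt0n. Qed.

Lemma tits_squares (x : {ffun vtx Q -> int}) :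
  2 * (euler x x)%:~R = \sum_(a : arr Q) (w (src a))%:R * (w (tgt a))%:R *
    ((x (src a))%:~R / (w (src a))%:R - (x (tgt a))%:~R / (w (tgt a))%:R) ^+ 2 :> rat.
Proof.
rewrite /euler rmorphB !rmorph_sum mulrBr !mulr_sumr.
have -> : \sum_i 2 * (x i * x i)%:~R = \sum_i 2 * (w i)%:R * ((x i)%:~R ^+ 2 / (w i)%:R) :> rat.
  by apply: eq_bigr => i _; rewrite intrM; field.
rewrite -harmonic_sum -sumrB; apply: eq_bigr => a _; rewrite /= intrM.
by field; rewrite !w_neq0.
Qed.

Lemma tits_square_ge0 (x : {ffun vtx Q -> int}) (a : arr Q) :
  0 <= (w (src a))%:R * (w (tgt a))%:R *
    ((x (src a))%:~R / (w (src a))%:R - (x (tgt a))%:~R / (w (tgt a))%:R) ^+ 2 :> rat.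
Proof. by rewrite mulr_ge0 ?sqr_ge0 // mulr_ge0 // ler0n. Qed.

Variable i0 : vtx Q.
Hypothesis w_i0 : w i0 = 1%N.

Lemma tits_radical (x : {ffun vtx Q -> int}) : euler x x = 0 -> x = weight_vector *~ x i0.
Proof.
move=> tits0; have := tits_squares x; rewrite tits0 mulr0 => /esym/eqP.
rewrite psumr_eq0 => [/allP squares0|a _]; last exact: tits_square_ge0.
pose p i := (x i)%:~R / (w i)%:R == (x i0)%:~R :> rat.
apply/ffunP=> i; rewrite ffunMzE ffunE.
have : p i.
  apply: (connected _ (i := i0)) => [a|]; last by rewrite /p w_i0 divr1.
  have := squares0 a (mem_index_enum _).
  by rewrite !mulf_eq0 !(negPf (w_neq0 _)) /= orbb subr_eq0 /p => /eqP->.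
rewrite /p => /eqP ratio; apply/eqP; rewrite -(eqr_int rat) intrM -ratio; apply/eqP.
by rewrite mulrC divfK.
Qed.

Lemma weight_vector_null_root : null_root weight_vector.
Proof.
split=> [i|y|x|x tits0]; first by rewrite ffunE ltz_nat.
- exact: euler_weight_vector.
- rewrite -(ler0z rat) -(pmulr_rge0 _ (isT : 0 < 2 :> rat)) tits_squares.
  by apply: sumr_ge0 => a _; apply: tits_square_ge0.
by exists (x i0); apply: tits_radical.
Qed.

Lemma min_root_weight_vector (delta : {ffun vtx Q -> int}) :
  min_pos_imag_root delta -> weight_vector = delta.
Proof.
move=> [[delta0 delta_ge0 tits0] min]; have null_w := weight_vector_null_root.
have [w_pos _ _ _] := null_w; have deltaE := tits_radical tits0.
apply: min; first split=> [|i|].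
- by apply/eqP=> /ffunP/(_ i0); rewrite !ffunE w_i0.
- exact/ltW/w_pos.
- exact: null_root_isotropic null_w.
have delta_i0 : 1 <= delta i0.
  rewrite -gtz0_ge1 lt_neqAle delta_ge0 andbT eq_sym; apply: contra delta0 => /eqP i0_eq0.
  by rewrite deltaE i0_eq0 mulr0z.
by move=> i; rewrite deltaE ffunMzE -[leLHS]mulr1 ler_wpM2l // ltW.
Qed.

End HarmonicWeight.

Definition neighbour_sum (e : seq (nat * nat)) (w : nat -> nat) (i : nat) : nat :=
  sumn [seq if x.1 == i then w x.2 else if x.2 == i then w x.1 else 0%N | x <- e].

Definition graph_connected n (e : seq (nat * nat)) := forall p : pred nat,
  (forall i j, (i, j) \in e -> p i = p j) -> forall i, (i < n)%N -> p i = p 0%N.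

Definition harmonic_graph n e w := [/\ forall i j, (i, j) \in e -> (i < n)%N && (j < n)%N,
  forall i, (i < n)%N -> (0 < w i)%N, forall i, (i < n)%N -> neighbour_sum e w i = (w i).*2,
  graph_connected n e & exists2 i, (i < n)%N & w i = 1%N].

Lemma edge_mult_sum n e (w : nat -> nat) i :
  (forall x y, (x, y) \in e -> (x < n)%N && (y < n)%N) ->
  (\sum_(j < n) edge_mult e i j * w j)%N = neighbour_sum e w i.
Proof.
rewrite /edge_mult /neighbour_sum; elim: e => [|[x y] e IH] range.
  by rewrite big1 // => j _; rewrite mul0n.
rewrite /= -IH => [|u v uv]; last by apply: range; rewrite inE uv orbT.
under eq_bigr do rewrite mulnDl; rewrite big_split /=; congr (_ + _)%N.
have /andP[xn yn] := range x y (mem_head _ _).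
have [xi|xi] := eqVneq x i; [|have [yi|yi] := eqVneq y i].
- rewrite (bigD1 (Ordinal yn)) //= !xpair_eqE xi !eqxx /= mul1n big1 ?addn0 // => j jy.
  have yj : (y == j) = false by rewrite eq_sym; apply: negPf.
  rewrite !xpair_eqE yj andbF /=; case: eqP => //= ij; case: eqP => //= yi.
  by move: yj; rewrite yi ij eqxx.
- rewrite (bigD1 (Ordinal xn)) //= !xpair_eqE yi !eqxx /= orbT mul1n big1 ?addn0 // => j jx.
  have xj : (x == j) = false by rewrite eq_sym; apply: negPf.
  by rewrite !xpair_eqE xj (negPf xi).
by rewrite big1 // => j _; rewrite !xpair_eqE (negPf xi) (negPf yi) andbF.
Qed.

Section UnderlyingGraph.
Variables (Q : quiver) (n : nat) (e : seq (nat * nat)).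
Hypothesis acyclicQ : acyclic Q.

Lemma arrow_mult_sum (i : vtx Q) (w : vtx Q -> nat) :
  (\sum_(a : arr Q) ((src a == i) * w (tgt a) + (tgt a == i) * w (src a)) =
   \sum_j arrow_mult i j * w j)%N.
Proof.
under [RHS]eq_bigr => j _ do rewrite /arrow_mult -sum1dep_card big_distrl big_mkcond /=.
rewrite exchange_big /=; apply: eq_bigr => a _; have := acyclic_no_loop acyclicQ a.
have [si|si] := eqVneq (src a) i; have [ti|ti] := eqVneq (tgt a) i.
- by rewrite si ti eqxx.
- rewrite mul1n mul0n addn0 => _; rewrite (bigD1 (tgt a)) //= !xpair_eqE si !eqxx /= mul1n.
  rewrite big1 ?addn0 // => j jt.
  by rewrite !xpair_eqE eq_sym (negPf jt) andbF /= (negPf ti) andbF.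
- rewrite mul1n mul0n add0n => _; rewrite (bigD1 (src a)) //= !xpair_eqE ti !eqxx orbT mul1n.
  by rewrite big1 ?addn0 // => j jt; rewrite !xpair_eqE (negPf si) /= eq_sym (negPf jt).
by rewrite !mul0n => _; rewrite big1 // => j _; rewrite !xpair_eqE (negPf si) (negPf ti) andbF.
Qed.

Variables (f : vtx Q -> 'I_n) (g : 'I_n -> vtx Q).
Hypotheses (fK : cancel f g) (gK : cancel g f).
Hypothesis f_mult : forall i j, arrow_mult i j = edge_mult e (f i) (f j).

Lemma edge_arrow (i j : 'I_n) : (i : nat, j : nat) \in e ->
  exists a : arr Q, (src a, tgt a) = (g i, g j) \/ (src a, tgt a) = (g j, g i).
Proof.
move=> ij; have : (0 < arrow_mult (g i) (g j))%N.
  by rewrite f_mult !gK -has_count; apply/hasP; exists (i : nat, j : nat) => //=; rewrite eqxx.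
rewrite /arrow_mult card_gt0 => /set0Pn[a]; rewrite inE => /orP[]/eqP aij; exists a;
  by [left|right].
Qed.

Lemma underlying_connected : (forall i j, (i, j) \in e -> (i < n)%N && (j < n)%N) ->
  graph_connected n e -> forall p : pred (vtx Q),
  (forall a : arr Q, p (src a) = p (tgt a)) -> forall i j, p i -> p j.
Proof.
move=> range conn p p_arr i j; pose q (x : nat) := if insub x is Some y then p (g y) else false.
have qE (l : vtx Q) : q (f l) = p l by rewrite /q valK fK.
suff q_edge x y : (x, y) \in e -> q x = q y by rewrite -!qE !(conn q q_edge).
move=> xy; have /andP[xn yn] := range _ _ xy.
have q_ord l (ln : (l < n)%N) : q l = p (g (Ordinal ln)) by rewrite /q insubT.
rewrite (q_ord x xn) (q_ord y yn).
by have [a []] := @edge_arrow (Ordinal xn) (Ordinal yn) xy => -[<- <-]; rewrite p_arr.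
Qed.

End UnderlyingGraph.

Lemma harmonic_graph_null_root (Q : quiver) n e w (delta : {ffun vtx Q -> int}) :
  acyclic Q -> underlying_graph_is Q n e -> harmonic_graph n e w ->
  min_pos_imag_root delta -> null_root delta.
Proof.
move=> acyclicQ [f [[g fK gK] f_mult]] [range w_gt0 harmonic conn [i0 i0n w_i0]] min.
have wQ_gt0 i : (0 < w (f i))%N by apply: w_gt0.
have harmonicQ i : (\sum_(a : arr Q) ((src a == i) * w (f (tgt a)) +
    (tgt a == i) * w (f (src a))))%N = (w (f i)).*2.
  rewrite (arrow_mult_sum acyclicQ i (fun j => w (f j))) -harmonic // -(edge_mult_sum _ _ range).
  rewrite (reindex f) /=; last by exists g => j _.
  by apply: eq_bigr => j _; rewrite f_mult.
have connQ := underlying_connected fK gK f_mult range conn.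
have wQ_i0 : w (f (g (Ordinal i0n))) = 1%N by rewrite gK.
rewrite -(min_root_weight_vector wQ_gt0 harmonicQ connQ wQ_i0 min).
exact: (weight_vector_null_root wQ_gt0 harmonicQ connQ wQ_i0).
Qed.

Lemma graph_connectedP n e :
  (forall p : pred nat, (forall i j, (i, j) \in e -> p i = p j) ->
    forall i, (0 < i < n)%N -> exists2 j, (j < i)%N & p j = p i) ->
  graph_connected n e.
Proof.
move=> parent p p_edge i; have [m] := ubnP i; elim: m i => // m IH i im i_n.
have [->//|i_gt0] := posnP i.
have [|j ji <-] := parent p p_edge i; first by rewrite i_gt0.
by apply: IH; lia.
Qed.

Lemma neighbour_sum_cons x e w i : neighbour_sum (x :: e) w i =
  ((if x.1 == i then w x.2 else if x.2 == i then w x.1 else 0) + neighbour_sum e w i)%N.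
Proof. by []. Qed.

Lemma neighbour_sum_path w i s m :
  neighbour_sum [seq (j, j.+1) | j <- iota s m] w i =
  ((if (s <= i < s + m)%N then w i.+1 else 0) + (if (s < i <= s + m)%N then w i.-1 else 0))%N.
Proof.
elim: m s => [|m IH] s /=; first by rewrite /neighbour_sum /=; do 2?case: ifP; lia.
rewrite neighbour_sum_cons IH /=; have [->|si] := eqVneq s i; first by repeat case: ifP => ?; lia.
have [<-|si'] := eqVneq s.+1 i => /=; by repeat case: ifP => ?; lia.
Qed.

Lemma harmonic_affA n : (0 < n)%N -> harmonic_graph n.+1 (edges_affA n) (fun=> 1%N).
Proof.
move=> n_gt0; split=> [i j|//|i i_n||]; last by exists 0%N.
- rewrite inE => /orP[/eqP[-> ->]|/mapP[l + [-> ->]]]; first by rewrite ltnSn.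
  by rewrite mem_iota; lia.
- rewrite /edges_affA neighbour_sum_cons neighbour_sum_path /=.
  by do !case: ifP; lia.
apply: graph_connectedP => p p_edge i /andP[i_gt0 i_n]; exists i.-1; first by rewrite prednK.
apply: p_edge; rewrite inE; apply/orP; right; apply/mapP; exists i.-1; rewrite ?prednK // mem_iota.
lia.
Qed.

Lemma harmonic_affD n : (4 <= n)%N ->
  harmonic_graph n.+1 (edges_affD n) (fun i => if (1 < i < n - 1)%N then 2 else 1%N).
Proof.
move=> n_ge4; split=> [i j|i _|i i_n||]; last by exists 0%N.
- rewrite /edges_affD mem_cat !inE => /orP[/or4P[]/eqP[-> ->]|/mapP[l + [-> ->]]]; try lia.
  by rewrite mem_iota; lia.
- by case: ifP.
- rewrite /edges_affD /= !neighbour_sum_cons neighbour_sum_path /=.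
  by repeat (case: ifP => ?; try by lia).
apply: graph_connectedP => p p_edge i /andP[i_gt0 i_n].
have special x y : (x, y) \in [:: (0, 2); (1, 2); (n - 2, n - 1); (n - 2, n)]%N -> p x = p y.
  by move=> xy; apply: p_edge; rewrite mem_cat xy.
have [i_small|i_large] := leqP i 2.
  exists 0%N => //; have /orP[/eqP->|/eqP->] : (i == 1)%N || (i == 2)%N by lia.
    by rewrite (special 0%N 2) ?(special 1%N 2) // !inE ?eqxx ?orbT.
  by apply: special; rewrite inE eqxx.
have [i_mid|i_end] := leqP i (n - 2).
  exists i.-1; first lia.
  apply: p_edge; rewrite mem_cat; apply/orP; right.
  by apply/mapP; exists i.-1; rewrite ?prednK // mem_iota; lia.
exists (n - 2)%N => //; have /orP[/eqP->|/eqP->] : (i == n - 1)%N || (i == n)%N by lia.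
  by apply: special; rewrite !inE eqxx !orbT.
by apply: special; rewrite !inE eqxx !orbT.
Qed.

Definition harmonic_tree (ws : seq nat) (e : seq (nat * nat)) : bool :=
  let n := size ws in
  [&& all (fun x => (x.1 < n)%N && (x.2 < n)%N) e, all (leq 1) ws,
      all (fun i => neighbour_sum e (nth 0%N ws) i == (nth 0%N ws i).*2) (iota 0 n),
      all (fun i => has (fun x => (x.1 < x.2)%N && (x.2 == i)) e) (iota 1 n.-1) & 1%N \in ws].

Lemma harmonic_treeP ws e :
  harmonic_tree ws e -> harmonic_graph (size ws) e (nth 0%N ws).
Proof.
case/and5P=> /allP range /allP w_gt0 /allP harmonic /allP parent w1; split=> [i j ij|i i_n|i i_n||].
- exact: range ij.
- by apply/w_gt0/mem_nth.
- by apply/eqP/harmonic; rewrite mem_iota.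
- apply: graph_connectedP => p p_edge i i_n.
  have /hasP[[j l] jl /andP[/= jl_lt /eqP li]] : has (fun x => (x.1 < x.2)%N && (x.2 == i)) e.
    by apply: parent; rewrite mem_iota; lia.
  by exists j; rewrite -li //; apply: p_edge.
by exists (index 1%N ws); rewrite ?index_mem ?nth_index.
Qed.

Lemma tame_null_root (Q : quiver) (delta : {ffun vtx Q -> int}) :
  tame Q -> acyclic Q -> min_pos_imag_root delta -> null_root delta.
Proof.
move=> tameQ acyclicQ.
have treeE e (ws : seq nat) : harmonic_tree ws e -> underlying_graph_is Q (size ws) e ->
    min_pos_imag_root delta -> null_root delta.
  by move=> /harmonic_treeP tree graph; apply: harmonic_graph_null_root acyclicQ graph tree.
case: tameQ => [[n graphA]|[n n_ge4 graphD]|[graphE|graphE|graphE]].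
- apply: (harmonic_graph_null_root acyclicQ graphA (harmonic_affA _)).
  case: n graphA => // -[f [[g _ gK] f_mult]].
  have [|a loop] := @edge_arrow Q 1 (edges_affA 0) f g gK f_mult ord0 ord0; first by [].
  by have := acyclic_no_loop acyclicQ a; case: loop => -[-> ->]; rewrite eqxx.
- exact: harmonic_graph_null_root acyclicQ graphD (harmonic_affD n_ge4).
- exact: (treeE edges_affE6 [:: 3; 2; 1; 2; 1; 2; 1]%N isT graphE).
- exact: (treeE edges_affE7 [:: 4; 3; 2; 1; 3; 2; 1; 2]%N isT graphE).
exact: (treeE edges_affE8 [:: 6; 5; 4; 3; 2; 1; 4; 2; 3]%N isT graphE).
Qed.

(** * Short exact sequences and Hall numbers *)

Section RegularModulesAreTauRegular.
Variables (k : fieldType) (Q : quiver).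
Hypothesis acyclicQ : acyclic Q.
Implicit Types M : kQmodule k Q.

Lemma indec_regular_tau_regular M : indec_regular M -> tau_regular M.
Proof.
move=> [indec not_preproj not_preinj]; split.
  by apply: (indecomposable_torsion acyclicQ indec) => nM; apply: not_preproj; split.
apply/torsion_dual/(indecomposable_torsion (acyclic_op acyclicQ) (indecomposable_dual indec)).
by move=> nM; apply: not_preinj; split.
Qed.

Lemma tau_regular_zero : tau_regular (zero_mod : kQmodule k Q).
Proof.
have zero_eq (u v : @zero_mod k Q) : u = v by rewrite [LHS]thinmx0 [RHS]thinmx0.
split=> N _; apply/dimhom_eq0P => f _; apply/lfunP=> u; rewrite zero_lfunE.
  by rewrite (zero_eq u 0) linear0.
exact: zero_eq.
Qed.

Lemma regular_tau_regular M : regular M -> tau_regular M.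
Proof.
move=> [Rs [regRs iM]]; apply: tau_regular_isom (isom_sym iM) _.
elim: Rs regRs {iM} => [|R Rs IH] regRs /=; first exact: tau_regular_zero.
apply: tau_regular_ses (dsum_ses _ _) _ _.
  exact: indec_regular_tau_regular (regRs 0%N isT).
by apply: IH => n; apply: (regRs n.+1).
Qed.

End RegularModulesAreTauRegular.

Section SequencesWithDirectSum.
Variables (k : fieldType) (Q : quiver).
Implicit Types L M N X Y Z W : kQmodule k Q.

Lemma ses_iso_middle X Y Y' Z (f : 'Hom(X, Y)) (g : 'Hom(Y, Z)) (s : 'Hom(Y', Y)) :
  is_ses f g -> is_iso s -> exists f' : 'Hom(X, Y'), is_ses f' (g \o s)%VF.
Proof.
move=> [mf eg fg] iso_s; have [t [+ sK tK]] := iso_inv iso_s; rewrite is_isoE => /andP[mt _].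
move: iso_s; rewrite is_isoE => /andP[_ es]; exists (t \o f)%VF.
split; [exact: mono_comp mf mt | exact: epi_comp es eg |].
apply/vspaceP=> y; rewrite memv_ker comp_lfunE -memv_ker -fg; apply/memv_imgP/memv_imgP.
  by case=> x _ ->; exists x; rewrite ?memvf // comp_lfunE tK.
by case=> x _ sy; exists x; rewrite ?memvf // comp_lfunE -sy sK.
Qed.

Section Components.
Variables (X Y W Z : kQmodule k Q) (f : 'Hom(X, dsum Y W)) (g : 'Hom(dsum Y W, Z)).
Hypothesis fg : is_ses f g.

Let homg : is_hom g. Proof. by case: fg => _ /epi_hom. Qed.

Lemma ses_dsum_inr_mono : is_mono (dsum_fst Y W \o f)%VF -> is_mono (g \o dsum_inr Y W)%VF.
Proof.
move=> mf1; apply/is_monoP; split=> [|w]; first exact: is_hom_comp (dsum_inr_hom Y W) homg.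
rewrite comp_lfunE => gw0; have [_ _ imf] := fg.
have : dsum_inr Y W w \in limg f by rewrite imf memv_ker gw0.
case/memv_imgP=> x _ wE; have x0 : x = 0.
  by apply: (mono_eq0 mf1); rewrite comp_lfunE -wE dsum_fstE dsum_inrE.
by apply: (mono_eq0 (dsum_inr_mono Y W)); rewrite wE x0 linear0.
Qed.

Lemma ses_dsum_quo (sI : is_submod (limg (g \o dsum_inr Y W)%VF)) :
  is_mono (dsum_fst Y W \o f)%VF ->
  is_ses (dsum_fst Y W \o f)%VF
    (quo_proj (limg (g \o dsum_inr Y W)%VF) \o (g \o dsum_inl Y W) : 'Hom(Y, quomod sI))%VF.
Proof.
move=> mf1; have [_ eg imf] := fg; split=> //.
  apply/is_epiP; split=> [|v].
    exact: is_hom_comp (is_hom_comp (dsum_inl_hom Y W) homg) (quo_proj_hom sI).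
  have [z <-] := epi_onto (quo_proj_epi sI) v; have [[y w] <-] := epi_onto eg z.
  exists y; rewrite comp_lfunE; apply: quo_projE.
  by rewrite (dsum_copair_eta g) opprD addrA subrr add0r memvN memv_img ?memvf.
apply/vspaceP=> y; rewrite memv_ker comp_lfunE quo_proj0;
  apply/memv_imgP/memv_imgP => [[x _ ->]|[w _ yw]].
  have : f x \in lker g by rewrite -imf memv_img ?memvf.
  rewrite memv_ker (dsum_copair_eta g) addr_eq0 => /eqP fx; exists (- (f x).2); rewrite ?memvf //.
  by rewrite [(dsum_fst Y W \o f)%VF x]comp_lfunE dsum_fstE fx linearN.
have : (y, - w) \in lker g by rewrite memv_ker (dsum_copair_eta g) linearN /= yw subrr.
by rewrite -imf => /memv_imgP[x _ xE]; exists x; rewrite ?memvf // comp_lfunE dsum_fstE -xE.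
Qed.

End Components.

Lemma ses_dsum_glue X Y W M Z (f1 : 'Hom(X, Y)) (q : 'Hom(Y, Z)) (g2 : 'Hom(W, M))
    (p : 'Hom(M, Z)) (g1 : 'Hom(Y, M)) :
  is_ses f1 q -> is_ses g2 p -> is_hom g1 -> (forall y, p (g1 y) = q y) ->
  exists f : 'Hom(X, dsum Y W), is_ses f (dsum_copair g1 g2).
Proof.
move=> f1q g2p hg1 pg1; have [mf1 eq imf1] := f1q; have [mg2 _ img2] := g2p.
have [|f2 hf2 f2E] := mono_factor mg2 (is_hom_comp (mono_hom mf1) hg1).
  rewrite img2; apply/subvP=> _ /memv_imgP[x _ ->].
  by rewrite memv_ker comp_lfunE pg1 (ses_comp0 _ f1q).
exists (dsum_pair f1 (- f2)); have hf := dsum_pair_hom (mono_hom mf1) (is_homN hf2); split.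
- by apply/is_monoP; split=> // x; rewrite dsum_pairE => -[/(mono_eq0 mf1)].
- apply/is_epiP; split=> [|m]; first exact: dsum_copair_hom hg1 (mono_hom mg2).
  have [y yE] := epi_onto eq (p m); have : m - g1 y \in limg g2.
    by rewrite img2 memv_ker linearB /= pg1 yE subrr.
  by case/memv_imgP=> w _ wE; exists (y, w); rewrite dsum_copairE /= -wE addrC subrK.
apply/vspaceP=> -[y w]; rewrite memv_ker dsum_copairE /=; apply/memv_imgP/eqP => [[x _]|yw0].
  by rewrite dsum_pairE => -[-> ->]; rewrite opp_lfunE linearN /= f2E comp_lfunE subrr.
have g1y : g1 y = - g2 w by apply/eqP; rewrite -addr_eq0 yw0.
have : y \in limg f1 by rewrite imf1 memv_ker -pg1 g1y linearN /= (ses_comp0 _ g2p) oppr0.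
case/memv_imgP=> x _ yE; exists x; rewrite ?memvf // dsum_pairE -yE; congr pair.
by apply: (mono_inj mg2); rewrite opp_lfunE linearN /= f2E comp_lfunE -yE g1y opprK.
Qed.

End SequencesWithDirectSum.

Section Sequences.
Variables (k : fieldType) (Q : quiver).
Hypothesis acyclicQ : acyclic Q.
Variable d : {ffun vtx Q -> int}.
Hypothesis null_d : null_root d.
Variables P P' R R' : kQmodule k Q.
Hypotheses (nP : tau_nilpotent P) (defectP : defect d P = -1).
Hypotheses (nP' : tau_nilpotent P') (defectP' : defect d P' = -1).
Hypotheses (rR : tau_regular R) (chainR : uniserial d R) (rR' : tau_regular R').

Lemma ses_fst_mono (f : 'Hom(P, dsum P' R')) (g : 'Hom(dsum P' R', R)) :
  is_ses f g -> is_mono (dsum_fst P' R' \o f)%VF.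
Proof.
move=> fg; have [mf eg imf] := fg; have hf1 := is_hom_comp (mono_hom mf) (dsum_fst_hom P' R').
apply: (defect_m1_mono acyclicQ null_d nP nP' defectP hf1); apply/negP=> /eqP f1_eq0.
have [|h hh hE] := epi_factor eg (dsum_fst_hom P' R').
  rewrite -imf; apply/subvP=> _ /memv_imgP[x _ ->].
  by rewrite memv_ker -comp_lfunE f1_eq0 zero_lfunE.
have h0 : h = 0 by have /dimhom_eq0P := rR.1 _ nP'; apply.
apply: (defect_m1_nonzero defectP'); apply/is_zeroP=> u.
by have := hE (dsum_inl P' R' u); rewrite h0 zero_lfunE dsum_fstE dsum_inlE.
Qed.

Lemma submod_of_ses (f : 'Hom(P, dsum P' R')) (g : 'Hom(dsum P' R', R)) : is_ses f g ->
  exists (X : {vspace R}) (sX : is_submod X), isom (submod sX) R' /\ short_exact P P' (quomod sX).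
Proof.
move=> fg; have mf1 := ses_fst_mono fg; have mg2 := ses_dsum_inr_mono fg mf1.
have sI := is_submod_limg (mono_hom mg2); exists (limg (g \o dsum_inr P' R')%VF), sI.
split; first exact/isom_sym/mono_isom_img.
exact: ses_short_exact (ses_dsum_quo fg sI mf1).
Qed.

Lemma ses_of_submod (X : {vspace R}) (sX : is_submod X) :
  isom (submod sX) R' -> short_exact P P' (quomod sX) -> short_exact P (dsum P' R') R.
Proof.
move=> iX /short_exactP[f1 [q f1q]]; have [e me ee] := isom_epimono (isom_sym iX).
have tX : torsion (submod sX) := torsion_isom (isom_sym iX) rR'.1.
have [_ eq _] := f1q; have mg2 := mono_comp me (sub_incl_mono sX).
have [g1 hg1 g1E] := lift_ext0 acyclicQ (dimhom_tau_torsion nP' tX) (sub_quo_ses sX) (epi_hom eq).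
have g2p : is_ses (sub_incl sX \o e)%VF (quo_proj X : 'Hom(R, quomod sX)).
  split=> //; first exact: quo_proj_epi.
  by rewrite limg_comp (epi_limg ee) limg_sub_incl lker_quo_proj.
by have [f /ses_short_exact] := ses_dsum_glue f1q g2p hg1 g1E.
Qed.

Lemma uniserial_mono_automorphic (h h' : 'Hom(R', R)) :
  is_mono h -> is_mono h' -> exists2 beta : 'End(R'), is_iso beta & (h \o beta)%VF = h'.
Proof.
move=> mh mh'.
have rI u := regular_sub_img acyclicQ null_d rR' rR u (regular_subf acyclicQ null_d rR').
have same_img : limg h = limg h'.
  have same_dim : \dim (limg h) = \dim (limg h') by rewrite !limg_dim_lker0 ?mono_lker0.
  case/orP: (chainR (rI _ (mono_hom mh)) (rI _ (mono_hom mh'))) => sub; apply/eqP.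
    by rewrite eqEdim sub same_dim /=.
  by rewrite eq_sym eqEdim sub same_dim /=.
have [|beta hbeta betaE] := mono_factor mh (mono_hom mh'); first by rewrite same_img.
have hbetaE : (h \o beta)%VF = h' by apply/lfunP=> u; rewrite comp_lfunE betaE.
exists beta => //; apply: mono_dimvec_iso => //.
by apply: (mono_of_comp (g := h) hbeta); rewrite hbetaE.
Qed.

Lemma generators_automorphic (h h' : 'Hom(P', R)) : is_hom h -> is_hom h' ->
  regularly_generates d h -> regularly_generates d h' ->
  exists2 alpha : 'End(R), is_mono alpha & (alpha \o h)%VF = h'.
Proof.
move=> hh hh' gen gen'.
have [alpha halpha alphaE] := uniserial_transitive acyclicQ null_d nP' defectP' rR chainR hh hh'
  gen.
have [alpha' halpha' alphaE'] :=
  uniserial_transitive acyclicQ null_d nP' defectP' rR chainR hh' hh gen'.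
exists alpha => //; apply: (mono_of_comp (g := alpha') halpha).
suff -> : (alpha' \o alpha)%VF = \1%VF by apply: is_mono_id.
apply/eqP; rewrite -subr_eq0; apply/eqP; apply: (generated_hom_eq0 acyclicQ null_d rR rR gen).
  exact: is_homB (is_hom_comp halpha halpha') (is_hom_id R).
by rewrite comp_lfunDl comp_lfunNl comp_lfun1l -comp_lfunA alphaE alphaE' subrr.
Qed.

Lemma ses_inl_generates (f : 'Hom(P, dsum P' R')) (g : 'Hom(dsum P' R', R)) :
  is_ses f g -> ~ isom R R' -> regularly_generates d (g \o dsum_inl P' R')%VF.
Proof.
move=> fg not_iso Z rZ gZ; have mg2 := ses_dsum_inr_mono fg (ses_fst_mono fg).
have [_ eg _] := fg; have hg2 := mono_hom mg2.
have rX := regular_sub_img acyclicQ null_d rR' rR hg2 (regular_subf acyclicQ null_d rR').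
have XZ : (limg (g \o dsum_inr P' R')%VF + Z = fullv)%VS.
  apply/eqP; rewrite eqEsubv subvf /= -(epi_limg eg); apply/subvP=> _ /memv_imgP[u _ ->].
  rewrite (dsum_copair_eta g) addrC memv_add ?memv_img ?memvf //.
  by rewrite (subvP gZ) // memv_img ?memvf.
case/orP: (chainR rX rZ) => [/addv_idPr XZE|/addv_idPl XZE]; first by rewrite -XZE XZ.
case: not_iso; apply/isom_sym/(isomI mg2); rewrite /is_epi hg2 /=.
by rewrite -[X in X == _]XZE XZ eqxx.
Qed.

(* Up to Aut R every surjection has the same first component, and then the    *)
(* second one is determined up to Aut R'.                                     *)
Lemma ses_transitive (f f' : 'Hom(P, dsum P' R')) (g g' : 'Hom(dsum P' R', R)) :
  is_ses f g -> is_ses f' g' -> ~ isom R R' ->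
  exists2 beta : 'End(R'), is_iso beta &
    lker (dsum_copair (g \o dsum_inl P' R')%VF (g \o dsum_inr P' R' \o beta)%VF) = lker g'.
Proof.
move=> fg fg' not_iso; have [_ /epi_hom hg _] := fg; have [_ /epi_hom hg' _] := fg'.
have mg2 := ses_dsum_inr_mono fg (ses_fst_mono fg).
have mg2' := ses_dsum_inr_mono fg' (ses_fst_mono fg').
have [alpha malpha alphaE] := generators_automorphic (is_hom_comp (dsum_inl_hom P' R') hg')
  (is_hom_comp (dsum_inl_hom P' R') hg) (ses_inl_generates fg' not_iso)
  (ses_inl_generates fg not_iso).
have [beta iso_beta betaE] := uniserial_mono_automorphic mg2 (mono_comp mg2' malpha).
exists beta => //; rewrite betaE -alphaE.
have alphag u :
    dsum_copair (alpha \o (g' \o dsum_inl P' R'))%VF (alpha \o (g' \o dsum_inr P' R'))%VF u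
    = alpha (g' u).
  by rewrite dsum_copairE [in RHS](dsum_copair_eta g') linearD /= [in LHS]comp_lfunE; congr (_ + _);
    apply: comp_lfunE.
apply/vspaceP=> u; rewrite !memv_ker alphag.
by apply/eqP/eqP => [/(mono_eq0 malpha)|->]; rewrite ?linear0.
Qed.

End Sequences.

Lemma ncard_bij (T U : choiceType) (A : set T) (B : set U) (F : T -> U) : finite_set A ->
  (forall x, A x -> B (F x)) -> (forall x y, A x -> A y -> F x = F y -> x = y) ->
  (forall y, B y -> exists2 x, A x & F x = y) -> ncard A = ncard B.
Proof.
move=> finA FB F_inj F_onto; have -> : B = (F @` A)%classic.
  by apply/seteqP; split=> [y /F_onto[x Ax <-]|_ [x Ax <-]]; [exists x|apply: FB].
rewrite /ncard fset_set_image // card_in_imfset // => x y.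
by rewrite !in_fset_set // => /set_mem Ax /set_mem Ay; apply: F_inj.
Qed.

Section GraphSubmodules.
Variables (k : fieldType) (Q : quiver) (P P' R R' : kQmodule k Q).
Variables (phi : 'Hom(P, P')) (psi : 'Hom(R, R')).
Hypotheses (iso_phi : is_iso phi) (iso_psi : is_iso psi).
Implicit Type h : 'Hom(P, R).

Let mono_phi : is_mono phi. Proof. by move: iso_phi; rewrite is_isoE => /andP[]. Qed.
Let mono_psi : is_mono psi. Proof. by move: iso_psi; rewrite is_isoE => /andP[]. Qed.

Definition graph_map h : 'Hom(P, dsum P' R') := dsum_pair phi (psi \o h)%VF.

Lemma graph_mapE h u : graph_map h u = (phi u, psi (h u)).
Proof. by rewrite dsum_pairE comp_lfunE. Qed.

Lemma graph_map_ses h : is_hom h -> exists q : 'Hom(dsum P' R', R), is_ses (graph_map h) q.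
Proof.
move=> hh; have [phi' [+ phiK phi'K]] := iso_inv iso_phi;
  rewrite is_isoE => /andP[/mono_hom hphi' _].
have [psi' [+ psiK psi'K]] := iso_inv iso_psi; rewrite is_isoE => /andP[/mono_hom hpsi' _].
have hq := dsum_copair_hom (is_homN (is_hom_comp hphi' hh)) hpsi'.
have qE u : dsum_copair (- (h \o phi')%VF) psi' u = psi' u.2 - h (phi' u.1).
  by rewrite dsum_copairE opp_lfunE comp_lfunE addrC.
exists (dsum_copair (- (h \o phi')%VF) psi'); split.
- apply/is_monoP; split=> [|u].
    exact: dsum_pair_hom (mono_hom mono_phi) (is_hom_comp hh (mono_hom mono_psi)).
  by rewrite graph_mapE => -[/(mono_eq0 mono_phi)].
- by apply/is_epiP; split=> // x; exists (0, psi x); rewrite qE /= psiK !linear0 addr0.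
apply/vspaceP=> -[p r]; rewrite memv_ker qE subr_eq0 /=; apply/memv_imgP/eqP => [[u _]|rE].
  by rewrite graph_mapE => -[-> ->]; rewrite psiK phiK.
by exists (phi' p); rewrite ?memvf // graph_mapE phi'K -rE psi'K.
Qed.

Lemma limg_graph_map_inj h h' : limg (graph_map h) = limg (graph_map h') -> h = h'.
Proof.
move=> same_graph; apply/lfunP=> u; apply: (mono_inj mono_psi).
have : graph_map h u \in limg (graph_map h') by rewrite -same_graph memv_img ?memvf.
by case/memv_imgP=> v _; rewrite !graph_mapE => -[/(mono_inj mono_phi)-> ->].
Qed.

Lemma exists_graph_map (f : 'Hom(P, dsum P' R')) : is_hom f -> is_iso (dsum_fst P' R' \o f)%VF ->
  exists2 h, is_hom h & limg (graph_map h) = limg f.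
Proof.
move=> hf iso_f1; have [j [+ f1K jK]] := iso_inv iso_f1; rewrite is_isoE => /andP[/mono_hom hj _].
have [psi' [+ _ psi'K]] := iso_inv iso_psi; rewrite is_isoE => /andP[/mono_hom hpsi' _].
have [phi' [_ _ phi'K]] := iso_inv iso_phi; have hjphi := is_hom_comp (mono_hom mono_phi) hj.
exists (psi' \o (dsum_snd P' R' \o (f \o (j \o phi))))%VF.
  exact: is_hom_comp (is_hom_comp (is_hom_comp hjphi hf) (dsum_snd_hom P' R')) hpsi'.
set h := (psi' \o _)%VF; have graphE u : graph_map h u = f (j (phi u)).
  have fst_fj : (f (j (phi u))).1 = phi u by rewrite -dsum_fstE -comp_lfunE jK.
  by rewrite graph_mapE !comp_lfunE psi'K dsum_sndE [RHS]surjective_pairing fst_fj.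
apply/vspaceP=> w; apply/memv_imgP/memv_imgP => -[u _ ->].
  by exists (j (phi u)); rewrite ?memvf.
by exists (phi' (dsum_fst P' R' (f u))); rewrite ?memvf // graphE phi'K -[X in j X]comp_lfunE f1K.
Qed.

End GraphSubmodules.

Section HallNumbers.
Variables (k : finFieldType) (Q : quiver).
Hypothesis acyclicQ : acyclic Q.
Variable d : {ffun vtx Q -> int}.
Hypothesis null_d : null_root d.
Variables P P' R R' : kQmodule k Q.
Hypotheses (nP : tau_nilpotent P) (defectP : defect d P = -1).
Hypotheses (nP' : tau_nilpotent P') (defectP' : defect d P' = -1).
Hypotheses (rR : tau_regular R) (chainR : uniserial d R) (rR' : tau_regular R').
Variables (f : 'Hom(P, dsum P' R')) (g : 'Hom(dsum P' R', R)).
Hypothesis fg : is_ses f g.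

Let fst_mono (f' : 'Hom(P, dsum P' R')) (g' : 'Hom(dsum P' R', R)) (fg' : is_ses f' g') :
    is_mono (dsum_fst P' R' \o f')%VF :=
  ses_fst_mono acyclicQ null_d nP defectP nP' defectP' rR fg'.

(* The submodules counted are the graphs of the maps from P to R'.            *)
Lemma hall_isom : isom R R' -> hall R P (dsum P' R') = ncard (hom_set P R).
Proof.
move=> iR; have [psi iso_psi] := iR.
have same_dimvec : dimvec P = dimvec P'.
  have := dimvec_ses fg; rewrite (dimvec_ses (dsum_ses P' R')) (dimvec_isom iR).
  by move/addIr.
have fst_iso (f' : 'Hom(P, dsum P' R')) (g' : 'Hom(dsum P' R', R)) :
    is_ses f' g' -> is_iso (dsum_fst P' R' \o f')%VF.
  by move=> fg'; apply: (mono_dimvec_iso (fst_mono fg')).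
have iso_phi := fst_iso _ _ fg.
apply/esym/(@ncard_bij _ _ _ _ (fun h => limg (graph_map (dsum_fst P' R' \o f)%VF psi h))).
- exact: finite_lfun_set.
- move=> h hh; apply/hall_setP; have [q hq] := graph_map_ses iso_phi iso_psi hh.
  by exists (graph_map (dsum_fst P' R' \o f)%VF psi h), q; split=> //; case: hq.
- by move=> h h' _ _; apply: limg_graph_map_inj.
move=> Y /hall_setP[f' [g' [fg' <-]]]; have [mf' _ <-] := fg'.
have [h hh hE] := exists_graph_map iso_phi iso_psi (mono_hom mf') (fst_iso _ _ fg').
by exists h.
Qed.

Let g1 := (g \o dsum_inl P' R')%VF.
Let g2 := (g \o dsum_inr P' R')%VF.

Definition twist (beta : 'End(R')) : 'Hom(dsum P' R', R) := dsum_copair g1 (g2 \o beta)%VF.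

Lemma twist_ses beta : is_iso beta -> exists f' : 'Hom(P, dsum P' R'), is_ses f' (twist beta).
Proof.
move=> iso_beta; have := iso_beta; rewrite is_isoE => /andP[mb eb].
pose s := dsum_pair (dsum_fst P' R') (beta \o dsum_snd P' R')%VF.
have sE u : s u = (u.1, beta u.2) by rewrite dsum_pairE comp_lfunE dsum_fstE dsum_sndE.
have hs : is_hom s.
  exact: dsum_pair_hom (dsum_fst_hom P' R') (is_hom_comp (dsum_snd_hom P' R') (mono_hom mb)).
have iso_s : is_iso s.
  rewrite is_isoE; apply/andP; split.
    by apply/is_monoP; split=> // -[u v]; rewrite sE => -[/= -> /(mono_eq0 mb)->].
  by apply/is_epiP; split=> // -[u v]; have [w <-] := epi_onto eb v; exists (u, w); rewrite sE.
have -> : twist beta = (g \o s)%VF; last exact: ses_iso_middle fg iso_s.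
apply/lfunP=> u; rewrite dsum_copairE [RHS]comp_lfunE sE (dsum_copair_eta g) /=.
by congr (_ + _); apply: comp_lfunE.
Qed.

Hypothesis not_iso : ~ isom R R'.

Lemma lker_twist_inj beta beta' : is_iso beta -> is_iso beta' ->
  lker (twist beta) = lker (twist beta') -> beta = beta'.
Proof.
move=> /twist_ses[_ [_ eb _]] /twist_ses[_ [_ eb' _]] same_ker.
have [alpha /and3P[halpha _ _] alphaE] := epi_same_ker_iso eb eb' same_ker.
have gen : regularly_generates d g1 :=
  ses_inl_generates acyclicQ null_d nP defectP nP' defectP' rR chainR rR' fg not_iso.
have alpha1 : alpha = \1%VF.
  apply/eqP; rewrite -subr_eq0; apply/eqP.
  apply: (generated_hom_eq0 acyclicQ null_d rR rR gen); first exact: is_homB halpha (is_hom_id R).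
  apply/lfunP=> p; rewrite comp_lfunE add_lfunE opp_lfunE id_lfunE zero_lfunE.
  by have := alphaE (p, 0); rewrite !dsum_copairE /= !linear0 !addr0 => ->; rewrite subrr.
have mg2 : is_mono g2 := ses_dsum_inr_mono fg (fst_mono fg).
apply/lfunP=> r; apply: (mono_inj mg2); have := alphaE (0, r).
by rewrite alpha1 id_lfunE !dsum_copairE /= !linear0 !add0r ![(_ \o _)%VF r]comp_lfunE.
Qed.

Lemma hall_not_isom : hall R P (dsum P' R') = ncard (aut_set R').
Proof.
apply/esym/(@ncard_bij _ _ _ _ (fun beta => lker (twist beta))).
- exact: finite_lfun_set.
- move=> beta /twist_ses[f' fg']; apply/hall_setP.
  by exists f', (twist beta).
- exact: lker_twist_inj.
move=> Y /hall_setP[f' [g' [fg' <-]]].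
exact: (ses_transitive acyclicQ null_d nP defectP nP' defectP' rR chainR rR' fg fg' not_iso).
Qed.

End HallNumbers.

Theorem proposition5p3 (k : finFieldType) (Q : quiver)
    (tameQ : tame Q) (acyclicQ : acyclic Q)
    (delta : {ffun vtx Q -> int}) (delta_root : min_pos_imag_root delta)
    (P P' R R' : kQmodule k Q)
    (preprojP : preprojective P) (defectP : defect delta P = -1)
    (preprojP' : preprojective P') (defectP' : defect delta P' = -1)
    (regR : indec_regular R) (regR' : regular R') :
  (short_exact P (dsum P' R') R <->
   exists (X : {vspace R}) (sX : is_submod X),
     isom (submod sX) R' /\ short_exact P P' (quomod sX)) /\
  (short_exact P (dsum P' R') R ->
   (isom R R' -> hall R P (dsum P' R') = ncard (hom_set P R)) /\
   (~ isom R R' -> hall R P (dsum P' R') = ncard (aut_set R'))).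
Proof.
have null_delta := tame_null_root tameQ acyclicQ delta_root.
have [[_ nP] [_ nP']] := (preprojP, preprojP'); have [indecR _ _] := regR.
have rR := indec_regular_tau_regular acyclicQ regR.
have rR' := regular_tau_regular acyclicQ regR'.
have chainR := indecomposable_uniserial acyclicQ null_delta rR indecR.
split; [split | move/short_exactP=> [f [g fg]]; split].
- move/short_exactP=> [f [g fg]].
  exact: (submod_of_ses acyclicQ null_delta nP defectP nP' defectP' rR fg).
- by move=> [X [sX [iX sesX]]]; apply: (ses_of_submod acyclicQ nP' rR' iX sesX).
- exact: (hall_isom acyclicQ null_delta nP defectP nP' defectP' rR fg).
exact: (hall_not_isom acyclicQ null_delta nP defectP nP' defectP' rR chainR rR' fg).
Qed.
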